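(* Let $\Omega\subset\mathbb{R}^2$ be a bounded, convex polygon, $s\in(\tfrac12,1)$, $\mathcal{D}\subset\Omega$ a finite set, $\{\mathfrak{u}_z\}_{z\in\mathcal{D}}\subset\mathbb{R}$, $\alpha>0$, $\mathfrak{f}\in L^2(\Omega)$, and $-\infty<a<b<\infty$. Put $\mathbb{Q}_{ad}=\{v\in L^2(\Omega): a\le v(x)\le b \text{ for a.e. } x\in\Omega\}$ and $$J(\mathfrak{u},q)=\frac12\sum_{z\in\mathcal{D}}|\mathfrak{u}(z)-\mathfrak{u}_z|^2+\frac{\alpha}{2}\|q\|_{L^2(\Omega)}^2 .$$ Then the problem of minimizing $J(\mathfrak{u},q)$ over all $(\mathfrak{u},q)\in\mathbb{H}^s(\Omega)\times\mathbb{Q}_{ad}$ subject to the state equation $$\mathcal{B}(\mathfrak{u},v)=\int_\Omega(\mathfrak{f}+q)v\,dx\qquad\forall v\in\mathbb{H}^s(\Omega)$$ has a unique solution $(\bar{\mathfrak{u}},\bar q)\in\mathbb{H}^s(\Omega)\times\mathbb{Q}_{ad}$.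
   Context: $\{(\lambda_k,\varphi_k)\}_{k\ge1}\subset\mathbb{R}^+\times H_0^1(\Omega)$ are the eigenpairs of the Dirichlet Laplacian, i.e. $\int_\Omega\nabla\varphi_k\cdot\nabla v\,dx=\lambda_k\int_\Omega\varphi_k v\,dx$ for all $v\in H_0^1(\Omega)$, with $\{\varphi_k\}$ an orthonormal basis of $L^2(\Omega)$. For $r\ge0$, $\mathbb{H}^r(\Omega)=\{w=\sum_k w_k\varphi_k:\ \sum_k\lambda_k^r|w_k|^2<\infty\}$ with norm $\|w\|_{\mathbb{H}^r(\Omega)}=(\sum_k\lambda_k^r|w_k|^2)^{1/2}$. The bilinear form is $\mathcal{B}:\mathbb{H}^s(\Omega)\times\mathbb{H}^s(\Omega)\to\mathbb{R}$, $\mathcal{B}(v,w)=\sum_{k}\lambda_k^s v_k w_k$. For each $q\in L^2(\Omega)$ the state equation has a unique solution $\mathfrak{u}\in\mathbb{H}^s(\Omega)$; it belongs to $\mathbb{H}^{2s}(\Omega)\hookrightarrow C(\bar\Omega)$ (as $s>\tfrac12$), so the point values $\mathfrak{u}(z)$ in $J$ are those of its continuous representative. *)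

(* Defs.v *)
From HB Require Import structures.
From mathcomp Require Import all_boot all_order all_algebra.
From mathcomp Require Import all_classical all_reals all_analysis.
Set Implicit Arguments.
Unset Strict Implicit.
Unset Printing Implicit Defensive.
Import Order.TTheory GRing.Theory Num.Theory.
Import numFieldNormedType.Exports.
Local Open Scope classical_set_scope.
Local Open Scope ring_scope.

Section Defs.
Context {R : realType}.
Implicit Types (Omega : set (R * R)) (u v w f q : R * R -> R).
Implicit Types (g h : R * R -> R * R).

Definition leb2 : {measure set (measurableTypeR R * measurableTypeR R) -> \bar R} :=
  (@lebesgue_measure R \x @lebesgue_measure R)%E.

(* Open, nondegenerate; bounded because the vertex set V is finite. *)
Definition convex_polygon Omega :=
  Omega !=set0 /\
  exists2 V : set (R * R), finite_set V &
    Omega = interior (smallest (@convex_set R (R * R)%type) V).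

(* An element of L^2(Omega) is given by a representative on the whole plane;
   only its values on Omega matter, and elements are compared with eq_ae. *)
Definition L2 Omega f := (f \_ Omega) \in Lfun leb2 2%:E.

Definition L2dot Omega f w : R := (\int[leb2]_(x in Omega) (f x * w x))%R.

Definition L2norm Omega f : R := fine 'N[leb2]_2%:E[EFin \o (f \_ Omega)]%E.

Definition eq_ae Omega f w := ae_eq leb2 Omega f w.

Definition L2cvg Omega (F : nat -> R * R -> R) f :=
  L2norm Omega (F n \- f) @[n --> \oo] --> 0.

Definition smooth f :=
  forall (l : seq (R * R)) (x : R * R),
    differentiable (foldr (fun d F => 'D_d F) f l : R * R -> R) x.

Definition test_function Omega f :=
  [/\ smooth f, compact (closure [set x | f x != 0])
    & closure [set x | f x != 0] `<=` Omega].

Definition grad f : R * R -> R * R := fun x => ('D_(1, 0) f x, 'D_(0, 1) f x).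

Definition L2_weak_grad Omega u g :=
  [/\ L2 Omega (fst \o g), L2 Omega (snd \o g)
    & forall f, test_function Omega f ->
        L2dot Omega u (fst \o grad f) = - L2dot Omega (fst \o g) f /\
        L2dot Omega u (snd \o grad f) = - L2dot Omega (snd \o g) f].

(* Closure of the test functions in the H^1 norm. *)
Definition H10 Omega u :=
  L2 Omega u /\
  exists2 g, L2_weak_grad Omega u g &
    exists F : nat -> R * R -> R,
      [/\ forall n, test_function Omega (F n),
          L2cvg Omega F u,
          L2cvg Omega (fun n => fst \o grad (F n)) (fst \o g)
        & L2cvg Omega (fun n => snd \o grad (F n)) (snd \o g)].

Definition grad_dot Omega g h : R :=
  L2dot Omega (fst \o g) (fst \o h) + L2dot Omega (snd \o g) (snd \o h).

(* The weak gradient is unique up to a.e. equality and exists on H^1_0, so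
   quantifying over all g and h selects the gradients of u and v. *)
Definition dirichlet_eigenpair Omega (lam : R) u :=
  [/\ 0 < lam, H10 Omega u
    & forall v g h, H10 Omega v ->
        L2_weak_grad Omega u g -> L2_weak_grad Omega v h ->
        grad_dot Omega g h = lam * L2dot Omega u v].

Section Spectral.
Variables (Omega : set (R * R)) (lam : nat -> R) (phi : nat -> R * R -> R).

Definition orthonormal_basis :=
  [/\ forall k, L2 Omega (phi k),
      forall j k, L2dot Omega (phi j) (phi k) = (j == k)%:R
    & forall f, L2 Omega f ->
        L2cvg Omega
          (fun n x => \sum_(k < n) L2dot Omega f (phi k) * phi k x) f].

Definition dirichlet_eigensystem :=
  (forall k, dirichlet_eigenpair Omega (lam k) (phi k)) /\ orthonormal_basis.

Definition coef w (k : nat) : R := L2dot Omega w (phi k).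

(* Meaningful for r >= 0, where H^r(Omega) is a subspace of L^2(Omega). *)
Definition Hspace (r : R) w :=
  L2 Omega w /\ cvgn (series (fun k => lam k `^ r * `|coef w k| ^+ 2)).

Definition Bform (s : R) v w : R :=
  limn (series (fun k => lam k `^ s * coef v k * coef w k)).

Definition state_equation (s : R) f u q :=
  forall v, Hspace s v -> Bform s u v = L2dot Omega (f \+ q) v.

End Spectral.

(* Two functions that are continuous on the open set Omega and agree a.e. on it
   agree on Omega, so this determines the value at z in Omega; the default 0 is
   returned only if u has no continuous representative, which does not happen
   for solutions of the state equation when s > 1/2. *)
Definition point_value Omega u (z : R * R) : R :=
  xget 0 [set c | exists v,
    [/\ {in Omega, continuous v}, eq_ae Omega v u & c = v z]].

Definition Qad Omega (a b : R) q :=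
  L2 Omega q /\ {ae leb2, forall x, Omega x -> a <= q x <= b}.

Definition J Omega (D : set (R * R)) (ud : R * R -> R) (alpha : R) u q : R :=
  2^-1 * (\sum_(z \in D) `|point_value Omega u z - ud z| ^+ 2)
  + alpha / 2 * L2norm Omega q ^+ 2.

Definition admissible Omega lam phi (s : R) f (a b : R) u q :=
  [/\ Hspace Omega lam phi s u, Qad Omega a b q
    & state_equation Omega lam phi s f u q].

Definition optimal Omega lam phi (s : R) D ud (alpha : R) f (a b : R) u q :=
  admissible Omega lam phi s f a b u q /\
  forall v p, admissible Omega lam phi s f a b v p ->
    J Omega D ud alpha u q <= J Omega D ud alpha v p.

End Defs.

(* Main.v *)
From HB Require Import structures.
Require Import Defs.
From mathcomp Require Import all_boot all_order all_algebra.
From mathcomp Require Import all_classical all_reals all_analysis.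
From mathcomp Require Import measurable_realfun ring lra.
Import Order.TTheory GRing.Theory Num.Theory.
Import numFieldNormedType.Exports.
Local Open Scope classical_set_scope.
Local Open Scope ring_scope.
Set Implicit Arguments.
Unset Strict Implicit.
Unset Printing Implicit Defensive.


(** Testing the state equation with the eigenfunctions shows that the state of a
    control q is the function u with coefficients lam_k ^ (- s) g_k, g = f + q.
    It exists because Poincare's inequality keeps the lam_k away from 0
    (eigenvalue_ge, riesz_fischer, solves_exists). Everything then depends on
    one fact, solves_representative: such a u has a continuous representative on
    Omega whose value at each point is bounded by a constant times the norm of g,
    the interior form of the embedding of H^(2 s) into C(Omega).

    This embedding is proved without regularity theory. Let kern t x be a smooth
    bump on the disc of radius sqrt t around x, of mass independent of t. In
    dimension 2 its t-derivative dkern t x is the Laplacian of a test function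
    zeta t x (laplacian_zeta, is_derive_kern). The weak form of the eigenvalue
    problem therefore says that the coefficients of dkern t x are - lam_k times
    those of zeta t x (eigen_weak), and Bessel's inequality for these two
    functions bounds the t-derivative of the average <u, kern t x> by
    77 |g| t ^ (s - 3 / 2) (dkern_estimate). For s > 1 / 2 this is integrable at
    t = 0, so the averages converge as t tends to 0, uniformly near every point
    of Omega, to a continuous function (point_limit_continuous). Testing against
    test functions, which are dense because the eigenfunctions lie in H^1_0,
    identifies the limit with u times the mass of the kernel
    (point_limit_eq_mass).

    Point values are thus affine and bounded as functions of the control
    (point_value_control), so the cost of a midpoint lies below the mean of the
    costs by at least alpha / 8 |p - q| ^ 2 (cost_mid). Hence a minimizing sequence
    of controls is Cauchy and converges in L^2 (sqint_complete). The limit satisfies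
    the bounds (Qad_closed), and the cost is continuous along the sequence
    (cvg_cost), so the limit is optimal. Two optimal controls agree almost
    everywhere by the same inequality, and then so do their states. *)


(** * Lebesgue measure on the plane *)

Section plane.
Context {R : realType}.
Implicit Types (O A : set (R * R)).
Local Notation mplane := (measurableTypeR R * measurableTypeR R)%type.

Definition rat_box (q : rat * rat * rat * rat) : set (R * R) :=
  let: (a, b, c, d) := q in `]ratr a, ratr b[ `*` `]ratr c, ratr d[.

Lemma measurable_box (i j : interval R) :
  measurable ([set` i] `*` [set` j] : set mplane).
Proof. by apply: measurableX; exact: measurable_itv. Qed.

(** Rational boxes form a countable base of the topology. Both measurability of
    open sets and the passage from local to global null sets rest on it. *)
Lemma rat_box_nbhs O x : nbhs x O ->
  exists q, rat_box q x /\ rat_box q `<=` O.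
Proof.
move=> /nbhs_ballP[e /= e0 eO].
have [a] := @rat_in_itvoo R (x.1 - e) x.1 ltac:(lra).
have [b] := @rat_in_itvoo R x.1 (x.1 + e) ltac:(lra).
have [c] := @rat_in_itvoo R (x.2 - e) x.2 ltac:(lra).
have [d] := @rat_in_itvoo R x.2 (x.2 + e) ltac:(lra).
rewrite !in_itv/= => /andP[d1 d2] /andP[c1 c2] /andP[b1 b2] /andP[a1 a2].
exists (a, b, c, d); split; first by split; rewrite /= in_itv/=; apply/andP; split.
move=> y [/=]; rewrite !in_itv/= => /andP[y1 y2] /andP[y3 y4].
by apply: eO; split; rewrite /ball/= ltr_norml; apply/andP; split; lra.
Qed.

Lemma open_measurable2 O : open O -> measurable (O : set mplane).
Proof.
rewrite openE => oO.
have -> : O = \bigcup_(q in [set: rat * rat * rat * rat])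
    (if `[< rat_box q `<=` O >] then rat_box q else set0).
  apply/seteqP; split=> [x /oO /rat_box_nbhs [q [qx qO]]|x [q _]].
    by exists q => //; case: asboolP.
  by case: asboolP => // + qx; apply.
apply: countable_bigcupT_measurable => // -[[[a b] c] d].
by case: ifP => _; [exact: measurable_box|exact: measurable0].
Qed.

Lemma open_continuous_measurable2 O (f : R * R -> R) :
  open O -> {in O, continuous f} -> measurable_fun (O : set mplane) f.
Proof.
move=> oO cf; apply: (measurability _ (RGenOInfty.measurableE R)).
move=> /= _ [_ [a ->]] <-; apply: open_measurable2.
rewrite openE => x [Ox]; rewrite /= in_itv/= andbT => ax.
apply: filterI; first exact: open_nbhs_nbhs.
have : f y @[y --> x] --> f x by apply: cf; rewrite inE.
move=> /(_ `]a, +oo[%classic); apply; apply: open_nbhs_nbhs.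
by split; [exact: interval_open|rewrite /= in_itv/= ax].
Qed.

Lemma leb2_box (a b c d : R) : a <= b -> c <= d ->
  leb2 (`]a, b[ `*` `]c, d[) = ((b - a) * (d - c))%:E.
Proof.
move=> ab cd; rewrite /leb2/=.
transitivity (lebesgue_measure `]a, b[%classic * lebesgue_measure `]c, d[%classic)%E.
  rewrite -(@product_measure1E _ _ (measurableTypeR R) (measurableTypeR R) R
    lebesgue_measure lebesgue_measure `]a, b[%classic `]c, d[%classic) //.
rewrite !lebesgue_measure_itv/= !lte_fin EFinM -!EFinB.
have [?|ba] := ltP a b; last first.
  by rewrite mul0e (_ : b - a = 0) ?mul0e//; lra.
have [//|dc] := ltP c d.
by rewrite mule0 (_ : d - c = 0) ?mule0//; lra.
Qed.

Lemma leb2_open_gt0 O x : open O -> O x -> (0 < leb2 O)%E.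
Proof.
move=> oO Ox; have [[[[a b] c] d] [[/= abx cdx] bO]] := rat_box_nbhs (open_nbhs_nbhs (conj oO Ox)).
move: abx cdx; rewrite !in_itv/= => /andP[ax xb] /andP[cx xd].
apply: (@lt_le_trans _ _ (leb2 (rat_box (a, b, c, d)))); last first.
  apply: le_measure => //; rewrite inE; [exact: measurable_box|exact: open_measurable2].
rewrite /= leb2_box ?lte_fin; [|lra|lra].
by apply: mulr_gt0; lra.
Qed.

(** Countably many rational boxes meet A in a null set, and by hypothesis they
    cover O. *)
Lemma negligible_locally O (A : set (R * R)) :
  (forall x, O x -> exists2 U, nbhs x U & leb2.-negligible (A `&` U)) ->
  leb2.-negligible (A `&` O).
Proof.
move=> Oae.
pose F (q : rat * rat * rat * rat) : set (R * R) :=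
  if `[< leb2.-negligible (A `&` rat_box q) >] then A `&` rat_box q else set0.
have FN q : leb2.-negligible (F q).
  by rewrite /F; case: asboolP => // _; exact: negligible_set0.
pose G n := if unpickle n is Some q then F q else set0.
apply: (@negligibleS _ mplane R leb2 (\bigcup_n G n)).
  move=> x [Ax /Oae[U xU UN]]; have [q [qx qU]] := rat_box_nbhs xU.
  exists (pickle q); first exact: Logic.I.
  rewrite /G pickleK /F; case: asboolP => [_|]; first by split.
  case; apply: (@negligibleS _ mplane R leb2 (A `&` U)) => //.
  by move=> y [Ay /qU].
have GN n : leb2.-negligible (G n).
  rewrite /G; case: unpickle => [q|]; first exact: FN.
  exact: (@negligible_set0 _ mplane R leb2).
exact: (@negligible_bigcup _ mplane R leb2 G GN).
Qed.

End plane.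

(** * Square-integrable functions *)

Section square_integrable.
Context d (T : measurableType d) (R : realType).
Variables (mu : {measure set T -> \bar R}) (D : set T).
Hypothesis mD : measurable D.
Implicit Types f g h : T -> R.

Definition sqint f :=
  measurable_fun D f /\ mu.-integrable D (EFin \o (fun x => f x ^+ 2)).

Definition dot f g : R := (\int[mu]_(x in D) (f x * g x))%R.

Definition nrm f : R := Num.sqrt (dot f f).

Lemma le_integrableR f g : measurable_fun D f ->
  mu.-integrable D (EFin \o g) -> (forall x, D x -> `|f x| <= g x) ->
  mu.-integrable D (EFin \o f).
Proof.
move=> mf ig fg; apply: (le_integrable mD _ _ ig); first exact/measurable_EFinP.
by move=> x Dx; rewrite /= lee_fin (le_trans (fg _ Dx))// ler_norm.
Qed.

Lemma integrableDR f g : mu.-integrable D (EFin \o f) ->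
  mu.-integrable D (EFin \o g) -> mu.-integrable D (EFin \o (f \+ g)).
Proof. by move=> f1 g1; have := integrableD mD f1 g1; apply: eq_integrable. Qed.

Lemma integrableZR c f : mu.-integrable D (EFin \o f) ->
  mu.-integrable D (EFin \o (fun x => c * f x)).
Proof. by move=> f1; have := integrableZl mD c f1; apply: eq_integrable. Qed.

Lemma sqint_mul f g : sqint f -> sqint g ->
  mu.-integrable D (EFin \o (f \* g)).
Proof.
move=> [mf f2] [mg g2]; have fg := integrableDR f2 g2.
apply: (le_integrableR _ fg); first exact: measurable_funM.
move=> x Dx /=; rewrite ler_norml; apply/andP; split; nra.
Qed.

Lemma sqintZ c f : sqint f -> sqint (fun x => c * f x).
Proof.
move=> [mf f2]; split; first exact: measurable_funM.
have := integrableZR (c ^+ 2) f2; apply: eq_integrable => // x _ /=.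
by rewrite exprMn.
Qed.

Lemma sqintD f g : sqint f -> sqint g -> sqint (f \+ g).
Proof.
move=> f2 g2; have [[mf if2] [mg ig2]] := (f2, g2).
split; first exact: measurable_funD.
apply: (@le_integrableR _ (fun x => 2 * f x ^+ 2 + 2 * g x ^+ 2)).
- by apply: measurable_funX; exact: measurable_funD.
- exact: (integrableDR (integrableZR _ if2) (integrableZR _ ig2)).
- by move=> x _ /=; rewrite ger0_norm ?sqr_ge0//; have := sqr_ge0 (f x - g x); nra.
Qed.

Lemma sqintB f g : sqint f -> sqint g -> sqint (f \- g).
Proof.
move=> f2 /(sqintZ (-1)) /(sqintD f2); congr sqint.
by apply/funext => x /=; rewrite mulN1r.
Qed.

Lemma sqint0 : sqint (fun=> 0).
Proof.
split; first exact: measurable_cst.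
have := integrable0 mu D; apply: eq_integrable => // x _ /=.
by rewrite expr0n.
Qed.

Lemma sqint_sum (I : Type) (s : seq I) (F : I -> T -> R) :
  (forall i, sqint (F i)) -> sqint (fun x => \sum_(i <- s) F i x).
Proof.
move=> F2; elim: s => [|i s IH].
  by under eq_fun do rewrite big_nil; exact: sqint0.
by under eq_fun do rewrite big_cons; exact: (sqintD (F2 i) IH).
Qed.

Lemma dotC f g : dot f g = dot g f.
Proof. by apply: eq_Rintegral => x _; rewrite mulrC. Qed.

Lemma dotDl f g h : sqint f -> sqint g -> sqint h ->
  dot (f \+ g) h = dot f h + dot g h.
Proof.
move=> f2 g2 h2; rewrite /dot -RintegralD//; try exact: sqint_mul.
by apply: eq_Rintegral => x _; rewrite /= mulrDl.
Qed.

Lemma dotZl c f g : sqint f -> sqint g ->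
  dot (fun x => c * f x) g = c * dot f g.
Proof.
move=> f2 g2; rewrite /dot -RintegralZl//; last exact: (sqint_mul f2 g2).
by apply: eq_Rintegral => x _; rewrite mulrA.
Qed.

Lemma dotBl f g h : sqint f -> sqint g -> sqint h ->
  dot (f \- g) h = dot f h - dot g h.
Proof.
move=> f2 g2 h2.
have -> : f \- g = f \+ (fun x => (-1) * g x).
  by apply/funext => x /=; rewrite mulN1r.
by rewrite dotDl ?dotZl ?mulN1r//; exact: sqintZ.
Qed.

Lemma dot0l f : dot (fun=> 0) f = 0.
Proof.
rewrite /dot; under eq_Rintegral do rewrite mul0r.
by rewrite Rintegral_cst// mul0r.
Qed.

Lemma dotDr f g h : sqint f -> sqint g -> sqint h ->
  dot h (f \+ g) = dot h f + dot h g.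
Proof. by move=> *; rewrite dotC dotDl// !(dotC h). Qed.

Lemma dotBr f g h : sqint f -> sqint g -> sqint h ->
  dot h (f \- g) = dot h f - dot h g.
Proof. by move=> *; rewrite dotC dotBl// !(dotC h). Qed.

Lemma dotZr c f g : sqint f -> sqint g ->
  dot g (fun x => c * f x) = c * dot g f.
Proof. by move=> *; rewrite dotC dotZl// dotC. Qed.

Lemma dot_suml (I : Type) (s : seq I) (F : I -> T -> R) g :
  (forall i, sqint (F i)) -> sqint g ->
  dot (fun x => \sum_(i <- s) F i x) g = \sum_(i <- s) dot (F i) g.
Proof.
move=> F2 g2; elim: s => [|i s IH].
  by under [in LHS]eq_fun do rewrite big_nil; rewrite big_nil dot0l.
rewrite big_cons -IH -dotDl//; last exact: sqint_sum.
by congr dot; apply/funext => x; rewrite big_cons.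
Qed.

Lemma dot_ge0 f : 0 <= dot f f.
Proof. by apply: Rintegral_ge0 => x _; rewrite -expr2 sqr_ge0. Qed.

Lemma dotBB f g : sqint f -> sqint g ->
  dot (f \- g) (f \- g) = dot f f - 2 * dot f g + dot g g.
Proof.
move=> f2 g2; have fg := sqintB f2 g2.
by rewrite dotBl// !dotBr// (dotC g f); ring.
Qed.

Lemma dotDD f g : sqint f -> sqint g ->
  dot (f \+ g) (f \+ g) = dot f f + 2 * dot f g + dot g g.
Proof.
move=> f2 g2; have fg := sqintD f2 g2.
by rewrite dotDl// !dotDr// (dotC g f); ring.
Qed.

Lemma dot_sqr_le f g : sqint f -> sqint g ->
  dot f g ^+ 2 <= dot f f * dot g g.
Proof.
move=> f2 g2; set A := dot f f; set B := dot f g; set C := dot g g.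
(* Cauchy-Schwarz: A - 2 c B + c ^ 2 C has a constant sign in c. *)
have key c : 0 <= A - 2 * c * B + c ^+ 2 * C.
  have := dot_ge0 (f \- (fun x => c * g x)).
  rewrite dotBB//; last exact: sqintZ.
  by rewrite !dotZr ?dotZl//; [rewrite -/A -/B -/C => h; lra|exact: sqintZ].
have A0 : 0 <= A := dot_ge0 f.
have C0 : 0 <= C := dot_ge0 g.
have [CE|Cn] := eqVneq C 0.
  have [->|Bn] := eqVneq B 0; first by rewrite expr0n/= mulr_ge0.
  (* With C = 0 the form is affine in c, and this c makes it negative. *)
  have := key ((A + 1) / B).
  rewrite CE mulr0 addr0 -mulrA -(mulrA (A + 1)) mulVf// mulr1 => h; lra.
have := key (B / C).
have {Cn} C1 : 0 < C by rewrite lt_neqAle eq_sym Cn.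
rewrite expr_div_n => h.
have : 0 <= (A - 2 * (B / C) * B + B ^+ 2 / C ^+ 2 * C) * C by apply: mulr_ge0.
suff -> : (A - 2 * (B / C) * B + B ^+ 2 / C ^+ 2 * C) * C = A * C - B ^+ 2.
  by move=> ?; lra.
by field; lra.
Qed.

Lemma nrm_ge0 f : 0 <= nrm f. Proof. exact: sqrtr_ge0. Qed.

Lemma nrm_sqr f : nrm f ^+ 2 = dot f f.
Proof. by rewrite /nrm sqr_sqrtr// dot_ge0. Qed.

Lemma dot_norm_le f g : sqint f -> sqint g -> `|dot f g| <= nrm f * nrm g.
Proof.
move=> f2 g2; rewrite -(@ler_pXn2r _ 2)// ?nnegrE ?mulr_ge0 ?nrm_ge0//.
by rewrite exprMn !nrm_sqr real_normK ?num_real//; exact: dot_sqr_le.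
Qed.

Lemma nrm_triangle f g : sqint f -> sqint g -> nrm (f \+ g) <= nrm f + nrm g.
Proof.
move=> f2 g2; rewrite -(@ler_pXn2r _ 2)// ?nnegrE ?addr_ge0 ?nrm_ge0//.
rewrite sqrrD !nrm_sqr dotDD//.
have := le_trans (ler_norm _) (dot_norm_le f2 g2); lra.
Qed.

Lemma nrmB f g : nrm (f \- g) = nrm (g \- f).
Proof.
by rewrite /nrm; congr Num.sqrt; apply: eq_Rintegral => x _ /=; ring.
Qed.

Lemma nrmZ c f : sqint f -> nrm (fun x => c * f x) = `|c| * nrm f.
Proof.
move=> f2; rewrite /nrm dotZl ?dotZr//; last exact: sqintZ.
by rewrite mulrA -expr2 sqrtrM ?sqr_ge0// sqrtr_sqr.
Qed.

Lemma nrm_le f c : 0 <= c -> dot f f <= c ^+ 2 -> nrm f <= c.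
Proof.
move=> c0 fc; rewrite -(@ler_pXn2r _ 2)// ?nnegrE ?nrm_ge0//.
by rewrite nrm_sqr.
Qed.

Lemma ae_sqint f g : measurable_fun D g -> ae_eq mu D f g ->
  sqint f -> sqint g.
Proof.
move=> mg fg [mf f2]; split => //.
have mg2 : measurable_fun D (EFin \o (fun x => g x ^+ 2)).
  by apply/measurable_EFinP; exact: measurable_funX.
apply/integrableP; split => //.
have /integrableP[mf2 /(le_lt_trans _)] := f2; apply.
rewrite (ae_eq_integral (fun x => `|(f x ^+ 2)%:E|%E))//.
- exact: measurableT_comp.
- exact: measurableT_comp.
- by apply: filterS fg => x fg Dx /=; rewrite fg.
Qed.

Lemma ae_dot f g h : sqint f -> sqint g -> sqint h -> ae_eq mu D f g ->
  dot f h = dot g h.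
Proof.
move=> f2 g2 h2 fg; rewrite /dot /Rintegral; congr fine.
apply: ae_eq_integral => //.
- by have /measurable_int := sqint_mul f2 h2.
- by have /measurable_int := sqint_mul g2 h2.
- by apply: filterS fg => x fg Dx /=; rewrite fg.
Qed.

Lemma dot0_ae f : sqint f -> dot f f = 0 -> ae_eq mu D f (fun=> 0).
Proof.
move=> [mf f2] f0.
have : (\int[mu]_(x in D) `|(f x ^+ 2)%:E| = 0)%E.
  transitivity (\int[mu]_(x in D) (f x ^+ 2)%:E)%E.
    by apply: eq_integral => x _; rewrite gee0_abs// lee_fin sqr_ge0.
  rewrite -[LHS]fineK; last exact: (integrable_fin_num mD f2).
  congr (_%:E); rewrite -[RHS]f0; apply: eq_Rintegral => x _.
  by rewrite expr2.
move/ae_eq_integral_abs => /(_ mD) h.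
have := h ltac:(by apply/measurable_EFinP; exact: measurable_funX).
apply: filterS => x /[apply] -[] /eqP.
by rewrite sqrf_eq0 => /eqP.
Qed.

Lemma dot_indep_ae f g : sqint f -> sqint g ->
  dot (f \- g) (f \- g) = 0 -> ae_eq mu D f g.
Proof.
move=> f2 g2 /(dot0_ae (sqintB f2 g2)); apply: filterS => x /[apply] /= /eqP.
by rewrite subr_eq0 => /eqP.
Qed.

End square_integrable.

(** * Completeness of L^2 *)

Section completeness.
Context d (T : measurableType d) (R : realType).
Variables (mu : {measure set T -> \bar R}) (D : set T).
Hypothesis mD : measurable D.
Implicit Types (f g : T -> R) (F : nat -> T -> R) (c : R).
Local Notation sqint := (sqint mu D).
Local Notation dot := (dot mu D).
Local Notation nrm := (nrm mu D).

Lemma int_sqrE f : sqint f -> (\int[mu]_(x in D) (f x ^+ 2)%:E)%E = (dot f f)%:E.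
Proof.
move=> [mf f2]; rewrite -[LHS]fineK; last exact: (integrable_fin_num mD f2).
by congr (_%:E); apply: eq_Rintegral => x _; rewrite expr2.
Qed.

Lemma limn_einf_le (u : (\bar R)^nat) (c : \bar R) : (forall n, (u n <= c)%E) ->
  (limn_einf u <= c)%E.
Proof.
move=> uc; rewrite limn_einf_lim; apply: lime_le; first exact: is_cvg_einfs.
apply: nearW => n; apply: le_trans (uc n).
by apply: ereal_inf_lbound; exists n => //=.
Qed.

(** Fatou's lemma makes the unit balls of L^2 closed under a.e. limits. *)
Lemma fatou_sqint F f c : (forall n, sqint (F n)) ->
  measurable_fun D f -> {ae mu, forall x, D x -> F n x @[n --> \oo] --> f x} ->
  (forall n, dot (F n) (F n) <= c) -> sqint f /\ dot f f <= c.
Proof.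
move=> F2 mf Ff Fc.
have mF n : measurable_fun D (fun x => (F n x ^+ 2)%:E).
  by apply/measurable_EFinP/measurable_funX; have [] := F2 n.
have mf2 : measurable_fun D (fun x => (f x ^+ 2)%:E).
  by apply/measurable_EFinP/measurable_funX.
have le : (\int[mu]_(x in D) (f x ^+ 2)%:E <= c%:E)%E.
  apply: (@le_trans _ _ (limn_einf (fun n => \int[mu]_(x in D) (F n x ^+ 2)%:E)%E)).
    rewrite (ae_eq_integral (fun x => limn_einf (fun n => (F n x ^+ 2)%:E)))//.
    - apply: fatou => // n x _; by rewrite lee_fin sqr_ge0.
    - under eq_fun do rewrite limn_einf_lim.
      rewrite (_ : (fun x => _) = (fun x => - limn_esup (fun n => - (F n x ^+ 2)%:E))%E).
        apply: measurableT_comp => //; apply: measurable_fun_limn_esup => n.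
        by apply: measurableT_comp.
      by apply/funext => x; rewrite -limn_einf_lim.
    - apply: filterS Ff => x Ffx Dx.
      have h : (F n x ^+ 2)%:E @[n --> \oo] --> (f x ^+ 2)%:E.
        by apply: cvg_EFin; [exact: nearW|apply: cvgM; exact: Ffx].
      by rewrite (cvg_limn_einf_sup h).
  by apply: limn_einf_le => n; rewrite int_sqrE// lee_fin.
have f2 : sqint f.
  split => //; apply/integrableP; split => //=.
  under eq_integral => x _ do rewrite ger0_norm ?sqr_ge0//.
  by rewrite (le_lt_trans le)// ltry.
by split => //; rewrite -lee_fin -int_sqrE.
Qed.

(** Weighting the increments by 4 ^ j leaves the sum of their squares
    integrable, hence finite a.e., and then the increments decay like 2 ^ -j. *)
Lemma ae_cvg_fast S : (forall j, sqint (S j)) ->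
  (forall j, nrm (S j.+1 \- S j) <= 4^-1 ^+ j) ->
  {ae mu, forall x, D x -> cvgn (S ^~ x)}.
Proof.
move=> S2 Sfast.
have dS2 j : sqint (S j.+1 \- S j) by apply: sqintB.
pose h j x := ((2 ^+ j * (S j.+1 x - S j x)) ^+ 2)%:E.
have h2 j : sqint (fun x => 2 ^+ j * (S j.+1 \- S j) x) by apply: sqintZ.
have mh j : measurable_fun D (h j).
  by apply/measurable_EFinP/measurable_funX; have [] := h2 j.
have h0 j x : D x -> (0 <= h j x)%E by move=> _; rewrite lee_fin sqr_ge0.
have hint j : (\int[mu]_(x in D) h j x <= (2^-1 ^+ j)%:E)%E.
  rewrite (int_sqrE (h2 j)) lee_fin -nrm_sqr nrmZ//.
  rewrite ger0_norm ?exprn_ge0// exprMn.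
  apply: (@le_trans _ _ ((2 ^+ j) ^+ 2 * (4^-1 ^+ j) ^+ 2)).
    rewrite ler_wpM2l ?sqr_ge0// ler_pXn2r ?nnegrE ?nrm_ge0//.
  rewrite -!exprM !(mulnC j) !exprM -exprMn.
  rewrite lerXn2r ?nnegrE//; try lra.
have intH : mu.-integrable D (fun x => \sum_(0 <= j <oo) h j x)%E.
  apply/integrableP; split.
    apply: ge0_emeasurable_sum => [j x Dx _|j _]; [exact: h0|exact: mh].
  rewrite (eq_integral (fun x => \sum_(0 <= j <oo) h j x)%E); last first.
    move=> x /set_mem Dx; rewrite gee0_abs//.
    by apply: nneseries_ge0 => n _ _; exact: h0.
  rewrite integral_nneseries//.
  apply: (@le_lt_trans _ _ (\sum_(0 <= j <oo) (geometric 1 2^-1 j)%:E)%E).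
    apply: lee_nneseries => [j _ _|j _].
      by apply: integral_ge0 => x; exact: h0.
    by rewrite /geometric /= mul1r.
  rewrite (_ : limn _ = (1 / (1 - 2^-1))%:E) ?ltry//; apply/cvg_lim => //.
  rewrite (_ : (fun n => _) = EFin \o series (geometric 1 2^-1 : R ^nat)); last first.
    by apply/funext => n; rewrite /= sumEFin.
  apply: cvg_EFin; first exact: nearW.
  by apply: cvg_geometric_series; rewrite ger0_norm ?invr_ge0// invf_lt1// ltr1n.
have := integrable_ae mD intH; apply: filterS => x /[apply] Hx.
pose H : R := fine (\sum_(0 <= j <oo) h j x)%E.
have dle j : `|S j.+1 x - S j x| <= Num.sqrt H * 2^-1 ^+ j.
  have : (h j x <= \sum_(0 <= j <oo) h j x)%E.
    apply: (@le_trans _ _ (\sum_(0 <= i < j.+1) h i x)%E).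
      rewrite big_nat_recr//= leeDr// sume_ge0// => i _.
      by rewrite lee_fin sqr_ge0.
    by apply: nneseries_lim_ge => i _ _; rewrite lee_fin sqr_ge0.
  rewrite -(fineK Hx) lee_fin -/H => hj.
  have H0 : 0 <= H by apply: le_trans hj; exact: sqr_ge0.
  have -> : `|S j.+1 x - S j x| = 2^-1 ^+ j * Num.sqrt ((2 ^+ j * (S j.+1 x - S j x)) ^+ 2).
    rewrite sqrtr_sqr normrM ger0_norm ?exprn_ge0// mulrA -exprMn mulVf ?expr1n ?mul1r//.
  by rewrite mulrC ler_wpM2r ?exprn_ge0 ?invr_ge0// ler_wsqrtr.
have cv : cvgn (series (telescope (S ^~ x))).
  apply: normed_cvg; rewrite /normed_series_of /=.
  apply: (@series_le_cvg _ _ (geometric (Num.sqrt H) 2^-1)) => //=.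
  by apply: is_cvg_geometric_series; rewrite ger0_norm ?invr_ge0// invf_lt1// ltr1n.
rewrite (_ : S ^~ x = (fun n => S 0%N x + series (telescope (S ^~ x)) n)).
  by apply: is_cvgD => //; exact: is_cvg_cst.
by apply/funext => n; rewrite -eq_sum_telescope.
Qed.

(** The limit is taken pointwise along a rapidly converging subsequence S.
    Fatou's lemma for the differences F n - S j, with n fixed, then bounds the
    distance of the whole sequence to that limit. *)
Lemma sqint_complete F : (forall n, sqint (F n)) ->
  (forall e, 0 < e -> exists N : nat, forall n m, (N <= n)%N -> (N <= m)%N ->
     nrm (F n \- F m) <= e) ->
  exists2 f, sqint f & forall e, 0 < e -> exists N : nat, forall n, (N <= n)%N ->
     nrm (F n \- f) <= e.
Proof.
move=> F2 CF.
have /choice[N HN] (j : nat) : exists N : nat, forall n m, (N <= n)%N -> (N <= m)%N ->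
    nrm (F n \- F m) <= 4^-1 ^+ j.
  by apply: CF; rewrite exprn_gt0.
(* Adding up the thresholds N gives a nondecreasing choice of indices. *)
pose k j := (\sum_(i < j.+1) N i)%N.
have kN i j : (i <= j)%N -> (N i <= k j)%N.
  move=> ij; rewrite /k (bigD1 (Ordinal (ij : (i < j.+1)%N)))//=.
  exact: leq_addr.
pose S j := F (k j).
have Sae : {ae mu, forall x, D x -> cvgn (S ^~ x)}.
  apply: ae_cvg_fast => [j|j]; first exact: F2.
  by apply: HN; apply: kN.
pose f x := fine (limn_esup (fun j => (S j x)%:E)).
have mf : measurable_fun D f.
  apply: (measurableT_comp (fine_measurable measurableT)).
  apply: measurable_fun_limn_esup => j; apply/measurable_EFinP.
  by have [] := F2 (k j).
have Sf : {ae mu, forall x, D x -> S j x @[j --> \oo] --> f x}.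
  apply: filterS Sae => x Sx Dx; have {}Sx := Sx Dx.
  have h : (S j x)%:E @[j --> \oo] --> (limn (S ^~ x))%:E.
    by apply: cvg_EFin; [exact: nearW|].
  by rewrite /f (cvg_limn_einf_sup h).
have key j n : (N j <= n)%N ->
    sqint (F n \- f) /\ dot (F n \- f) (F n \- f) <= (4^-1 ^+ j) ^+ 2.
  move=> jn; apply: (@fatou_sqint (fun i => F n \- S (i + j)%N)).
  - by move=> i; exact: (sqintB mD (F2 n) (F2 _)).
  - by apply: measurable_funB => //; have [] := F2 n.
  - apply: filterS Sf => x Sx Dx; apply: cvgB; first exact: cvg_cst.
    have := Sx Dx; rewrite -(cvg_shiftn j); exact.
  - move=> i; rewrite -nrm_sqr ler_pXn2r ?nnegrE ?nrm_ge0 ?exprn_ge0 ?invr_ge0//.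
    by apply: HN => //; apply: kN; rewrite leq_addl.
have f2 : sqint f.
  have [h _] := key 0%N (N 0%N) (leqnn _).
  rewrite (_ : f = F (N 0%N) \- (F (N 0%N) \- f)); first exact: sqintB.
  by apply/funext => x /=; rewrite opprB addrC subrK.
exists f => // e e0.
have [j je] : exists j, 4^-1 ^+ j <= e.
  have := @cvg_geometric R 1 4^-1 ltac:(by rewrite ger0_norm ?invr_ge0// invf_lt1// ltr1n).
  move/cvgrPdist_lt => /(_ _ e0)[j _ /(_ j (leqnn _))].
  rewrite sub0r normrN /geometric /= mul1r => /ltW h; exists j.
  by apply: le_trans h; exact: ler_norm.
exists (N j) => n /key[_ h]; apply: le_trans je.
by apply: nrm_le => //; rewrite exprn_ge0// invr_ge0.
Qed.

End completeness.

(** * Orthonormal bases *)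

Section hilbert_basis.
Context d (T : measurableType d) (R : realType).
Variables (mu : {measure set T -> \bar R}) (D : set T).
Hypothesis mD : measurable D.
Local Notation sqint := (sqint mu D).
Local Notation dot := (dot mu D).
Local Notation nrm := (nrm mu D).
Variable phi : nat -> T -> R.
Hypothesis phi2 : forall k, sqint (phi k).
Hypothesis phi_orth : forall j k, dot (phi j) (phi k) = (j == k)%:R.
Hypothesis phi_basis : forall f, sqint f ->
  nrm ((fun x => \sum_(k < n) dot f (phi k) * phi k x) \- f) @[n --> \oo] --> 0.

Lemma sqint_lincomb (I : Type) (s : seq I) (c : I -> R) (g : I -> nat) :
  sqint (fun x => \sum_(i <- s) c i * phi (g i) x).
Proof. by apply: sqint_sum => // i; apply: sqintZ. Qed.

Lemma dot_lincomb (s : seq nat) (c : nat -> R) f : sqint f ->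
  dot (fun x => \sum_(i <- s) c i * phi i x) f = \sum_(i <- s) c i * dot f (phi i).
Proof.
move=> f2; rewrite dot_suml//; last by move=> i; apply: sqintZ.
by apply: eq_bigr => i _; rewrite dotZl// dotC.
Qed.

Lemma nrm_lincomb (s : seq nat) (c : nat -> R) : uniq s ->
  nrm (fun x => \sum_(i <- s) c i * phi i x) ^+ 2 = \sum_(i <- s) c i ^+ 2.
Proof.
move=> us; rewrite nrm_sqr dot_lincomb; last exact: sqint_lincomb.
rewrite big_seq [RHS]big_seq; apply: eq_bigr => i si.
rewrite dot_lincomb// (bigD1_seq i)//= big1 ?addr0 => [|j ji].
  by rewrite phi_orth eqxx mulr1 expr2.
by rewrite phi_orth eq_sym (negbTE ji) mulr0.
Qed.

Let partial f n := fun x => \sum_(k < n) dot f (phi k) * phi k x.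

Let partialE f n : partial f n = fun x => \sum_(0 <= k < n) dot f (phi k) * phi k x.
Proof. by apply/funext => x; rewrite /partial big_mkord. Qed.

Let partial2 f n : sqint (partial f n).
Proof. by rewrite partialE; exact: sqint_lincomb. Qed.

Lemma bessel f n : sqint f -> \sum_(0 <= k < n) dot f (phi k) ^+ 2 <= dot f f.
Proof.
move=> f2; have := dot_ge0 mu D (partial f n \- f).
rewrite dotBB// -nrm_sqr partialE nrm_lincomb ?iota_uniq// dot_lincomb//.
under [X in 2 * X]eq_bigr do rewrite -expr2.
lra.
Qed.

Lemma parseval f g : sqint f -> sqint g ->
  \sum_(0 <= k < n) dot f (phi k) * dot g (phi k) @[n --> \oo] --> dot f g.
Proof.
move=> f2 g2; apply/cvgrPdist_le => e e0.
have /cvgrPdist_le/(_ (e / (nrm g + 1))) := phi_basis f2.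
have g1 : 0 < nrm g + 1 by rewrite ltr_wpDl ?nrm_ge0.
move=> /(_ (divr_gt0 e0 g1)); apply: filterS => n.
rewrite sub0r normrN ger0_norm ?nrm_ge0// ler_pdivlMr// => h.
rewrite -dot_lincomb// -partialE distrC -dotBl//.
apply: le_trans (dot_norm_le mD (sqintB mD (partial2 f n) f2) g2) _.
apply: le_trans h; rewrite ler_wpM2l ?nrm_ge0//.
by rewrite lerDl.
Qed.

(** Parseval's identity for f - g, all of whose coefficients vanish. *)
Lemma coef_inj f g : sqint f -> sqint g ->
  (forall k, dot f (phi k) = dot g (phi k)) -> ae_eq mu D f g.
Proof.
move=> f2 g2 fg; apply: dot_indep_ae => //.
have := parseval (sqintB mD f2 g2) (sqintB mD f2 g2).
under eq_fun do under eq_bigr do rewrite dotBl// fg subrr mul0r.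
under eq_fun do rewrite big1//.
by move/(cvg_lim (@Rhausdorff R)) <-; rewrite lim_cst.
Qed.

(** By orthonormality the partial sums are Cauchy, and a coefficient is stable
    along them as soon as its term has been added. *)
Lemma riesz_fischer (c : nat -> R) M :
  (forall n, \sum_(0 <= k < n) c k ^+ 2 <= M) ->
  exists2 f, sqint f & forall k, dot f (phi k) = c k.
Proof.
move=> cM.
pose F n x := \sum_(0 <= k < n) c k * phi k x.
have F2 n : sqint (F n) by exact: sqint_lincomb.
have FB m n : (m <= n)%N -> nrm (F n \- F m) ^+ 2 = \sum_(m <= k < n) c k ^+ 2.
  move=> mn; rewrite -nrm_lincomb ?iota_uniq//; congr (nrm _ ^+ _).
  by apply/funext => x; rewrite /F /= (big_cat_nat (n := m))//= addrAC subrr add0r.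
have cv : cvgn (series (fun k => c k ^+ 2)).
  apply: nondecreasing_is_cvgn.
    by apply: nondecreasing_series => k _ _; exact: sqr_ge0.
  by exists M => _ [n _ <-]; exact: cM.
have [f f2 Ff] : exists2 f, sqint f & forall e, 0 < e ->
    exists N : nat, forall n, (N <= n)%N -> nrm (F n \- f) <= e.
  apply: sqint_complete => // e e0.
  have /cauchy_cvgP/cauchy_seriesP/(_ (e ^+ 2)) := cv.
  move=> /(_ (exprn_gt0 _ e0))[[A B] /= [[a _ aA] [b _ bB]] AB].
  exists (maxn a b).
  have key m n : (maxn a b <= m)%N -> (maxn a b <= n)%N -> (m <= n)%N ->
      nrm (F n \- F m) <= e.
    rewrite !geq_max => /andP[am bm] /andP[an bn] mn.
    rewrite -(@ler_pXn2r _ 2)// ?nnegrE ?nrm_ge0 ?(ltW e0)// FB//.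
    have /ltW := AB (m, n) (conj (aA _ am) (bB _ bn)).
    by apply: le_trans; exact: ler_norm.
  move=> n m Nn Nm; have [mn|/ltnW nm] := leqP m n; first exact: key.
  by rewrite nrmB; exact: key.
exists f => // k; apply/eqP; rewrite -subr_eq0 -normr_le0; apply/ler_addgt0Pl => e e0.
rewrite addr0; have [N HN] := Ff _ e0; have := HN (maxn N k.+1) (leq_maxl _ _).
apply: le_trans.
have -> : c k = dot (F (maxn N k.+1)) (phi k).
  rewrite dot_lincomb// (bigD1_seq k) ?iota_uniq//=; last first.
    by rewrite mem_index_iota/= leq_max ltnSn orbT.
  rewrite phi_orth eqxx mulr1 big1 ?addr0// => j jk.
  by rewrite phi_orth eq_sym (negbTE jk) mulr0.
rewrite distrC -dotBl//.
apply: le_trans (dot_norm_le mD (sqintB mD (F2 _) f2) (phi2 k)) _.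
by rewrite {2}/nrm phi_orth eqxx sqrtr1 mulr1.
Qed.

End hilbert_basis.

Section L2_bridge.
Context {R : realType}.
Variable Omega : set (R * R).
Local Notation mplane := (measurableTypeR R * measurableTypeR R)%type.
Hypothesis mO : measurable (Omega : set mplane).

(** L^2 is defined through the L^p seminorm of the restriction to Omega; the
    equivalent form as an integral of f ^ 2 over Omega is the one for which
    Hilbert space arguments are direct. *)
Lemma L2_sqint f : L2 Omega f <-> sqint leb2 (Omega : set mplane) f.
Proof.
split.
- move=> /[dup] /Lfun2_integrable_sqr i2 /andP[+ _]; rewrite inE/= => mf; split.
    by apply/(measurable_restrictT _ mO).
  rewrite (integrable_mkcond _ mO); apply: eq_integrable i2 => // x _ /=.
  by rewrite /patch; case: ifP => // _; rewrite expr0n.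
move=> [mf f2]; apply/andP; split; rewrite inE/=.
  by apply/(measurable_restrictT _ mO).
rewrite /finite_norm unlock; apply: poweR_lty.
rewrite (eq_integral ((fun x : mplane => (f x ^+ 2)%:E) \_ (Omega : set mplane))); last first.
  move=> x _ /=; rewrite /patch; case: ifP => _ /=.
    by rewrite -[in RHS](real_normK (num_real (f x))) -powR_mulrn.
  by rewrite normr0 powR0//.
rewrite -integral_mkcond.
exact: (integrable_lty mO f2).
Qed.

Lemma L2norm_nrm f : L2 Omega f -> L2norm Omega f = nrm leb2 (Omega : set mplane) f.
Proof.
move=> /L2_sqint f2; rewrite /L2norm unlock.
rewrite (eq_integral ((fun x : mplane => (f x ^+ 2)%:E) \_ (Omega : set mplane))); last first.
  move=> x _ /=; rewrite /patch; case: ifP => _ /=.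
    by rewrite -[in RHS](real_normK (num_real (f x))) -powR_mulrn.
  by rewrite normr0 powR0//.
rewrite -integral_mkcond (int_sqrE mO f2) poweR_EFin /= /nrm.
by rewrite -powR12_sqrt// dot_ge0.
Qed.

End L2_bridge.

(** * Smooth functions of the plane *)

Section flat_function.
Context {R : realType}.
Implicit Types (t x : R) (k : nat).

(** The derivative of t ^ -k exp (- 1 / t) is a combination of two functions of
    the same shape, so the whole family is smooth across 0; every bump function
    below is composed from its members. Moreover flat 2 is the derivative of
    flat 0, which is what relates the kernel to a Laplacian. *)
Definition flat k t : R := if 0 < t then t^-1 ^+ k * expR (- t^-1) else 0.

Lemma flat_ge0 k t : 0 <= flat k t.
Proof.
rewrite /flat; case: ifP => // t0.
by rewrite mulr_ge0 ?expR_ge0// exprn_ge0// invr_ge0 ltW.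
Qed.

Lemma flat_gt0 k t : 0 < t -> 0 < flat k t.
Proof. by move=> t0; rewrite /flat t0 mulr_gt0 ?expR_gt0// exprn_gt0// invr_gt0. Qed.

Lemma flat_le0 k t : t <= 0 -> flat k t = 0.
Proof. by rewrite /flat ltNge => ->. Qed.

(** Substituting x = 1 / t this is x ^ k <= k! exp x, one term of the
    exponential series. *)
Lemma flat_le_fact k t : flat k t <= k`!%:R.
Proof.
rewrite /flat; case: ifP => // t0.
rewrite expRN ler_pdivrMr ?expR_gt0//.
have x0 : 0 <= t^-1 by rewrite invr_ge0 ltW.
case: k => [|k].
  by rewrite expr0 fact0 mul1r (le_trans _ (expR_ge1Dx _))// lerDl.
rewrite mulrC -ler_pdivrMr ?ltr0n ?fact_gt0//.
by apply: le_trans (expR_ge1Dxn k x0); rewrite lerDr.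
Qed.

Lemma is_derive_flat k t :
  is_derive t 1 (flat k) (flat k.+2 t - k%:R * flat k.+1 t).
Proof.
have [t0|t0|->] := ltgtP t 0.
- rewrite !flat_le0 ?(ltW t0)// mulr0 subr0.
  apply: (@near_eq_is_derive _ _ _ (cst (0:R))).
  have : t \in `]-oo, (0:R)[ by rewrite in_itv.
  move=> /near_in_itvNyo; apply: filterS => y; rewrite in_itv/= => y0.
  by rewrite flat_le0// ltW.
- have tn0 : id t != 0 by rewrite gt_eqF.
  have dV : is_derive t 1 (fun y : R => y^-1) (- t^-2).
    apply: (is_derive_eq (is_deriveV tn0 (is_derive_id t 1))).
    by rewrite /= /GRing.scale/= mulr1.
  have dX : is_derive t 1 (fun y : R => y^-1 ^+ k) (- k%:R * t^-1 ^+ k.+1).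
    have dX := is_deriveX k dV; rewrite exprfctE in dX; apply: (is_derive_eq dX).
    rewrite /GRing.scale/=; case: k {dX} => [|k]; first by rewrite !mul0r oppr0 mul0r.
    by rewrite /= -exprVn !exprS expr0; ring.
  have dN : is_derive t 1 (fun y : R => - y^-1) (t^-1 ^+ 2).
    by have := is_deriveN dV; rewrite opprK exprVn.
  have dE : is_derive t 1 (fun y : R => expR (- y^-1)) (expR (- t^-1) * t^-1 ^+ 2).
    have := @is_derive1_comp R expR (fun y => - y^-1) t _ _ (is_derive_expR _) dN.
    exact.
  have dM : is_derive t 1 ((fun y => y^-1 ^+ k) * (fun y => expR (- y^-1)))
      (flat k.+2 t - k%:R * flat k.+1 t).
    apply: (is_derive_eq (is_deriveM dX dE)).
    by rewrite /GRing.scale/= /flat t0 !exprS; ring.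
  apply: (near_eq_is_derive _ dM).
  have : t \in `](0:R), +oo[ by rewrite in_itv/= t0.
  move=> /near_in_itvoy; apply: filterS => y; rewrite in_itv/= andbT => y0.
  by rewrite /flat y0.
- (* At 0 the difference quotient is h times the bounded function flat k.+2. *)
  rewrite !flat_le0// mulr0 subr0.
  have h1 : h^-1 *: (flat k (h + 0) - flat k 0) @[h --> (0:R)^'] --> (0:R).
    apply/cvgrPdist_le => e e0; near=> h.
    rewrite sub0r normrN addr0 (flat_le0 k (lexx _)) subr0.
    have h0 : h != 0 by near: h; exact: nbhs_dnbhs_neq.
    have [hn|hp] := leP h 0; first by rewrite flat_le0// scaler0 normr0 ltW.
    have -> : h^-1 *: flat k h = h * flat k.+2 h.
      rewrite /GRing.scale/= /flat hp !exprS; field.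
      by rewrite h0.
    rewrite ger0_norm ?mulr_ge0 ?flat_ge0 ?(ltW hp)//.
    apply: (@le_trans _ _ (h * k.+2`!%:R)).
      by rewrite ler_wpM2l ?flat_le_fact// ltW.
    rewrite -ler_pdivlMr ?ltr0n ?fact_gt0//.
    apply: le_trans (ler_norm _) _; apply: ltW; near: h.
    apply: dnbhs0_lt; rewrite divr_gt0// ltr0n fact_gt0//.
  apply: DeriveDef.
    by apply/cvg_ex; exists 0; under eq_fun do rewrite /GRing.scale/= mulr1; exact: h1.
  rewrite /derive; under eq_fun do rewrite /GRing.scale/= mulr1.
  exact: (cvg_lim (@Rhausdorff R) h1).
Unshelve. all: by end_near. Qed.

Lemma flat_differentiable k t : differentiable (flat k) t.
Proof. by apply/derivable1_diffP; have [] := is_derive_flat k t. Qed.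

Lemma flat_derive1 k t : (flat k)^`()%classic t = flat k.+2 t - k%:R * flat k.+1 t.
Proof. by rewrite derive1E; have [_] := is_derive_flat k t. Qed.

End flat_function.

Section smooth_functions.
Context {R : realType}.
Implicit Types (f g : R * R -> R) (d x : R * R).

(** Smoothness asks for differentiability of all iterated directional
    derivatives. It suffices to exhibit a class of differentiable functions that
    is stable under directional derivatives; generating the class inductively
    makes stability a case analysis on the rules of calculus. *)
Inductive smooth_expr : (R * R -> R) -> Prop :=
| smooth_expr_smooth f of smooth f : smooth_expr f
| smooth_expr_cst c : smooth_expr (cst c)
| smooth_expr_fst : smooth_expr fst
| smooth_expr_snd : smooth_expr snd
| smooth_expr_add f g of smooth_expr f & smooth_expr g : smooth_expr (f + g)
| smooth_expr_mul f g of smooth_expr f & smooth_expr g : smooth_expr (f * g)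
| smooth_expr_flat k f of smooth_expr f : smooth_expr (flat k \o f).

Lemma smooth_derive f d : smooth f -> smooth ('D_d f : R * R -> R).
Proof. by move=> sf l x; have := sf (rcons l d) x; rewrite foldr_rcons. Qed.

Lemma fst_continuous : continuous (fst : R * R -> R).
Proof. by move=> x; exact: cvg_fst. Qed.

Lemma snd_continuous : continuous (snd : R * R -> R).
Proof. by move=> x; exact: cvg_snd. Qed.

Lemma differentiable_fst x : differentiable (fst : R * R -> R) x.
Proof.
exact: (@linear_differentiable R _ R (fst : {linear (R * R)%type -> R}) x
  fst_continuous).
Qed.

Lemma differentiable_snd x : differentiable (snd : R * R -> R) x.
Proof.
exact: (@linear_differentiable R _ R (snd : {linear (R * R)%type -> R}) x
  snd_continuous).
Qed.

Lemma smooth_expr_diff f x : smooth_expr f -> differentiable f x.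
Proof.
elim=> {f} [f /(_ [::])//|c|||f g _ df _ dg|f g _ df _ dg|k f _ df].
- exact: differentiable_cst.
- exact: differentiable_fst.
- exact: differentiable_snd.
- exact: differentiableD.
- exact: differentiableM.
- exact: differentiable_comp df (flat_differentiable _ _).
Qed.

Lemma derive_fst d x : 'D_d (fst : R * R -> R) x = d.1.
Proof.
rewrite deriveE; last exact: differentiable_fst.
by rewrite (@diff_lin R _ R (fst : {linear (R * R)%type -> R}) x fst_continuous).
Qed.

Lemma derive_snd d x : 'D_d (snd : R * R -> R) x = d.2.
Proof.
rewrite deriveE; last exact: differentiable_snd.
by rewrite (@diff_lin R _ R (snd : {linear (R * R)%type -> R}) x snd_continuous).
Qed.

Lemma derive_flat_comp k f d x : differentiable f x ->
  'D_d (flat k \o f) x = 'D_d f x * (flat k.+2 (f x) - k%:R * flat k.+1 (f x)).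
Proof.
move=> df; have dg := flat_differentiable k (f x).
rewrite !deriveE//; last exact: differentiable_comp.
by rewrite diff_comp//= diff1E// flat_derive1.
Qed.

Lemma smooth_expr_derive f d : smooth_expr f -> smooth_expr ('D_d f).
Proof.
have der g x : smooth_expr g -> derivable g x d.
  by move=> sg; apply: diff_derivable; exact: smooth_expr_diff.
elim=> {f} [f sf|c|||f g sf df sg dg|f g sf df sg dg|k f sf df].
- exact/smooth_expr_smooth/smooth_derive.
- rewrite (_ : 'D_d _ = cst 0); first exact: smooth_expr_cst.
  by apply/funext => x; exact: derive_cst.
- rewrite (_ : 'D_d _ = cst d.1); first exact: smooth_expr_cst.
  by apply/funext => x; exact: derive_fst.
- rewrite (_ : 'D_d _ = cst d.2); first exact: smooth_expr_cst.
  by apply/funext => x; exact: derive_snd.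
- rewrite (_ : 'D_d _ = 'D_d f + 'D_d g); first exact: smooth_expr_add.
  by apply/funext => x; rewrite deriveD//; exact: der.
- rewrite (_ : 'D_d _ = f * 'D_d g + g * 'D_d f).
    by apply: smooth_expr_add; exact: smooth_expr_mul.
  by apply/funext => x; rewrite deriveM//; exact: der.
- rewrite (_ : 'D_d _ = 'D_d f * ((flat k.+2 \o f) + cst (- k%:R) * (flat k.+1 \o f))).
    apply: smooth_expr_mul => //; apply: smooth_expr_add; first exact: smooth_expr_flat.
    by apply: smooth_expr_mul; [exact: smooth_expr_cst|exact: smooth_expr_flat].
  apply/funext => x; rewrite derive_flat_comp; last exact: smooth_expr_diff.
  by rewrite -[in LHS]mulNr.
Qed.

Lemma smooth_exprP f : smooth_expr f <-> smooth f.
Proof.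
split; last exact: smooth_expr_smooth.
move=> sf l x; apply: smooth_expr_diff.
by elim: l => //= d l; exact: smooth_expr_derive.
Qed.

End smooth_functions.

(** * Test functions *)

Lemma sqint_bounded d (T : measurableType d) (R : realType)
    (mu : {measure set T -> \bar R}) (D : set T) (f : T -> R) (C : R) :
  measurable D -> (mu D < +oo)%E -> measurable_fun D f ->
  (forall x, D x -> `|f x| <= C) -> sqint mu D f.
Proof.
move=> mD Doo mf fC; split => //; apply: (@le_integrableR _ _ _ _ _ mD _ (cst (C ^+ 2))).
- exact: measurable_funX.
- apply/integrableP; split; first by apply/measurable_EFinP; exact: measurable_cst.
  rewrite /= (_ : (fun _ => _) = cst `|C ^+ 2|%:E)//.
  by rewrite integral_cst// lte_mul_pinfty// lee_fin.
move=> x Dx; rewrite /= normrX lerXn2r ?nnegrE//; last exact: fC.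
by apply: le_trans (fC x Dx).
Qed.

Section test_functions.
Context {R : realType}.
Implicit Types (f g : R * R -> R) (Omega K : set (R * R)).
Local Notation mplane := (measurableTypeR R * measurableTypeR R)%type.

Lemma smooth_continuous f : smooth f -> continuous f.
Proof. by move=> sf x; apply: differentiable_continuous; exact: (sf [::] x). Qed.

Lemma smooth_derivable f d x : smooth f -> derivable f x d.
Proof. by move=> sf; apply: diff_derivable; exact: (sf [::] x). Qed.

Lemma smoothM f g : smooth f -> smooth g -> smooth (f * g).
Proof.
by move=> sf sg; apply/smooth_exprP/smooth_expr_mul; exact/smooth_exprP.
Qed.

Lemma test_functionI Omega K f : smooth f -> compact K -> K `<=` Omega ->
  (forall x, ~ K x -> f x = 0) -> test_function Omega f.
Proof.
move=> sf cK KO f0.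
have cl : closed K by apply: compact_closed => //; exact: norm_hausdorff.
have sK : closure [set x | f x != 0] `<=` K.
  rewrite [X in _ `<=` X](closure_id _).1//; apply: closureS => x /= fx.
  by apply: contrapT => /f0 /eqP; apply/negP.
split => //; last exact: subset_trans KO.
by apply: (subclosed_compact _ cK) => //; exact: closed_closure.
Qed.

Lemma test_function0 Omega f x : test_function Omega f -> ~ Omega x -> f x = 0.
Proof.
move=> [_ _ sO] nO; apply: contrapT => /eqP fx; apply/nO/sO.
exact: subset_closure.
Qed.

Lemma test_function_bounded Omega f : test_function Omega f ->
  exists C, forall x, `|f x| <= C.
Proof.
move=> [sf cf _].
have : compact (f @` closure [set x | f x != 0]).
  apply: continuous_compact => //; apply: continuous_subspaceT.
  exact: smooth_continuous.
move=> /compact_bounded [C [_ HC]]; exists (Num.max 0 (C + 1)) => x.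
have [->|fx] := eqVneq (f x) 0; first by rewrite normr0 le_max lexx.
rewrite le_max; apply/orP; right; apply: HC; first by rewrite ltrDl.
by exists x => //; exact: subset_closure.
Qed.

Lemma test_function_derive Omega f d : test_function Omega f ->
  test_function Omega ('D_d f : R * R -> R).
Proof.
move=> [sf cf fO]; apply: (test_functionI _ cf fO); first exact: smooth_derive.
move=> x nx; have : nbhs x (~` closure [set x | f x != 0]).
  by apply: open_nbhs_nbhs; split => //; exact/closed_openC/closed_closure.
move=> nb; rewrite (@near_eq_derive _ _ _ f (cst (0:R))); first exact: derive_cst.
apply: filterS nb => y ny; apply: contrapT => /eqP fy; apply: ny.
exact: subset_closure.
Qed.

Lemma test_functionM Omega f g : test_function Omega f -> smooth g ->
  test_function Omega (f * g).
Proof.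
move=> [sf cf fO] sg; apply: (test_functionI _ cf fO); first exact: smoothM.
move=> x nx; have [fx|fx] := eqVneq (f x) 0; first by rewrite /= mulrfctE fx mul0r.
by case: nx; exact: subset_closure.
Qed.

End test_functions.

Section bounded_domain.
Context {R : realType}.
Implicit Types (f g : R * R -> R).
Local Notation mplane := (measurableTypeR R * measurableTypeR R)%type.
Variables (Omega : set (R * R)) (M : R).
Hypothesis M0 : 0 < M.
Hypothesis oO : open Omega.
Hypothesis OM : Omega `<=` `]- M, M[ `*` `]- M, M[.

Let mO : measurable (Omega : set mplane). Proof. exact: open_measurable2. Qed.

Lemma leb2_bounded_lty : (leb2 Omega < +oo)%E.
Proof.
apply: (@le_lt_trans _ _ (leb2 (`]- M, M[ `*` `]- M, M[))).
  by apply: le_measure => //; rewrite inE//; exact: measurable_box.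
have MM : - M <= M by have := M0; lra.
by rewrite (leb2_box MM MM) ltry.
Qed.

Lemma sqint_continuous f C : {in Omega, continuous f} ->
  (forall x, Omega x -> `|f x| <= C) -> sqint leb2 (Omega : set mplane) f.
Proof.
move=> cf fC; apply: (@sqint_bounded _ mplane R leb2 Omega f C) => //.
  exact: leb2_bounded_lty.
exact: open_continuous_measurable2.
Qed.

Lemma test_function_sqint f : test_function Omega f ->
  sqint leb2 (Omega : set mplane) f.
Proof.
move=> tf; have [C fC] := test_function_bounded tf.
apply: (@sqint_continuous f C) => // x _; apply: smooth_continuous.
by have [] := tf.
Qed.

(* On a horizontal or vertical line the partial derivative and the derivative in
   one variable have the same difference quotients. *)
Let line1E f (y x : R) :
  (fun h : R => h^-1 *: ((fun t => f (t, y)) (h *: (1 : R) + x) - f (x, y))) =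
  (fun h : R => h^-1 *: (f (h *: (1, 0) + (x, y)) - f (x, y))).
Proof.
by apply/funext => h; congr (_ *: (f _ - _)); congr pair; rewrite /= scaler0 add0r.
Qed.

Let line2E f (x y : R) :
  (fun h : R => h^-1 *: ((fun t => f (x, t)) (h *: (1 : R) + y) - f (x, y))) =
  (fun h : R => h^-1 *: (f (h *: (0, 1) + (x, y)) - f (x, y))).
Proof.
by apply/funext => h; congr (_ *: (f _ - _)); congr pair; rewrite /= scaler0 add0r.
Qed.

Lemma derive1_line1 f (y x : R) :
  'D_(1 : R) (fun t => f (t, y)) x = 'D_(1, 0) f (x, y).
Proof. exact: (congr1 (fun F : R -> R => lim (F h @[h --> 0^'])) (line1E f y x)). Qed.

Lemma derive1_line2 f (x y : R) :
  'D_(1 : R) (fun t => f (x, t)) y = 'D_(0, 1) f (x, y).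
Proof. exact: (congr1 (fun F : R -> R => lim (F h @[h --> 0^'])) (line2E f x y)). Qed.

Lemma derivable_line1 f (y x : R) : derivable f (x, y) (1, 0) ->
  derivable (fun t => f (t, y)) x (1 : R).
Proof.
by move=> h; rewrite /derivable (line1E f y x).
Qed.

Lemma derivable_line2 f (x y : R) : derivable f (x, y) (0, 1) ->
  derivable (fun t => f (x, t)) y (1 : R).
Proof.
by move=> h; rewrite /derivable (line2E f x y).
Qed.

(** Both end values in the fundamental theorem of calculus vanish. *)
Lemma integral_derive_line0 (g : R -> R) : (forall t, derivable g t 1) ->
  continuous ('D_(1 : R) g) -> (forall t, M <= `|t| -> g t = 0) ->
  (forall t, M <= `|t| -> 'D_(1 : R) g t = 0) ->
  (\int[@lebesgue_measure R]_t ('D_(1 : R) g t)%:E = 0)%E.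
Proof.
move=> dg cg g0 dg0.
have cgg : continuous g.
  by move=> t; apply: differentiable_continuous; exact/derivable1_diffP.
transitivity (\int[@lebesgue_measure R]_(t in `[(- M)%R, M]) ('D_(1 : R) g t)%:E)%E.
  rewrite [RHS]integral_mkcond; apply: eq_integral => t _.
  rewrite patchE; case: ifPn => //; rewrite notin_setE /= in_itv/= => /negP h.
  rewrite dg0//; rewrite leNgt; apply: contra h; rewrite ltr_norml => /andP[].
  by move=> /ltW -> /ltW ->.
have gM : g M = 0 by apply: g0; rewrite ger0_norm// ltW.
have gN : g (- M) = 0 by apply: g0; rewrite normrN ger0_norm// ltW.
rewrite (@continuous_FTC2 _ _ g); first by rewrite gM gN subee.
- by have := M0; lra.
- exact: continuous_subspaceT.
- split; first by move=> t _; exact: dg.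
  + exact/cvg_at_right_filter/cgg.
  + exact/cvg_at_left_filter/cgg.
- by move=> t _; rewrite derive1E.
Qed.

(* A test function of Omega vanishes outside the box. *)
Let outside f t : test_function Omega f -> M <= `|t.1| \/ M <= `|t.2| -> f t = 0.
Proof.
move=> tf h; apply: (test_function0 tf) => /OM []; rewrite /= !in_itv/=.
by rewrite -!ltr_norml => h1 h2; case: h; rewrite leNgt ?h1 ?h2.
Qed.

Lemma test_function_integrableT f : test_function Omega f ->
  leb2.-integrable (setT : set mplane) (EFin \o f).
Proof.
move=> tf; have [C fC] := test_function_bounded tf.
have [mf f2] := test_function_sqint tf.
have fi : leb2.-integrable (Omega : set mplane) (EFin \o f).
  have h : sqint leb2 (Omega : set mplane) (cst 1).
    apply: (@sqint_continuous _ 1) => [x _|x _]; first exact: cvg_cst.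
    by rewrite normr1.
  have := sqint_mul mO (test_function_sqint tf) h.
  by apply: eq_integrable => // x _; rewrite /= mulr1.
have := (integrable_mkcond _ mO).1 fi.
apply: eq_integrable => // x _; rewrite patchE; case: ifPn => //.
by rewrite notin_setE => /(test_function0 tf) /= ->.
Qed.

Let integral_testE f : test_function Omega f ->
  (\int[leb2]_(x in (Omega : set mplane)) (f x)%:E = \int[leb2]_x (f x)%:E)%E.
Proof.
move=> tf; rewrite integral_mkcond; apply: eq_integral => x _.
rewrite patchE; case: ifPn => //.
by rewrite notin_setE => /(test_function0 tf) /= ->.
Qed.

(** Fubini's theorem reduces this to the integral of a derivative along a line,
    with zero boundary values. *)
Lemma integral_derive1_0 f : test_function Omega f ->
  (\int[leb2]_(x in Omega) ('D_(1, 0) f x))%R = 0.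
Proof.
move=> tf; have tdf := test_function_derive (1, 0) tf.
have [sf _ _] := tf; have [sdf _ _] := tdf.
rewrite /Rintegral integral_testE//.
have := integral21_prod_meas1 (test_function_integrableT tdf).
rewrite /leb2 /= => <-; rewrite (eq_integral (cst 0%E)) ?integral0// => y _.
rewrite /fubini_G /=; under eq_integral do rewrite -derive1_line1.
apply: integral_derive_line0.
- by move=> t; apply: derivable_line1; exact: smooth_derivable.
- rewrite (funext (derive1_line1 f y)) => t.
  have c : ((s, y) : R * R) @[s --> t] --> ((t, y) : R * R).
    apply: (@cvg_pair R R R (nbhs t) (nbhs t) (nbhs y) _ _ _ id (cst y)) => //.
    exact: cvg_cst.
  exact: (cvg_comp _ _ c (@smooth_continuous _ _ sdf (t, y))).
- by move=> t tM; apply: (outside tf); left.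
- by move=> t tM; rewrite derive1_line1; apply: (outside tdf); left.
Qed.

Lemma integral_derive2_0 f : test_function Omega f ->
  (\int[leb2]_(x in Omega) ('D_(0, 1) f x))%R = 0.
Proof.
move=> tf; have tdf := test_function_derive (0, 1) tf.
have [sf _ _] := tf; have [sdf _ _] := tdf.
rewrite /Rintegral integral_testE//.
have := integral12_prod_meas1 (test_function_integrableT tdf).
rewrite /leb2 /= => <-; rewrite (eq_integral (cst 0%E)) ?integral0// => x _.
rewrite /fubini_F /=; under eq_integral do rewrite -derive1_line2.
apply: integral_derive_line0.
- by move=> t; apply: derivable_line2; exact: smooth_derivable.
- rewrite (funext (derive1_line2 f x)) => t.
  have c : ((x, s) : R * R) @[s --> t] --> ((x, t) : R * R).
    apply: (@cvg_pair R R R (nbhs t) (nbhs x) (nbhs t) _ _ _ (cst x) id) => //.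
    exact: cvg_cst.
  exact: (cvg_comp _ _ c (@smooth_continuous _ _ sdf (x, t))).
- by move=> t tM; apply: (outside tf); right.
- by move=> t tM; rewrite derive1_line2; apply: (outside tdf); right.
Qed.

End bounded_domain.

(** * Dirichlet eigenfunctions *)

Section eigenfunctions.
Context {R : realType}.
Implicit Types (f g v w : R * R -> R).
Local Notation mplane := (measurableTypeR R * measurableTypeR R)%type.
Variables (Omega : set (R * R)) (M : R).
Hypothesis M0 : 0 < M.
Hypothesis oO : open Omega.
Hypothesis OM : Omega `<=` `]- M, M[ `*` `]- M, M[.
Local Notation sqintO := (sqint leb2 (Omega : set mplane)).
Local Notation dotO := (dot leb2 (Omega : set mplane)).
Local Notation nrmO := (nrm leb2 (Omega : set mplane)).

Let mO : measurable (Omega : set mplane). Proof. exact: open_measurable2. Qed.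

Let test2 f : test_function Omega f -> sqintO f.
Proof. exact: (test_function_sqint M0 oO OM). Qed.

(** The product f g is again a test function, so the integral of its derivative
    vanishes. *)
Lemma integration_by_parts_dir (d : R * R) f g :
  (forall h, test_function Omega h -> (\int[leb2]_(x in Omega) ('D_d h x))%R = 0) ->
  test_function Omega f -> test_function Omega g ->
  dotO f ('D_d g) = - dotO ('D_d f) g.
Proof.
move=> int0 tf tg; have [[sf _ _] [sg _ _]] := (tf, tg).
have tdf := test_function_derive d tf; have tdg := test_function_derive d tg.
apply/eqP; rewrite -addr_eq0 [dotO ('D_d f) g]dotC /dot -RintegralD//.
- rewrite -[X in _ == X](int0 _ (test_functionM tf sg)); apply/eqP.
  by apply: eq_Rintegral => x _; rewrite deriveM//; exact: smooth_derivable.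
- exact: (sqint_mul mO (test2 tf) (test2 tdg)).
- exact: (sqint_mul mO (test2 tg) (test2 tdf)).
Qed.

Lemma test_function_weak_grad v : test_function Omega v ->
  L2_weak_grad Omega v (grad v).
Proof.
move=> tv; split.
- by apply/(L2_sqint mO)/test2; exact: test_function_derive.
- by apply/(L2_sqint mO)/test2; exact: test_function_derive.
move=> f tf; split.
- exact: (integration_by_parts_dir (integral_derive1_0 M0 oO OM)).
- exact: (integration_by_parts_dir (integral_derive2_0 M0 oO OM)).
Qed.

Lemma L2cvg_cst v : L2 Omega v -> L2cvg Omega (fun=> v) v.
Proof.
move=> /(L2_sqint mO) v2; rewrite /L2cvg.
rewrite (_ : L2norm Omega _ = 0); first exact: cvg_cst.
rewrite (L2norm_nrm mO); last by apply/(L2_sqint mO)/sqintB.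
by rewrite /nrm dotBB//; rewrite (_ : _ + _ = 0) ?sqrtr0//; ring.
Qed.

Lemma test_function_H10 v : test_function Omega v -> H10 Omega v.
Proof.
move=> tv; have [g1 g2 _] := test_function_weak_grad tv.
split; first exact/(L2_sqint mO)/test2.
exists (grad v); first exact: test_function_weak_grad.
by exists (fun=> v); split => //; apply: L2cvg_cst => //; exact/(L2_sqint mO)/test2.
Qed.

Definition laplacian v : R * R -> R :=
  'D_(1, 0) ('D_(1, 0) v : R * R -> R) \+ 'D_(0, 1) ('D_(0, 1) v : R * R -> R).

(** One integration by parts is the weak formulation of the eigenvalue problem,
    the second is the definition of the weak gradient of u. Only derivatives of
    the test function appear, so no regularity of u enters. *)
Lemma eigen_weak lam u v : dirichlet_eigenpair Omega lam u ->
  test_function Omega v -> lam * dotO u v = - dotO u (laplacian v).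
Proof.
move=> [_ [/(L2_sqint mO) u2 [g [g1 g2 gw] _]] ev] tv.
have tv1 := test_function_derive (1, 0) tv.
have tv2 := test_function_derive (0, 1) tv.
have E : dotO (fst \o g) ('D_(1, 0) v) + dotO (snd \o g) ('D_(0, 1) v) = lam * dotO u v.
  exact: (ev v g (grad v) (test_function_H10 tv) (And3 g1 g2 gw) (test_function_weak_grad tv)).
have e1 : dotO u ('D_(1, 0) ('D_(1, 0) v : R * R -> R)) = - dotO (fst \o g) ('D_(1, 0) v).
  exact: (gw _ tv1).1.
have e2 : dotO u ('D_(0, 1) ('D_(0, 1) v : R * R -> R)) = - dotO (snd \o g) ('D_(0, 1) v).
  exact: (gw _ tv2).2.
have e3 : dotO u (laplacian v) = _ := dotDr mO
  (test2 (test_function_derive (1, 0) tv1)) (test2 (test_function_derive (0, 1) tv2)) u2.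
have alg (a b : R) : a + b = - (- a + - b) by ring.
rewrite -E (etrans e3 (congr2 +%R e1 e2)); exact: alg.
Qed.

(** The integral of d_1 (x_1 F ^ 2) vanishes, which gives
    |F| ^ 2 = - 2 <F, x_1 d_1 F>, and |x_1| <= M on Omega. *)
Lemma poincare_test F : test_function Omega F ->
  nrmO F <= 2 * M * nrmO ('D_(1, 0) F).
Proof.
move=> tF; have [sF _ _] := tF; have tdF := test_function_derive (1, 0) tF.
have sfst : smooth (fst : R * R -> R) by apply/smooth_exprP; exact: smooth_expr_fst.
have tFF := test_functionM tF sF.
have tx := test_functionM tFF sfst.
have txd := test_functionM tdF sfst.
have E : dotO F F + 2 * dotO F ('D_(1, 0) F * fst) = 0.
  have h2 : sqintO ('D_(1, 0) F * fst) := test2 txd.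
  have -> : dotO F F + 2 * dotO F ('D_(1, 0) F * fst) =
      dotO F (F \+ (fun x => 2 * ('D_(1, 0) F * fst) x)).
    by rewrite (dotDr mO (test2 tF) (sqintZ mO 2 h2) (test2 tF)) (dotZr mO 2 h2 (test2 tF)).
  rewrite -[RHS](integral_derive1_0 M0 oO OM tx); apply: eq_Rintegral => x _.
  have dF : derivable F x (1, 0) by exact: smooth_derivable.
  have dx : derivable (fst : R * R -> R) x (1, 0) by exact: smooth_derivable.
  have dFF : derivable (F * F) x (1, 0) by apply: smooth_derivable; exact: smoothM.
  rewrite (deriveM dFF dx) (deriveM dF dF) derive_fst /= /GRing.scale/= !mulrfctE.
  by ring.
have xd : nrmO ('D_(1, 0) F * fst) <= M * nrmO ('D_(1, 0) F).
  apply: nrm_le; first by rewrite mulr_ge0 ?nrm_ge0// ltW.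
  rewrite exprMn nrm_sqr /dot -RintegralZl//; last exact: (sqint_mul mO (test2 tdF) (test2 tdF)).
  apply: le_Rintegral => //.
  - exact: (sqint_mul mO (test2 txd) (test2 txd)).
  - have := integrableZR mO (M ^+ 2) (sqint_mul mO (test2 tdF) (test2 tdF)). exact.
  move=> x /OM [/= + _]; rewrite in_itv/= -ltr_norml => /ltW xM.
  rewrite mulrfctE -!expr2 exprMn mulrC ler_wpM2r ?sqr_ge0//.
  by rewrite -(real_normK (num_real x.1)) lerXn2r ?nnegrE// ltW.
have h := dot_norm_le mO (test2 tF) (test2 txd).
have [F0|F0] := eqVneq (nrmO F) 0; first by rewrite F0 !mulr_ge0 ?nrm_ge0// ltW.
have Fp : 0 < nrmO F by rewrite lt_neqAle eq_sym F0 nrm_ge0.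
rewrite -(ler_pM2l Fp).
have {E} : nrmO F * nrmO F = - (2 * dotO F ('D_(1, 0) F * fst)).
  by apply/eqP; rewrite -expr2 nrm_sqr -addr_eq0 E.
move=> ->; rewrite -mulrN.
have h1 : - dotO F ('D_(1, 0) F * fst) <= nrmO F * nrmO ('D_(1, 0) F * fst).
  by apply: le_trans h; rewrite -normrN ler_norm.
have := ler_wpM2l (nrm_ge0 leb2 (Omega : set mplane) F) xd.
lra.
Qed.

Lemma L2cvg_near (F : nat -> R * R -> R) u e : (forall n, sqintO (F n)) ->
  sqintO u -> L2cvg Omega F u -> 0 < e ->
  \forall n \near \oo, nrmO (F n \- u) <= e.
Proof.
move=> F2 u2 /cvgrPdist_le Fu e0; have := Fu _ e0; apply: filterS => n.
rewrite sub0r normrN (L2norm_nrm mO); last by apply/(L2_sqint mO)/sqintB.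
by move=> h; apply: le_trans h; exact: ler_norm.
Qed.

Lemma nrm_approx f g : sqintO f -> sqintO g -> nrmO g <= nrmO f + nrmO (f \- g).
Proof.
move=> f2 g2; rewrite nrmB; have := nrm_triangle mO f2 (sqintB mO g2 f2).
by rewrite (_ : f \+ (g \- f) = g)//; apply/funext => x /=; rewrite addrC subrK.
Qed.

(** Poincare's inequality, passed from test functions to H^1_0 by density, and
    applied to a normalized eigenfunction, whose Dirichlet energy is lam. *)
Lemma eigenvalue_ge lam u : dirichlet_eigenpair Omega lam u -> dotO u u = 1 ->
  (4 * M ^+ 2)^-1 <= lam.
Proof.
move=> [lam0 Hu ev] u1.
have [/(L2_sqint mO) u2 [g gw [F [tF Fu F1 _]]]] := Hu.
have [/(L2_sqint mO) g1 /(L2_sqint mO) g2 _] := gw.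
have F2 n := test2 (tF n).
have D2 n : sqintO (fst \o grad (F n)) by apply: test2; exact: test_function_derive.
have ug : nrmO u <= 2 * M * nrmO (fst \o g).
  apply/ler_addgt0Pl => e e0.
  have e1 : 0 < e / (1 + 2 * M) by rewrite divr_gt0//; have := M0; lra.
  have [n [Fn Dn]] : exists n, nrmO (F n \- u) <= e / (1 + 2 * M) /\
      nrmO ((fst \o grad (F n)) \- (fst \o g)) <= e / (1 + 2 * M).
    have [N _ HN] := filterI (L2cvg_near F2 u2 Fu e1) (L2cvg_near D2 g1 F1 e1).
    by exists N; exact: HN (leqnn _).
  have h1 := nrm_approx (F2 n) u2.
  have h2 := nrm_approx g1 (D2 n); rewrite nrmB in h2.
  have h3 := poincare_test (tF n).
  have h4 : 2 * M * nrmO ('D_(1, 0) (F n)) <=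
      2 * M * (nrmO (fst \o g) + e / (1 + 2 * M)).
    rewrite ler_wpM2l//; first by have := M0; lra.
    by apply: le_trans h2 _; rewrite lerD2l.
  have : e / (1 + 2 * M) + 2 * M * (e / (1 + 2 * M)) = e.
    by field; have := M0; lra.
  lra.
have := ev u g g Hu gw gw.
rewrite -[L2dot Omega u u]/(dotO u u) u1 mulr1 => <-.
have un : nrmO u = 1 by rewrite /nrm u1 sqrtr1.
rewrite un in ug.
have M2 : 0 < 4 * M ^+ 2 by rewrite mulr_gt0 ?exprn_gt0.
rewrite -[leLHS]mul1r ler_pdivrMr//.
have e1 : nrmO (fst \o g) ^+ 2 <= grad_dot Omega g g.
  by rewrite nrm_sqr /grad_dot lerDl; exact: dot_ge0.
apply: (@le_trans _ _ ((2 * M * nrmO (fst \o g)) ^+ 2)).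
  by rewrite -[leLHS](expr1n R 2) lerXn2r ?nnegrE// (le_trans _ ug).
by rewrite !exprMn (_ : 2 ^+ 2 = 4) 1?mulrC ?ler_wpM2r// 1?ltW//; ring.
Qed.

Lemma eigen_sqint lam phi : dirichlet_eigensystem Omega lam phi ->
  forall k, sqintO (phi k).
Proof. by move=> [_ [phi2 _ _]] k; exact/(L2_sqint mO). Qed.

Lemma eigen_orth lam phi : dirichlet_eigensystem Omega lam phi ->
  forall j k, dotO (phi j) (phi k) = (j == k)%:R.
Proof. by move=> [_ [_ orth _]]; exact: orth. Qed.

Lemma eigen_basis lam phi : dirichlet_eigensystem Omega lam phi ->
  forall g, sqintO g ->
    nrmO ((fun x => \sum_(k < n) dotO g (phi k) * phi k x) \- g) @[n --> \oo] --> 0.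
Proof.
move=> eig g g2; have p2 := eigen_sqint eig; have [_ [_ _ basis]] := eig.
have Sn n : sqintO (fun x => \sum_(k < n) dotO g (phi k) * phi k x).
  by apply: sqint_sum => // i; apply: sqintZ.
have := basis g ((L2_sqint mO g).2 g2); rewrite /L2cvg.
rewrite (_ : (fun n => L2norm _ _) = fun n =>
  nrmO ((fun x => \sum_(k < n) dotO g (phi k) * phi k x) \- g)) //.
apply/funext => n; apply: (L2norm_nrm mO); exact/(L2_sqint mO)/sqintB.
Qed.

(** Every eigenfunction is an L^2 limit of test functions, hence orthogonal to
    f, and the eigenfunctions form a basis. This obtains the density of test
    functions without mollifying f. *)
Lemma test_functions_dense lam phi f : dirichlet_eigensystem Omega lam phi ->
  sqintO f -> (forall v, test_function Omega v -> dotO f v = 0) ->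
  ae_eq leb2 (Omega : set mplane) f (fun=> 0).
Proof.
move=> eig f2 f0; have p2 := eigen_sqint eig.
apply: (@coef_inj _ _ _ leb2 Omega mO phi p2 (eigen_basis eig) f (fun=> 0) f2).
  exact: sqint0.
move=> k.
rewrite dot0l//.
have [_ [_ [g gw [F [tF Fu _ _]]]] _] := eig.1 k.
apply/eqP; rewrite -normr_le0; apply/ler_addgt0Pl => e e0; rewrite addr0.
have n1 : 0 < 1 + nrmO f by rewrite ltr_pwDl ?nrm_ge0.
have [N _ /(_ N (leqnn _)) h] := L2cvg_near (fun n => test2 (tF n)) (p2 k) Fu (divr_gt0 e0 n1).
have -> : dotO f (phi k) = - dotO f (F N \- phi k).
  by rewrite (dotBr mO (test2 (tF N)) (p2 k) f2) (f0 _ (tF N)) sub0r opprK.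
rewrite normrN; apply: le_trans (dot_norm_le mO f2 (sqintB mO (test2 (tF N)) (p2 k))) _.
have := ler_wpM2l (nrm_ge0 leb2 (Omega : set mplane) f) h.
move=> h'; apply: le_trans h' _.
by rewrite mulrCA ler_piMr ?(ltW e0)// ler_pdivrMr// mul1r lerDr.
Qed.

End eigenfunctions.

(** * The mollifying kernel *)

Lemma smooth_expr_derivable (R : realType) (f : R * R -> R) y d :
  smooth_expr f -> derivable f y d.
Proof. by move=> sf; apply: diff_derivable; exact: smooth_expr_diff. Qed.
Arguments smooth_expr_derivable {R f} y d _.

Section kernels.
Context {R : realType}.
Implicit Types (x y : R * R) (t : R).
Local Notation mplane := (measurableTypeR R * measurableTypeR R)%type.

Definition sqdist x y : R := (y.1 - x.1) ^+ 2 + (y.2 - x.2) ^+ 2.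

(** A mollifier at scale sqrt t centred at x: its support is the disc of radius
    sqrt t, and in dimension 2 the factor 1 / t makes its mass independent of
    t. *)
Definition kern t x y : R := t^-1 * flat 2 (1 - sqdist x y / t).

(** The potential of the t-derivative of the kernel: the profile flat 0 is a
    primitive of flat 2, and for a radial profile F in dimension 2 the Laplacian
    of F (1 - |y - x| ^ 2 / t) / (4 t) is the t-derivative of
    F' (1 - |y - x| ^ 2 / t) / t. *)
Definition zeta t x y : R := (4 * t)^-1 * flat 0 (1 - sqdist x y / t).

(** Common value of the t-derivative of kern and of the Laplacian of zeta. *)
Definition dkern t x y : R :=
  t^-1 ^+ 2 * (sqdist x y / t * (flat 4 (1 - sqdist x y / t) -
    2 * flat 3 (1 - sqdist x y / t)) - flat 2 (1 - sqdist x y / t)).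

Lemma sqdistC x y : sqdist x y = sqdist y x.
Proof. by rewrite /sqdist; ring. Qed.

Lemma kernC t x y : kern t x y = kern t y x.
Proof. by rewrite /kern sqdistC. Qed.

Lemma sqdist_ge0 x y : 0 <= sqdist x y.
Proof. by rewrite addr_ge0 ?sqr_ge0. Qed.

Lemma sqdist_le x y t : 0 <= t -> sqdist x y <= t ^+ 2 ->
  `|y.1 - x.1| <= t /\ `|y.2 - x.2| <= t.
Proof.
move=> t0; rewrite /sqdist => h.
by split; rewrite -(@ler_pXn2r _ 2)// ?nnegrE// real_normK ?num_real//;
  apply: le_trans h; rewrite ?lerDl ?lerDr sqr_ge0.
Qed.

(* The argument of the profiles, as an expression built from the coordinates, so
   that smoothness and derivatives can be read off. *)
Let q t x : R * R -> R := cst 1 + cst (- t^-1) *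
  ((fst + cst (- x.1)) * (fst + cst (- x.1)) + (snd + cst (- x.2)) * (snd + cst (- x.2))).

Let qE t x : q t x = fun y => 1 - sqdist x y / t.
Proof. by apply/funext => y; rewrite /q /sqdist !addrfctE !mulrfctE /=; ring. Qed.

Let qy t x y : q t x y = 1 - sqdist x y / t.
Proof. by rewrite qE. Qed.

Let smooth_lin c : smooth_expr (fst + cst c : R * R -> R) /\
  smooth_expr (snd + cst c : R * R -> R).
Proof.
by split; apply: smooth_expr_add; solve [exact: smooth_expr_fst|exact: smooth_expr_snd|exact: smooth_expr_cst].
Qed.

Let smooth_q t x : smooth_expr (q t x).
Proof.
have [f1 _] := smooth_lin (- x.1); have [_ f2] := smooth_lin (- x.2).
apply: smooth_expr_add; first exact: smooth_expr_cst.
apply: smooth_expr_mul; first exact: smooth_expr_cst.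
by apply: smooth_expr_add; exact: smooth_expr_mul.
Qed.

Lemma smooth_flat_disc k t x : smooth (fun y => flat k (1 - sqdist x y / t)).
Proof.
apply/smooth_exprP; have := smooth_expr_flat k (smooth_q t x).
by congr smooth_expr; apply/funext => y; rewrite /= qy.
Qed.

Let D_lin (d : R * R) c y :
  'D_d (fst + cst c : R * R -> R) y = d.1 /\ 'D_d (snd + cst c : R * R -> R) y = d.2.
Proof.
have dc : derivable (cst c : R * R -> R) y d by exact: derivable_cst.
have d1 : derivable (fst : R * R -> R) y d.
  by apply: diff_derivable; exact: differentiable_fst.
have d2 : derivable (snd : R * R -> R) y d.
  by apply: diff_derivable; exact: differentiable_snd.
split.
  by rewrite (deriveD d1 dc) derive_fst derive_cst addr0.
by rewrite (deriveD d2 dc) derive_snd derive_cst addr0.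
Qed.

Let D_q (d : R * R) t x y : 'D_d (q t x) y =
  - t^-1 * (2 * (y.1 - x.1) * d.1 + 2 * (y.2 - x.2) * d.2).
Proof.
have [f1 _] := smooth_lin (- x.1); have [_ f2] := smooth_lin (- x.2).
have d1 := smooth_expr_derivable y d f1; have d2 := smooth_expr_derivable y d f2.
have d11 := smooth_expr_derivable y d (smooth_expr_mul f1 f1).
have d22 := smooth_expr_derivable y d (smooth_expr_mul f2 f2).
have ds := smooth_expr_derivable y d (smooth_expr_add (smooth_expr_mul f1 f1) (smooth_expr_mul f2 f2)).
have dc c : derivable (cst c : R * R -> R) y d by exact: derivable_cst.
have dp := smooth_expr_derivable y d (smooth_expr_mul (smooth_expr_cst (- t^-1))
  (smooth_expr_add (smooth_expr_mul f1 f1) (smooth_expr_mul f2 f2))).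
rewrite /q (deriveD (dc 1) dp) derive_cst add0r (deriveM (dc _) ds).
rewrite derive_cst (deriveD d11 d22) (deriveM d1 d1) (deriveM d2 d2).
rewrite (D_lin d (- x.1) y).1 (D_lin d (- x.2) y).2 /GRing.scale/= !addrfctE /=.
by ring.
Qed.

Let DD_zeta (d : R * R) c t x y :
  'D_d ('D_d (cst c * (flat 0 \o q t x)) : R * R -> R) y =
  c * ('D_d (q t x) y ^+ 2 * (flat 4 (q t x y) - 2 * flat 3 (q t x y))
       - t^-1 * (2 * d.1 ^+ 2 + 2 * d.2 ^+ 2) * flat 2 (q t x y)).
Proof.
have [f1 _] := smooth_lin (- x.1); have [_ f2] := smooth_lin (- x.2).
have sq := smooth_q t x.
have s0 := smooth_expr_flat 0 sq; have s2 := smooth_expr_flat 2 sq.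
have dc z e : derivable (cst e : R * R -> R) z d by exact: derivable_cst.
have D1 : 'D_d (cst c * (flat 0 \o q t x)) =
    cst (- c * t^-1 * 2) * ((cst d.1 * (fst + cst (- x.1)) + cst d.2 * (snd + cst (- x.2))) * (flat 2 \o q t x)).
  apply/funext => z; rewrite (deriveM (dc z c) (smooth_expr_derivable z d s0)).
  rewrite derive_cst derive_flat_comp; last exact: smooth_expr_diff.
  by rewrite D_q /GRing.scale/= !mulrfctE !addrfctE /=; ring.
have sl : smooth_expr (cst d.1 * (fst + cst (- x.1)) + cst d.2 * (snd + cst (- x.2)) : R * R -> R).
  by apply: smooth_expr_add; apply: smooth_expr_mul => //; exact: smooth_expr_cst.
rewrite D1 (deriveM (dc _ _) (smooth_expr_derivable y d (smooth_expr_mul sl s2))).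
rewrite derive_cst (deriveM (smooth_expr_derivable y d sl) (smooth_expr_derivable y d s2)).
rewrite (deriveD (smooth_expr_derivable y d (smooth_expr_mul (smooth_expr_cst _) f1))
  (smooth_expr_derivable y d (smooth_expr_mul (smooth_expr_cst _) f2))).
rewrite (deriveM (dc _ _) (smooth_expr_derivable y d f1)) (deriveM (dc _ _) (smooth_expr_derivable y d f2)).
rewrite derive_cst derive_cst (D_lin d (- x.1) y).1 (D_lin d (- x.2) y).2.
rewrite derive_flat_comp; last exact: smooth_expr_diff.
by rewrite D_q /GRing.scale/= !mulrfctE !addrfctE /=; ring.
Qed.

Lemma laplacian_zeta t x : 0 < t -> laplacian (zeta t x) = dkern t x.
Proof.
move=> t0; have -> : zeta t x = cst (4 * t)^-1 * (flat 0 \o q t x).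
  by apply/funext => y; rewrite /zeta mulrfctE /= qy.
apply/funext => y.
apply: (etrans (congr2 +%R (DD_zeta (1, 0) (4 * t)^-1 t x y) (DD_zeta (0, 1) (4 * t)^-1 t x y))).
rewrite (D_q (1, 0)) (D_q (0, 1)) /= qy /dkern /sqdist.
set A := flat 4 _; set B := flat 3 _; set C := flat 2 _.
by field; lra.
Qed.

Lemma is_derive_kern t x y : 0 < t ->
  is_derive t 1 (fun t => kern t x y) (dkern t x y).
Proof.
move=> t0; have tn0 : id t != 0 by rewrite gt_eqF.
have dV : is_derive t 1 (fun s : R => s^-1) (- t^-1 ^+ 2).
  apply: (is_derive_eq (is_deriveV tn0 (is_derive_id t 1))).
  by rewrite /= /GRing.scale/= mulr1 exprVn.
have dq : is_derive t 1 (fun s : R => 1 - sqdist x y / s) (sqdist x y * t^-1 ^+ 2).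
  have h := is_deriveB (is_derive_cst (1:R) t 1) (is_deriveZ (sqdist x y) dV).
  apply: (is_derive_eq h); rewrite /GRing.scale/=; ring.
have df := @is_derive1_comp R (flat 2) (fun s => 1 - sqdist x y / s) t _ _
  (is_derive_flat 2 _) dq.
have h := is_deriveM dV df; apply: (is_derive_eq h).
rewrite /GRing.scale/= /dkern.
set A := flat 4 _; set B := flat 3 _; set C := flat 2 _.
by field; lra.
Qed.

Lemma disc_out k t x y : 0 < t -> t <= sqdist x y -> flat k (1 - sqdist x y / t) = 0.
Proof.
by move=> t0 h; rewrite flat_le0// subr_le0 ler_pdivlMr// mul1r.
Qed.

Lemma kern_ge0 t x y : 0 < t -> 0 <= kern t x y.
Proof. by move=> t0; rewrite mulr_ge0 ?flat_ge0// invr_ge0 ltW. Qed.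

Lemma kern_le t x y : 0 < t -> kern t x y <= 2 / t.
Proof.
move=> t0; rewrite /kern mulrC ler_wpM2r ?invr_ge0 ?(ltW t0)//.
by apply: le_trans (flat_le_fact _ _) _; rewrite (_ : 2`! = 2%N).
Qed.

Lemma kern_out t x y : 0 < t -> t <= sqdist x y -> kern t x y = 0.
Proof. by move=> t0 h; rewrite /kern disc_out// mulr0. Qed.

Lemma dkern_out t x y : 0 < t -> t <= sqdist x y -> dkern t x y = 0.
Proof. by move=> t0 h; rewrite /dkern !disc_out//; ring. Qed.

Lemma zeta_out t x y : 0 < t -> t <= sqdist x y -> zeta t x y = 0.
Proof. by move=> t0 h; rewrite /zeta disc_out// mulr0. Qed.

Lemma zeta_le t x y : 0 < t -> `|zeta t x y| <= (4 * t)^-1.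
Proof.
move=> t0; rewrite ger0_norm; last first.
  by rewrite mulr_ge0 ?flat_ge0// invr_ge0; lra.
rewrite ler_piMr//; first by rewrite invr_ge0; lra.
exact: flat_le_fact.
Qed.

(** On the disc |y - x| ^ 2 / t <= 1, and flat 4, flat 3, flat 2 are at most 24,
    6, 2; the bound is 24 + 2 * 6 + 2. *)
Lemma dkern_le t x y : 0 < t -> `|dkern t x y| <= 38 * t^-1 ^+ 2.
Proof.
move=> t0; have [h|h] := leP t (sqdist x y).
  by rewrite dkern_out// normr0 mulr_ge0// sqr_ge0.
rewrite /dkern normrM ger0_norm ?sqr_ge0// mulrC ler_wpM2r ?sqr_ge0//.
set r := sqdist x y / t.
have r0 : 0 <= r by rewrite divr_ge0 ?sqdist_ge0// ltW.
have r1 : r <= 1 by rewrite ler_pdivrMr// mul1r ltW.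
have A0 := flat_ge0 4 (1 - r); have A1 := flat_le_fact 4 (1 - r).
have B0 := flat_ge0 3 (1 - r); have B1 := flat_le_fact 3 (1 - r).
have C0 := flat_ge0 2 (1 - r); have C1 := flat_le_fact 2 (1 - r).
rewrite (_ : 4`! = 24%N)// in A1; rewrite (_ : 3`! = 6%N)// in B1.
rewrite (_ : 2`! = 2%N)// in C1.
rewrite ler_norml; apply/andP; split; nra.
Qed.

Lemma disc_compact t x : 0 <= t -> compact [set y | sqdist x y <= t ^+ 2].
Proof.
move=> t0.
apply: (@subclosed_compact _ _ (`[x.1 - t, x.1 + t] `*` `[x.2 - t, x.2 + t])).
- have -> : [set y | sqdist x y <= t ^+ 2] = q 1 x @^-1` [set z | 1 - t ^+ 2 <= z].
    by apply/seteqP; split => y /=; rewrite qy divr1; lra.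
  apply: closed_comp; last exact: closed_ge.
  by move=> y _; apply: smooth_continuous; apply/smooth_exprP.
- by apply: compact_setX; exact: segment_compact.
- move=> y /= /(sqdist_le t0)[]; rewrite !ler_norml => /andP[a1 a2] /andP[b1 b2].
  by split; rewrite /= in_itv/=; apply/andP; split; lra.
Qed.

Lemma disc_test_function Omega k t x : 0 < t ->
  (forall y, sqdist x y <= t -> Omega y) ->
  test_function Omega (fun y => flat k (1 - sqdist x y / t)).
Proof.
move=> t0 dO; apply: (@test_functionI _ _ [set y | sqdist x y <= Num.sqrt t ^+ 2]).
- exact: smooth_flat_disc.
- by apply: disc_compact; exact: sqrtr_ge0.
- by move=> y /=; rewrite sqr_sqrtr ?(ltW t0)//; exact: dO.
- by move=> y /=; rewrite sqr_sqrtr ?(ltW t0)// => /negP; rewrite -ltNge => /ltW; exact: disc_out.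
Qed.

Lemma zeta_test_function Omega t x : 0 < t ->
  (forall y, sqdist x y <= t -> Omega y) -> test_function Omega (zeta t x).
Proof.
move=> t0 dO; have h := disc_test_function 0 t0 dO.
have sc : smooth (cst (4 * t)^-1 : R * R -> R).
  by apply/smooth_exprP; exact: smooth_expr_cst.
have := test_functionM h sc; congr test_function.
by apply/funext => y; rewrite /zeta mulrfctE mulrC.
Qed.

Lemma kern_continuous t x : continuous (kern t x).
Proof.
have s : smooth (kern t x).
  apply/smooth_exprP.
  rewrite (_ : kern t x = cst t^-1 * (fun y => flat 2 (1 - sqdist x y / t))).
    apply: smooth_expr_mul; first exact: smooth_expr_cst.
    exact/smooth_exprP/smooth_flat_disc.
  by apply/funext => y.
exact: smooth_continuous.
Qed.

Lemma dkern_continuous t x : 0 < t -> continuous (dkern t x).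
Proof.
move=> t0; rewrite -laplacian_zeta//.
have sz : smooth (zeta t x).
  apply/smooth_exprP.
  rewrite (_ : zeta t x = cst (4 * t)^-1 * (fun y => flat 0 (1 - sqdist x y / t))).
    apply: smooth_expr_mul; first exact: smooth_expr_cst.
    exact/smooth_exprP/smooth_flat_disc.
  by apply/funext => y.
apply: smooth_continuous; apply/smooth_exprP; apply: smooth_expr_add;
  by do 2 apply: smooth_expr_derive; exact/smooth_exprP.
Qed.

End kernels.

(** * Decay of the kernel derivative against a spectral series *)

Section kernel_estimates.
Context {R : realType}.
Local Notation mplane := (measurableTypeR R * measurableTypeR R)%type.
Variables (Omega : set (R * R)) (M : R).
Hypothesis M0 : 0 < M.
Hypothesis oO : open Omega.
Hypothesis OM : Omega `<=` `]- M, M[ `*` `]- M, M[.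
Local Notation sqintO := (sqint leb2 (Omega : set mplane)).
Local Notation dotO := (dot leb2 (Omega : set mplane)).
Local Notation nrmO := (nrm leb2 (Omega : set mplane)).
Implicit Types (f g u v : R * R -> R) (x y : R * R) (t s C : R).

Let mO : measurable (Omega : set mplane). Proof. exact: open_measurable2. Qed.

(** The disc of radius sqrt t sits in a square of area 4 t. *)
Lemma Rintegral_disc_le g C t x : 0 < t -> 0 <= C ->
  leb2.-integrable (Omega : set mplane) (EFin \o g) ->
  (forall y, g y <= C) -> (forall y, t <= sqdist x y -> g y <= 0) ->
  (\int[leb2]_(y in (Omega : set mplane)) g y)%R <= C * (4 * t).
Proof.
move=> t0 C0 ig gC gout; set r := Num.sqrt t.
have r0 : 0 < r by rewrite sqrtr_gt0.
have rt : r ^+ 2 = t by rewrite sqr_sqrtr// ltW.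
pose B : set mplane := `]x.1 - r, x.1 + r[ `*` `]x.2 - r, x.2 + r[.
have mB : measurable B by exact: measurable_box.
have leB : leb2 B = (4 * t)%:E.
  by rewrite /B leb2_box; [congr (_%:E); rewrite -rt; ring|lra|lra].
have iB : leb2.-integrable (Omega : set mplane) (EFin \o (\1_B : mplane -> R)).
  apply/integrableP; split; first by apply/measurable_EFinP; exact: measurable_indic.
  under eq_integral do rewrite /= ger0_norm ?indic_ge0//.
  rewrite integral_indic//; apply: (@le_lt_trans _ _ (leb2 B)); last by rewrite leB ltry.
  by apply: le_measure; rewrite ?inE//; exact: measurableI.
have IB : (\int[leb2]_(y in (Omega : set mplane)) (\1_B y : R))%R <= 4 * t.
  rewrite /Rintegral integral_indic//= -[4 * t]/(fine (4 * t)%:E) -leB.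
  have le : (leb2 (B `&` (Omega : set mplane)) <= leb2 B)%E.
    by apply: le_measure; rewrite ?inE//; exact: measurableI.
  apply: fine_le => //; last by rewrite leB.
  rewrite ge0_fin_numE ?measure_ge0//.
  by apply: le_lt_trans le _; rewrite leB ltry.
apply: (@le_trans _ _ (\int[leb2]_(y in (Omega : set mplane)) (C * \1_B y))%R).
  apply: le_Rintegral => //; first exact: (integrableZR mO C iB).
  move=> y _; rewrite indicE; case: (boolP (y \in B)) => yB; first by rewrite mulr1.
  rewrite mulr0; apply: gout; rewrite leNgt; apply: contra yB => h.
  have [h1 h2] : `|y.1 - x.1| < r /\ `|y.2 - x.2| < r.
    by split; rewrite -(@ltr_pXn2r _ 2)// ?nnegrE ?(ltW r0)// rt real_normK ?num_real//;
      apply: le_lt_trans h; rewrite /sqdist ?lerDl ?lerDr sqr_ge0.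
  rewrite inE; move: h1 h2; rewrite !ltr_norml => /andP[a1 a2] /andP[b1 b2].
  by split; rewrite /= in_itv/=; apply/andP; split; lra.
by rewrite (RintegralZl C mO iB) ler_wpM2l.
Qed.

Lemma dot_disc_le f C t x : 0 < t -> sqintO f -> (forall y, `|f y| <= C) ->
  (forall y, t <= sqdist x y -> f y = 0) -> dotO f f <= C ^+ 2 * (4 * t).
Proof.
move=> t0 f2 fC fout; have C0 : 0 <= C := le_trans (normr_ge0 _) (fC x).
apply: (@Rintegral_disc_le _ _ t x) => //; first exact: sqr_ge0.
- exact: (sqint_mul mO f2 f2).
- by move=> y; rewrite -expr2 -(real_normK (num_real (f y))) lerXn2r ?nnegrE.
- by move=> y /fout ->; rewrite mul0r.
Qed.

Lemma kern_sqint t x : 0 < t -> sqintO (kern t x).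
Proof.
move=> t0; apply: (@sqint_continuous _ _ M M0 oO OM _ (2 / t)).
  by move=> y _; exact: kern_continuous.
by move=> y _; rewrite ger0_norm ?kern_ge0 ?kern_le.
Qed.

Lemma dkern_sqint t x : 0 < t -> sqintO (dkern t x).
Proof.
move=> t0; apply: (@sqint_continuous _ _ M M0 oO OM _ (38 * t^-1 ^+ 2)).
  by move=> y _; exact: dkern_continuous.
by move=> y _; exact: dkern_le.
Qed.

Lemma sqint1 : sqintO (fun=> 1).
Proof.
apply: (@sqint_continuous _ _ M M0 oO OM _ 1) => [x _|x _]; first exact: cvg_cst.
by rewrite normr1.
Qed.

(** Below a = 1 the exponent -s is beaten by -1 because s < 1. *)
Lemma powRN_sqr_le a s : 0 < a -> 0 < s < 1 -> (a `^ (- s)) ^+ 2 <= 1 + a^-1 ^+ 2.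
Proof.
move=> a0 /andP[s0 s1].
have [a1|a1] := leP 1 a.
  have h : a `^ (- s) <= 1.
    by rewrite -(powRr0 a) ler_powR//; lra.
  have h0 := powR_ge0 a (- s); have := sqr_ge0 a^-1; nra.
have h : a `^ (- s) <= a^-1.
  rewrite -(powR_inv1 (ltW a0)); apply: ger_powR; last by lra.
  by rewrite a0 ltW.
have h0 := powR_ge0 a (- s).
have : (a `^ (- s)) ^+ 2 <= a^-1 ^+ 2 by rewrite lerXn2r ?nnegrE// invr_ge0 ltW.
lra.
Qed.

Variables (lam : nat -> R) (phi : nat -> R * R -> R).
Hypothesis eig : dirichlet_eigensystem Omega lam phi.

Let lam0 k : 0 < lam k. Proof. by have [] := eig.1 k. Qed.
Let p2 := eigen_sqint oO eig.
Let orth := eigen_orth eig.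
Let basis := eigen_basis oO eig.

(** The coefficients of dkern t x are - lam_k times those of zeta t x, and
    lam ^ (- 2 s) <= t ^ (2 s) (1 + (lam t) ^ -2). Hence the squares of
    lam_k ^ (- s) <dkern t x, phi_k> sum up to at most
    t ^ (2 s) (|dkern t x| ^ 2 + t ^ -2 |zeta t x| ^ 2). Both norms follow from
    sup bounds on a disc of area O(t), and the result is O(t ^ (2 s - 3)). The
    constant is chosen so that 4 * 38 ^ 2 + 1 / 4 <= 77 ^ 2. *)
Lemma dkern_estimate s u g t x : 1 / 2 < s -> s < 1 -> sqintO u -> sqintO g ->
  (forall k, dotO u (phi k) = lam k `^ (- s) * dotO g (phi k)) ->
  0 < t -> (forall y, sqdist x y <= t -> Omega y) ->
  `|dotO u (dkern t x)| <= 77 * nrmO g * t `^ (s - 3 / 2).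
Proof.
move=> s12 s1 u2 g2 ug t0 dO.
have s01 : 0 < s < 1 by apply/andP; split; lra.
have tz := zeta_test_function t0 dO.
have z2 := test_function_sqint M0 oO OM tz.
have e2 : sqintO (dkern t x) := dkern_sqint x t0.
have ez k : dotO (dkern t x) (phi k) = - (lam k * dotO (zeta t x) (phi k)).
  rewrite [dotO (zeta t x) (phi k)]dotC (eigen_weak M0 oO OM (eig.1 k) tz) opprK.
  by rewrite laplacian_zeta// dotC.
pose c k := lam k `^ (- s) * dotO (dkern t x) (phi k).
pose B := (77 * t `^ (s - 3 / 2)) ^+ 2.
have ts : t `^ (s - 3 / 2) ^+ 2 = t `^ s ^+ 2 * t^-1 ^+ 3.
  rewrite powRD; last by apply/implyP => _; rewrite gt_eqF.
  rewrite exprMn; congr (_ * _).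
  rewrite -powR_mulrn ?powR_ge0// -powRrM.
  rewrite (_ : - (3 / 2) * 2%:R = - 3%:R); last by field.
  by rewrite powRN powR_mulrn ?(ltW t0)// exprVn.
have cB n : \sum_(0 <= k < n) c k ^+ 2 <= B.
  apply: (@le_trans _ _ (t `^ s ^+ 2 * (\sum_(0 <= k < n) dotO (dkern t x) (phi k) ^+ 2 +
      t^-1 ^+ 2 * \sum_(0 <= k < n) dotO (zeta t x) (phi k) ^+ 2))).
    rewrite mulr_sumr -big_split/= mulr_sumr; apply: ler_sum => k _.
    have a0 : 0 < lam k * t by rewrite mulr_gt0.
    have h := powRN_sqr_le a0 s01.
    have E : lam k `^ (- s) = t `^ s * (lam k * t) `^ (- s).
      rewrite powRM ?(ltW (lam0 k)) ?(ltW t0)// mulrCA -powRD ?subrr ?powRr0 ?mulr1//.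
      by apply/implyP => _; rewrite gt_eqF.
    rewrite /c E exprMn exprMn -mulrA ler_wpM2l ?sqr_ge0//.
    apply: (@le_trans _ _ ((1 + (lam k * t)^-1 ^+ 2) * dotO (dkern t x) (phi k) ^+ 2)).
      by rewrite ler_wpM2r ?sqr_ge0.
    rewrite mulrDl mul1r lerD2l ez sqrrN exprMn invfM exprMn.
    rewrite mulrACA -exprMn mulrC.
    rewrite le_eqVlt; apply/orP; left; apply/eqP.
    by field; rewrite !gt_eqF.
  have h1 := le_trans (bessel mO p2 orth n e2)
    (dot_disc_le t0 e2 (fun y => dkern_le x y t0) (fun y => @dkern_out _ t x y t0)).
  have h2 := le_trans (bessel mO p2 orth n z2)
    (dot_disc_le t0 z2 (fun y => zeta_le x y t0) (fun y => @zeta_out _ t x y t0)).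
  rewrite /B exprMn ts mulrCA ler_wpM2l ?sqr_ge0//.
  have h2' := ler_wpM2l (sqr_ge0 t^-1) h2.
  apply: (le_trans (lerD h1 h2')).
  have -> : (38 * t^-1 ^+ 2) ^+ 2 * (4 * t) + t^-1 ^+ 2 * ((4 * t)^-1 ^+ 2 * (4 * t)) =
      (5776 + 4^-1) * t^-1 ^+ 3 by field; rewrite gt_eqF.
  by rewrite ler_wpM2r ?exprn_ge0 ?invr_ge0 ?(ltW t0)//; lra.
(* w is the power - s of the Dirichlet Laplacian applied to dkern t x; moving
   that power from u to the kernel turns <u, dkern t x> into <g, w>. *)
have [w w2 wc] := riesz_fischer mO p2 orth cB.
have wB : nrmO w <= 77 * t `^ (s - 3 / 2).
  apply: nrm_le; first by rewrite mulr_ge0 ?powR_ge0.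
  have h := parseval mO p2 basis w2 w2.
  rewrite -(cvg_lim (@Rhausdorff R) h); apply: limr_le; first exact: cvgP h.
  by apply: nearW => n; under eq_bigr do rewrite wc -expr2; exact: cB.
have -> : dotO u (dkern t x) = dotO g w.
  have h1 := parseval mO p2 basis u2 e2.
  have h2 := parseval mO p2 basis g2 w2.
  have E : (fun n => \sum_(0 <= k < n) dotO u (phi k) * dotO (dkern t x) (phi k)) =
      (fun n => \sum_(0 <= k < n) dotO g (phi k) * dotO w (phi k)).
    apply/funext => n; apply: eq_bigr => k _.
    by rewrite ug wc /c; ring.
  by rewrite E in h1; exact: (cvg_unique (@Rhausdorff R) h1 h2).
apply: le_trans (dot_norm_le mO g2 w2) _.
by rewrite [77 * _]mulrC -mulrA ler_wpM2l ?nrm_ge0.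
Qed.

End kernel_estimates.

(** * Point limits of averages *)

Section averages.
Context {R : realType}.
Local Notation mplane := (measurableTypeR R * measurableTypeR R)%type.
Variables (Omega : set (R * R)) (M : R).
Hypothesis M0 : 0 < M.
Hypothesis oO : open Omega.
Hypothesis OM : Omega `<=` `]- M, M[ `*` `]- M, M[.
Local Notation sqintO := (sqint leb2 (Omega : set mplane)).
Local Notation dotO := (dot leb2 (Omega : set mplane)).
Local Notation nrmO := (nrm leb2 (Omega : set mplane)).
Implicit Types (f g u v : R * R -> R) (x y : R * R) (t : R).

Let mO : measurable (Omega : set mplane). Proof. exact: open_measurable2. Qed.

Lemma nrm_le_cst f C : sqintO f -> (forall y, Omega y -> `|f y| <= C) -> 0 <= C ->
  nrmO f <= C * nrmO (fun=> 1).
Proof.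
move=> f2 fC C0; have o2 := sqint1 M0 oO OM.
apply: nrm_le; first by rewrite mulr_ge0 ?nrm_ge0.
rewrite exprMn nrm_sqr /dot -RintegralZl//; last exact: (sqint_mul mO o2 o2).
apply: le_Rintegral => //; first exact: (sqint_mul mO f2 f2).
  have := integrableZR mO (C ^+ 2) (sqint_mul mO o2 o2); exact.
move=> y /fC h; rewrite !mulr1 -expr2 -(real_normK (num_real (f y))).
by rewrite lerXn2r ?nnegrE.
Qed.

(** Differentiation under the integral sign: for z between t / 2 and 2 t the
    t-derivative of the kernel is bounded by its bound at t / 2. *)
Lemma is_derive_dot_kern u t x : 0 < t -> sqintO u ->
  is_derive t 1 (fun t => dotO u (kern t x)) (dotO u (dkern t x)).
Proof.
move=> t0 u2; have o2 := sqint1 M0 oO OM.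
have It : `]t / 2, 2 * t[%classic t by rewrite /= in_itv/=; apply/andP; split; lra.
have ipos (z : R) : `]t / 2, 2 * t[%classic z -> t / 2 < z by rewrite /= in_itv/= => /andP[].
have if_ (z : R) : `]t / 2, 2 * t[%classic z ->
    leb2.-integrable (Omega : set mplane) (EFin \o (fun y => u y * kern z x y)).
  move=> /ipos h; have z0 : 0 < z by lra.
  exact: (sqint_mul mO u2 (kern_sqint M0 oO OM x z0)).
have der (z : R) y : 0 < z -> is_derive z 1 (fun z => u y * kern z x y) (u y * dkern z x y).
  move=> z0; have := is_deriveZ (u y) (is_derive_kern x y z0); exact.
have df (z : R) (y : mplane) : `]t / 2, 2 * t[%classic z -> (Omega : set mplane) y ->
    derivable (fun z => u y * kern z x y) z 1.
  move=> /ipos h _; have z0 : 0 < z by lra.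
  by have [] := der z y z0.
pose G (y : mplane) := `|u y| * (38 * (t / 2)^-1 ^+ 2).
have G0 y : 0 <= G y by rewrite mulr_ge0// mulr_ge0// sqr_ge0.
have iu : leb2.-integrable (Omega : set mplane) (EFin \o u).
  have := sqint_mul mO u2 o2; apply: eq_integrable => // y _.
  by rewrite /= mulr1.
have iG : leb2.-integrable (Omega : set mplane) (EFin \o G).
  have ia : leb2.-integrable (Omega : set mplane) (EFin \o (fun y => `|u y|)).
    have := integrable_abse iu; exact.
  have := integrableZR mO (38 * (t / 2)^-1 ^+ 2) ia.
  by apply: eq_integrable => // y _; rewrite /G /= mulrC.
have p1 (z : R) y : 0 < z -> partial1of2 (fun z y => u y * kern z x y) z y = u y * dkern z x y.
  by move=> z0; rewrite /partial1of2 derive1E; have [_] := der z y z0.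
have Gub (z : R) (y : mplane) : `]t / 2, 2 * t[%classic z -> (Omega : set mplane) y ->
    `|partial1of2 (fun z y => u y * kern z x y) z y| <= G y.
  move=> /ipos h _; have z0 : 0 < z by lra.
  rewrite p1// normrM ler_wpM2l//; apply: le_trans (dkern_le x y z0) _.
  have t20 : 0 < t / 2 by lra.
  have hz : z^-1 <= (t / 2)^-1 by rewrite lef_pV2 ?posrE// ltW.
  have z1 : 0 <= z^-1 by rewrite invr_ge0 ltW.
  by rewrite ler_wpM2l// lerXn2r ?nnegrE//; exact: le_trans hz.
have d1 := @derivable_under_integral R _ mplane leb2 (fun z y => u y * kern z x y)
  Omega mO t (t / 2) (2 * t) It if_ df G G0 iG Gub.
have d2 := @differentiation_under_integral R _ mplane leb2 (fun z y => u y * kern z x y)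
  Omega mO t (t / 2) (2 * t) It if_ df G G0 iG Gub.
apply: DeriveDef; first exact: d1.
rewrite -derive1E [LHS]d2; apply: eq_Rintegral => y _; exact: p1.
Qed.

(** The derivative of flat 2 is flat 4 - 2 flat 3, at most 24 + 2 * 6 in absolute
    value. *)
Lemma flat_lipschitz (p q : R) : `|flat 2 p - flat 2 q| <= 36 * `|p - q|.
Proof.
wlog pq : p q / p < q => [hw|].
  have [h|h|->] := ltgtP p q; [exact: hw| |by rewrite !subrr normr0 mulr0].
  by rewrite distrC (distrC p); exact: hw.
have c : {within `[p, q], continuous (flat 2 : R -> R)}.
  apply: continuous_subspaceT => z; apply: differentiable_continuous.
  exact: flat_differentiable.
have [z _] := MVT pq (fun z _ => is_derive_flat 2 z) c.
rewrite distrC => ->; rewrite normrM (distrC p) ler_wpM2r//.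
have A0 := flat_ge0 4 z; have A1 := flat_le_fact 4 z.
have B0 := flat_ge0 3 z; have B1 := flat_le_fact 3 z.
rewrite (_ : 4`! = 24%N)// in A1; rewrite (_ : 3`! = 6%N)// in B1.
by rewrite ler_norml; apply/andP; split; lra.
Qed.

Lemma dot_kern_continuous u t : 0 < t -> sqintO u ->
  {in Omega, continuous (fun x => dotO u (kern t x))}.
Proof.
move=> t0 u2 x /set_mem Ox; have o2 := sqint1 M0 oO OM.
(* 36 is the Lipschitz constant of the profile and 4 M that of the squared
   distance, per coordinate, on the box containing Omega. *)
pose L := nrmO u * (t^-1 * (36 * (t^-1 * (4 * M))) * nrmO (fun=> 1)).
have L0 : 0 <= L.
  by rewrite !mulr_ge0 ?nrm_ge0 ?invr_ge0 ?(ltW t0) ?(ltW M0).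
have inM z : Omega z -> `|z.1| < M /\ `|z.2| < M.
  by move=> /OM[]; rewrite /= !in_itv/= !ltr_norml.
have key z : Omega z -> `|dotO u (kern t x) - dotO u (kern t z)| <=
    L * (`|x.1 - z.1| + `|x.2 - z.2|).
  move=> Oz; set del := `|x.1 - z.1| + `|x.2 - z.2|.
  have del0 : 0 <= del by rewrite addr_ge0.
  have k1 := kern_sqint M0 oO OM x t0; have k2 := kern_sqint M0 oO OM z t0.
  rewrite -dotBr//; apply: le_trans (dot_norm_le mO u2 (sqintB mO k1 k2)) _.
  rewrite /L -!mulrA ler_wpM2l ?nrm_ge0// !mulrA (mulrAC _ _ del).
  apply: nrm_le_cst; first exact: sqintB.
    move=> y Oy /=; rewrite /kern -mulrBr normrM ger0_norm ?invr_ge0 ?(ltW t0)//.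
    rewrite -!mulrA ler_wpM2l ?invr_ge0 ?(ltW t0)//.
    apply: le_trans (flat_lipschitz _ _) _; rewrite ler_wpM2l//.
    have -> : 1 - sqdist x y / t - (1 - sqdist z y / t) =
        t^-1 * (sqdist z y - sqdist x y) by ring.
    rewrite normrM ger0_norm ?invr_ge0 ?(ltW t0)// ler_wpM2l ?invr_ge0 ?(ltW t0)//.
    have [y1 y2] := inM y Oy; have [x1 x2] := inM x Ox; have [z1 z2] := inM z Oz.
    rewrite (_ : sqdist z y - sqdist x y = (x.1 - z.1) * (y.1 - z.1 + (y.1 - x.1)) +
      (x.2 - z.2) * (y.2 - z.2 + (y.2 - x.2))); last by rewrite /sqdist; ring.
    rewrite /del; apply: le_trans (ler_normD _ _) _.
    apply: (@le_trans _ _ (`|x.1 - z.1| * (4 * M) + `|x.2 - z.2| * (4 * M))); last first.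
      by rewrite le_eqVlt; apply/orP; left; apply/eqP; ring.
    apply: lerD; rewrite normrM ler_wpM2l//.
      move: y1 x1 z1; rewrite !ltr_norml => /andP[a1 a2] /andP[a3 a4] /andP[a5 a6].
      by rewrite ler_norml; apply/andP; split; lra.
    move: y2 x2 z2; rewrite !ltr_norml => /andP[a1 a2] /andP[a3 a4] /andP[a5 a6].
    by rewrite ler_norml; apply/andP; split; lra.
  by rewrite !mulr_ge0 ?invr_ge0 ?(ltW t0) ?(ltW M0).
apply/cvgrPdist_le => e e0.
have d0 : 0 < e / (2 * (L + 1)) by rewrite divr_gt0// mulr_gt0//; lra.
have : nbhs x (Omega `&` ball x (e / (2 * (L + 1)))).
  by apply: filterI; [exact: open_nbhs_nbhs|exact: nbhsx_ballx].
apply: filterS => z [Oz [/ltW b1 /ltW b2]].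
apply: le_trans (key z Oz) _.
apply: (@le_trans _ _ (L * (e / (2 * (L + 1)) + e / (2 * (L + 1))))).
  by rewrite ler_wpM2l// lerD.
have -> : e / (2 * (L + 1)) + e / (2 * (L + 1)) = e / (L + 1) by field; lra.
by rewrite mulrCA ler_piMr ?(ltW e0)// ler_pdivrMr ?mul1r; lra.
Qed.

Lemma small_powR (K b e : R) : 0 <= K -> 0 < b -> 0 < e ->
  exists2 tau, 0 < tau & forall t, 0 < t <= tau -> K * t `^ b <= e.
Proof.
move=> K0 b0 e0; have p0 : 0 < e / (K + 1) by rewrite divr_gt0//; lra.
exists ((e / (K + 1)) `^ b^-1); first exact: powR_gt0.
move=> t /andP[t0 tt].
have h : t `^ b <= e / (K + 1).
  have -> : e / (K + 1) = ((e / (K + 1)) `^ b^-1) `^ b.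
    by rewrite -powRrM mulVf ?gt_eqF// powRr1// ltW.
  apply: ge0_ler_powR; first exact: ltW.
  - by rewrite nnegrE ltW.
  - by rewrite nnegrE powR_ge0.
  - exact: tt.
apply: (le_trans (ler_wpM2l K0 h)).
by rewrite mulrCA ler_piMr ?(ltW e0)// ler_pdivrMr ?mul1r; lra.
Qed.

Lemma disc_nbhs x0 : Omega x0 ->
  exists2 T, 0 < T & \forall x \near x0, forall y, sqdist x y <= T -> Omega y.
Proof.
move=> Ox; have /nbhs_ballP[r /= r0 rO] : nbhs x0 Omega by exact: open_nbhs_nbhs.
exists ((r / 2) ^+ 2); first by rewrite exprn_gt0// divr_gt0.
have r4 : 0 < r / 2 by rewrite divr_gt0.
have := nbhsx_ballx x0 _ r4; apply: filterS => x [b1 b2] y /(sqdist_le (ltW r4))[h1 h2].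
apply: rO; move: b1 b2; rewrite /ball/= => b1 b2.
split; rewrite /ball/=.
  have -> : x0.1 - y.1 = (x0.1 - x.1) - (y.1 - x.1) by ring.
  by apply: le_lt_trans (ler_normB _ _) _; lra.
have -> : x0.2 - y.2 = (x0.2 - x.2) - (y.2 - x.2) by ring.
by apply: le_lt_trans (ler_normB _ _) _; lra.
Qed.

(** The scales are 1 / (n + 1). Only this sequence is used to define the limit;
    point_limit_dist then controls all scales. *)
Definition point_limit u x : R := limn (fun n => dotO u (kern n.+1%:R^-1 x)).

Section decay.
Variables (u : R * R -> R) (b C : R).
Hypothesis u2 : sqintO u.
Hypothesis b0 : 0 < b.
Hypothesis C0 : 0 <= C.
Hypothesis decay : forall t x, 0 < t -> (forall y, sqdist x y <= t -> Omega y) ->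
  `|dotO u (dkern t x)| <= C * t `^ (b - 1).

(** Since b > 0, the bound C t ^ (b - 1) on the t-derivative is integrable at 0.
    The mean value theorem is applied to the difference with the primitive
    C / b * t ^ b, once for each sign. *)
Lemma dot_kern_incr t t' x : 0 < t' -> t' <= t ->
  (forall y, sqdist x y <= t -> Omega y) ->
  `|dotO u (kern t x) - dotO u (kern t' x)| <= C / b * t `^ b.
Proof.
move=> t'0; rewrite le_eqVlt => /predU1P[->|t't] dO.
  by rewrite subrr normr0 mulr_ge0 ?powR_ge0// divr_ge0// ltW.
pose m t := dotO u (kern t x).
have main (sg : R) : `|sg| = 1 -> sg * (m t - m t') <= C / b * t `^ b.
  move=> sg1; pose F z := sg * m z - C / b * z `^ b.
  have dF z : z \in `]t', t[ ->
      is_derive z 1 F (sg * dotO u (dkern z x) - C * z `^ (b - 1)).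
    rewrite in_itv/= => /andP[z1 _]; have z0 : 0 < z by lra.
    have h1 := is_deriveZ sg (is_derive_dot_kern x z0 u2).
    have h2 := is_deriveZ (C / b) (is_derive1_powR b z0).
    apply: (is_derive_eq (is_deriveB h1 h2)).
    rewrite /GRing.scale/=; congr (_ - _); rewrite mulrA; congr (_ * _).
    by field; rewrite gt_eqF.
  have cF : {within `[t', t], continuous F}.
    apply: derivable_within_continuous => z; rewrite in_itv/= => /andP[z1 _].
    have z0 : 0 < z by lra.
    have h1 := is_deriveZ sg (is_derive_dot_kern x z0 u2).
    have h2 := is_deriveZ (C / b) (is_derive1_powR b z0).
    by have [] := is_deriveB h1 h2.
  have [z zt] := MVT t't dF cF.
  move: zt; rewrite in_itv/= => /andP[z1 z2] E; have z0 : 0 < z by lra.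
  have h : sg * dotO u (dkern z x) - C * z `^ (b - 1) <= 0.
    rewrite subr_le0; apply: (le_trans (ler_norm _)); rewrite normrM sg1 mul1r.
    by apply: decay => // y yz; apply: dO; apply: le_trans yz _; exact: ltW.
  have FF : F t - F t' <= 0 by rewrite E mulr_le0_ge0// subr_ge0 ltW.
  have K2 : 0 <= C / b * t' `^ b by rewrite mulr_ge0 ?powR_ge0// divr_ge0// ltW.
  have alg (p q k1 k2 : R) : sg * p - k1 - (sg * q - k2) <= 0 -> 0 <= k2 ->
    sg * (p - q) <= k1 by move=> *; lra.
  exact: (alg _ _ _ _ FF K2).
have alg (p k : R) : 1 * p <= k -> (-1) * p <= k -> `|p| <= k.
  by move=> *; rewrite ler_norml; apply/andP; split; lra.
exact: (alg _ _ (main 1 (normr1 _)) (main (-1) (normrN1 _))).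
Qed.

Let K := C / b.
Let K0 : 0 <= K. Proof. by rewrite divr_ge0// ltW. Qed.

Lemma point_limit_cvg T x : 0 < T -> (forall y, sqdist x y <= T -> Omega y) ->
  dotO u (kern n.+1%:R^-1 x) @[n --> \oo] --> point_limit u x.
Proof.
move=> T0 dO; apply/cauchy_cvgP; apply: cauchy_exP => e e0.
have e2 : 0 < e / 2 by rewrite divr_gt0.
have [tau tau0 Htau] := small_powR K0 b0 e2.
have mt : 0 < Num.min tau T by rewrite lt_min tau0 T0.
have [N _ HN] := near_infty_natSinv_lt (PosNum mt).
have /= := HN N (leqnn N); rewrite lt_min => /andP[/ltW N1 /ltW N2].
exists (dotO u (kern N.+1%:R^-1 x)); exists N => // n Nn /=.
rewrite /ball/=; apply: (@le_lt_trans _ _ (e / 2)); last by lra.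
apply: (@le_trans _ _ (K * N.+1%:R^-1 `^ b)).
  apply: dot_kern_incr; first by rewrite invr_gt0.
    by rewrite lef_pV2 ?posrE// ler_nat ltnS.
  by move=> y h; apply: dO; apply: le_trans N2.
by apply: Htau; rewrite N1 invr_gt0 ltr0Sn.
Qed.

Lemma point_limit_dist T t x : 0 < t -> t <= T ->
  (forall y, sqdist x y <= T -> Omega y) ->
  `|dotO u (kern t x) - point_limit u x| <= K * t `^ b.
Proof.
move=> t0 tT dO; have T0 : 0 < T by lra.
apply/ler_addgt0Pl => e e0.
have /cvgrPdist_le/(_ _ e0)[N _ HN] := point_limit_cvg T0 dO.
have [N' _ HN'] := near_infty_natSinv_lt (PosNum t0).
have h1 := HN _ (leq_maxl N N'); have /= h2 := HN' _ (leq_maxr N N').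
set n := maxn N N' in h1 h2.
have tri (p q r : R) : `|p - q| <= `|p - r| + `|q - r|.
  by rewrite (distrC q); exact: ler_distD.
apply: le_trans (tri _ _ (dotO u (kern n.+1%:R^-1 x))) _.
rewrite [leRHS]addrC; apply: lerD; last exact: h1.
apply: dot_kern_incr => //; first exact: ltW.
by move=> y h; apply: dO; apply: le_trans tT.
Qed.

(** On a neighbourhood of x0 all the discs of a fixed radius lie in Omega, so the
    continuous averages converge there uniformly. *)
Lemma point_limit_continuous : {in Omega, continuous (point_limit u)}.
Proof.
move=> x0 /set_mem Ox; apply/cvgrPdist_le => e e0.
have [T T0 nT] := disc_nbhs Ox.
have e3 : 0 < e / 3 by rewrite divr_gt0.
have [tau tau0 Htau] := small_powR K0 b0 e3.
pose t := Num.min tau T.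
have t0 : 0 < t by rewrite lt_min tau0 T0.
have tT : t <= T by rewrite ge_min lexx orbT.
have Kt : K * t `^ b <= e / 3 by apply: Htau; rewrite t0 ge_min lexx.
have /cvgrPdist_le/(_ _ e3) nc : dotO u (kern t x) @[x --> x0] --> dotO u (kern t x0).
  by apply: dot_kern_continuous => //; rewrite inE.
have d0 := point_limit_dist t0 tT (nbhs_singleton nT).
apply: filterS (filterI nT nc) => x [dx cx].
have d1 := point_limit_dist t0 tT dx.
have tri (p q r r' : R) : `|p - q| <= `|r - q| + `|r' - r| + `|r' - p|.
  rewrite -(normrN (r' - p)) (_ : p - q = (r - q) + (r' - r) + - (r' - p)); last by ring.
  by apply: le_trans (ler_normD _ _) _; rewrite lerD2r ler_normD.
apply: le_trans (tri _ _ (dotO u (kern t x)) (dotO u (kern t x0))) _.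
have -> : e = e / 3 + e / 3 + e / 3 by field.
exact: (lerD (lerD (le_trans d1 Kt) cx) (le_trans d0 Kt)).
Qed.

End decay.

End averages.

(** * Exchange of integrals and almost everywhere equality *)

(** Fubini's theorem for u (y) k (x, y) v (x), extended by 0 outside D. *)
Lemma Rintegral_exchange d (T : measurableType d) (R : realType)
    (mu : {sigma_finite_measure set T -> \bar R}) (D : set T)
    (u v : T -> R) (k : T * T -> R) (B : R) :
  measurable D -> mu.-integrable D (EFin \o u) -> mu.-integrable D (EFin \o v) ->
  measurable_fun setT k -> (forall z, `|k z| <= B) ->
  (\int[mu]_(x in D) ((\int[mu]_(y in D) (u y * k (x, y))) * v x))%R =
  (\int[mu]_(y in D) ((\int[mu]_(x in D) (v x * k (x, y))) * u y))%R.
Proof.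
move=> mD iu iv mk kB; have pt : T := point.
have B0 : 0 <= B := le_trans (normr_ge0 _) (kB (pt, pt)).
have mu_ : measurable_fun D u by apply/measurable_EFinP; exact: measurable_int iu.
have mv_ : measurable_fun D v by apply/measurable_EFinP; exact: measurable_int iv.
have mu' : measurable_fun setT (u \_ D) by apply/(measurable_restrictT _ mD).
have mv' : measurable_fun setT (v \_ D) by apply/(measurable_restrictT _ mD).
have iu' : mu.-integrable setT (EFin \o (u \_ D)).
  have := (integrable_mkcond _ mD).1 iu; apply: eq_integrable => // x _.
  by rewrite /= !patchE; case: ifP.
have iv' : mu.-integrable setT (EFin \o (v \_ D)).
  have := (integrable_mkcond _ mD).1 iv; apply: eq_integrable => // x _.
  by rewrite /= !patchE; case: ifP.
pose a (z : T * T) : \bar R := ((u \_ D) z.2 * k z * (v \_ D) z.1)%:E.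
have ma : measurable_fun setT a.
  apply/measurable_EFinP; apply: measurable_funM; last exact: measurableT_comp measurable_fst.
  by apply: measurable_funM => //; exact: measurableT_comp measurable_snd.
have mabs_u : measurable_fun setT (fun y => `|(u \_ D) y|%:E).
  by apply/measurable_EFinP; exact: measurableT_comp.
have mabs_v : measurable_fun setT (fun y => `|(v \_ D) y|%:E).
  by apply/measurable_EFinP; exact: measurableT_comp.
have fu : (\int[mu]_y `|(u \_ D) y|%:E < +oo)%E by have /integrableP[] := iu'.
have fv : (\int[mu]_y `|(v \_ D) y|%:E < +oo)%E by have /integrableP[] := iv'.
have ia : (mu \x mu)%E.-integrable setT a.
  apply: (@integrable12ltyP _ _ T T R mu mu a ma).2.
  pose A := (\int[mu]_y `|(u \_ D) y|%:E)%E.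
  have A0 : (0 <= A)%E by apply: integral_ge0 => y _; rewrite lee_fin.
  have Afin : A \is a fin_num by rewrite ge0_fin_numE.
  apply: (@le_lt_trans _ _ (\int[mu]_x (fine (B%:E * A) * `|(v \_ D) x|)%:E)%E).
    apply: ge0_le_integral => //.
    - by move=> x _; apply: integral_ge0.
    - apply: (measurable_fun_fubini_tonelli_F (abse \o a)) => //=.
      exact: measurableT_comp.
    - apply/measurable_EFinP; apply: measurable_funM => //.
      exact: measurableT_comp.
    move=> x _.
    apply: (@le_trans _ _ (\int[mu]_y ((B * `|(v \_ D) x|)%:E * `|(u \_ D) y|%:E))%E).
      apply: ge0_le_integral => //.
      + apply: measurableT_comp => //.
        exact: (measurableT_comp ma (pair1_measurable x)).
      + apply: emeasurable_funM => //.
      move=> y _; rewrite /a /= lee_fin !normrM.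
      rewrite [leRHS](_ : _ = `|(u \_ D) y| * B * `|(v \_ D) x|); last by ring.
      by rewrite ler_wpM2r// ler_wpM2l.
    rewrite ge0_integralZl_EFin ?mulr_ge0// -/A.
    have BA : (B%:E * A)%E \is a fin_num by rewrite fin_numM.
    by rewrite [leRHS]EFinM fineK// [X in (X * A)%E]EFinM muleAC.
  under eq_integral do rewrite EFinM.
  rewrite ge0_integralZl_EFin//; last by rewrite fine_ge0// mule_ge0.
  by rewrite lte_mul_pinfty// ?fin_numE// lee_fin fine_ge0// mule_ge0.
have F := Fubini ia.
have iuk x : mu.-integrable D (EFin \o (fun y => u y * k (x, y))).
  have := integrableMl mD iu (h := fun y => k (x, y)).
  apply; first exact: measurable_funTS (measurableT_comp mk (pair1_measurable x)).
  by exists B; split; [exact: num_real|move=> z Bz y _ /=; apply: le_trans (ltW Bz)].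
have ivk y : mu.-integrable D (EFin \o (fun x => v x * k (x, y))).
  have := integrableMl mD iv (h := fun x => k (x, y)).
  apply; first exact: measurable_funTS (measurableT_comp mk (pair2_measurable y)).
  by exists B; split; [exact: num_real|move=> z Bz x _ /=; apply: le_trans (ltW Bz)].
rewrite /Rintegral; congr fine.
transitivity (\int[mu]_x \int[mu]_y a (x, y))%E.
  rewrite integral_mkcond; apply: eq_integral => x _.
  rewrite patchE; case: ifPn => xD; last first.
    rewrite integral0_eq// => y _; rewrite /a /= [in X in _ * X]patchE (negbTE xD).
    by rewrite mulr0.
  rewrite EFinM fineK; last exact: (integrable_fin_num mD (iuk x)).
  rewrite -(integralZr mD (iuk x)) integral_mkcond; apply: eq_integral => y _.
  by rewrite /a /= !patchE xD; case: ifP => _; [rewrite -EFinM|rewrite !mul0r].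
rewrite F; apply/esym.
rewrite integral_mkcond; apply: eq_integral => y _.
rewrite patchE; case: ifPn => yD; last first.
  rewrite integral0_eq// => x _; rewrite /a /= [in X in X * _]patchE (negbTE yD).
  by rewrite !mul0r.
rewrite EFinM fineK; last exact: (integrable_fin_num mD (ivk y)).
rewrite -(integralZr mD (ivk y)) integral_mkcond; apply: eq_integral => x _.
rewrite /a /= !patchE yD; case: ifP => _; last by rewrite mulr0.
by rewrite -EFinM; congr (_%:E); ring.
Qed.

Section planar_measure.
Context {R : realType}.
Local Notation mplane := (measurableTypeR R * measurableTypeR R)%type.

(** The planar Lebesgue measure under a name that can carry the fact that it is
    sigma-finite, so that Fubini's theorem applies to its product with itself. *)
Definition planar : set mplane -> \bar R := @leb2 R.

HB.instance Definition _ := Measure.copy planar (@leb2 R : set mplane -> \bar R).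

Lemma planar_sigma_finite : sigma_finite setT planar.
Proof.
exists (fun n : nat => `]- n%:R, n%:R[ `*` `]- n%:R, n%:R[).
  apply/seteqP; split => // x _.
  pose n := Num.bound (Num.max `|x.1| `|x.2|).
  exists n => //=.
  have : Num.max `|x.1| `|x.2| < n%:R.
    apply: le_lt_trans (archi_boundP _); first exact: lexx.
    by rewrite le_max normr_ge0.
  by rewrite gt_max => /andP[h1 h2]; split; rewrite /= in_itv/= -ltr_norml.
move=> n; split; first exact: measurable_box.
have nn : - n%:R <= n%:R :> R by have := ler0n R n; lra.
by rewrite /planar (leb2_box nn nn) ltry.
Qed.

HB.instance Definition _ :=
  Measure_isSigmaFinite.Build _ _ _ planar planar_sigma_finite.

Lemma measurable_kern t : measurable_fun setT (fun z : mplane * mplane => kern t z.1 z.2).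
Proof.
have m11 : measurable_fun setT (fun z : mplane * mplane => z.1.1).
  exact: measurableT_comp measurable_fst measurable_fst.
have m12 : measurable_fun setT (fun z : mplane * mplane => z.1.2).
  exact: measurableT_comp measurable_snd measurable_fst.
have m21 : measurable_fun setT (fun z : mplane * mplane => z.2.1).
  exact: measurableT_comp measurable_fst measurable_snd.
have m22 : measurable_fun setT (fun z : mplane * mplane => z.2.2).
  exact: measurableT_comp measurable_snd measurable_snd.
have cf : continuous (flat 2 : R -> R).
  by move=> z; apply: differentiable_continuous; exact: flat_differentiable.
apply: measurable_funM => //.
apply: (measurableT_comp (continuous_measurable_fun cf)).
apply: measurable_funB => //; apply: measurable_funM => //.
by apply: measurable_funD; apply: measurable_funX; exact: measurable_funB.
Qed.

End planar_measure.

Section identification.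
Context {R : realType}.
Local Notation mplane := (measurableTypeR R * measurableTypeR R)%type.
Variables (Omega : set (R * R)) (M : R).
Hypothesis M0 : 0 < M.
Hypothesis oO : open Omega.
Hypothesis OM : Omega `<=` `]- M, M[ `*` `]- M, M[.
Local Notation sqintO := (sqint leb2 (Omega : set mplane)).
Local Notation dotO := (dot leb2 (Omega : set mplane)).
Local Notation nrmO := (nrm leb2 (Omega : set mplane)).
Implicit Types (f g u v : R * R -> R) (x y : R * R) (t : R).

Let mO : measurable (Omega : set mplane). Proof. exact: open_measurable2. Qed.

Lemma sqint_integrable u : sqintO u -> leb2.-integrable (Omega : set mplane) (EFin \o u).
Proof.
move=> u2; have := sqint_mul mO u2 (sqint1 M0 oO OM).
by apply: eq_integrable => // y _; rewrite /= mulr1.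
Qed.

Lemma dot_kern_sym u v t : 0 < t -> sqintO u -> sqintO v ->
  dotO (fun x => dotO u (kern t x)) v = dotO (fun y => dotO v (kern t y)) u.
Proof.
move=> t0 u2 v2.
have kB (z : mplane * mplane) : `|kern t z.1 z.2| <= 2 / t.
  by rewrite ger0_norm ?kern_ge0 ?kern_le.
have h := @Rintegral_exchange _ mplane R planar Omega u v _ (2 / t) mO
  (sqint_integrable u2) (sqint_integrable v2) (measurable_kern t) kB.
have {}h : dotO (fun x => dotO u (kern t x)) v =
  dotO (fun y => (\int[leb2]_(x in (Omega : set mplane)) (v x * kern t x y))%R) u.
  exact: h.
have E : (fun y => (\int[leb2]_(x in (Omega : set mplane)) (v x * kern t x y))%R) =
    (fun y => dotO v (kern t y)).
  by apply/funext => y; apply: eq_Rintegral => x _; rewrite kernC.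
by rewrite E in h.
Qed.

(** The set where f and g differ is open, and a nonempty open set has positive
    measure. *)
Lemma ae_eq_continuous f g : {in Omega, continuous f} -> {in Omega, continuous g} ->
  ae_eq leb2 (Omega : set mplane) f g -> forall x, Omega x -> f x = g x.
Proof.
move=> cf cg fg x Ox; apply: contrapT => /eqP fgx.
pose U := [set y | Omega y /\ f y - g y != 0].
have oU : open U.
  rewrite openE => y [Oy ny]; have Oy' : y \in Omega by rewrite inE.
  apply: filterI; first exact: open_nbhs_nbhs.
  have c : f z - g z @[z --> y] --> f y - g y by apply: cvgB; [exact: cf|exact: cg].
  by apply: (c [set r | r != 0]); apply: open_nbhs_nbhs; split; [exact: open_neq|].
have Ux : U x by split; rewrite ?subr_eq0.
have := leb2_open_gt0 oU Ux.
have [N [mN N0 sN]] := fg.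
suff : (leb2 U <= leb2 N)%E by rewrite N0 leNgt => /negP.
apply: le_measure; rewrite ?inE//; first exact: open_measurable2.
move=> y [Oy ny]; apply: sN => /= h; move: ny; rewrite h// subrr eqxx.
by [].
Qed.

End identification.

(** * The continuous representative *)

Section representative.
Context {R : realType}.
Local Notation mplane := (measurableTypeR R * measurableTypeR R)%type.
Variables (Omega : set (R * R)) (M : R).
Hypothesis M0 : 0 < M.
Hypothesis oO : open Omega.
Hypothesis OM : Omega `<=` `]- M, M[ `*` `]- M, M[.
Local Notation sqintO := (sqint leb2 (Omega : set mplane)).
Local Notation dotO := (dot leb2 (Omega : set mplane)).
Local Notation nrmO := (nrm leb2 (Omega : set mplane)).
Implicit Types (f g u v : R * R -> R) (x y : R * R) (t B : R).

Let mO : measurable (Omega : set mplane). Proof. exact: open_measurable2. Qed.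

Local Notation one := (fun=> 1 : R).
Let one2 : sqintO one := sqint1 M0 oO OM.
Let k2 := kern_sqint M0 oO OM.

(** The kernel is at most 2 / t and lives on a square of area 4 t. *)
Lemma dot_kern_le v B t x : 0 < t -> sqintO v -> (forall y, `|v y| <= B) ->
  `|dotO v (kern t x)| <= 8 * B.
Proof.
move=> t0 v2 vB; have B0 : 0 <= B := le_trans (normr_ge0 _) (vB x).
have i := sqint_mul mO v2 (k2 x t0).
have C0 : 0 <= B * (2 / t) by rewrite mulr_ge0// divr_ge0// ltW.
apply: (le_trans (le_normr_Rintegral mO i)).
have -> : 8 * B = B * (2 / t) * (4 * t) by field; lra.
apply: (@Rintegral_disc_le _ Omega oO _ _ t x) => //.
- have := integrable_abse i; exact.
- by move=> y; rewrite normrM ler_pM// ger0_norm ?kern_ge0// kern_le.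
- by move=> y h; rewrite /= kern_out// mulr0 normr0.
Qed.

(** The mass of the kernel does not depend on t: its t-derivative is the
    integral of the laplacian of a test function. *)
Lemma dot_one_dkern t x : 0 < t -> (forall y, sqdist x y <= t -> Omega y) ->
  dotO one (dkern t x) = 0.
Proof.
move=> t0 dO; have tz := zeta_test_function t0 dO.
have t1 := test_function_derive (1, 0) tz; have t2 := test_function_derive (0, 1) tz.
have z1 := test_function_sqint M0 oO OM (test_function_derive (1, 0) t1).
have z2 := test_function_sqint M0 oO OM (test_function_derive (0, 1) t2).
rewrite -laplacian_zeta//; apply: (etrans (dotDr mO z1 z2 one2)).
have e1 : dotO one ('D_(1, 0) ('D_(1, 0) (zeta t x) : R * R -> R)) = 0.
  rewrite -[RHS](integral_derive1_0 M0 oO OM t1).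
  by apply: eq_Rintegral => y _; exact: mul1r.
have e2 : dotO one ('D_(0, 1) ('D_(0, 1) (zeta t x) : R * R -> R)) = 0.
  rewrite -[RHS](integral_derive2_0 M0 oO OM t2).
  by apply: eq_Rintegral => y _; exact: mul1r.
by apply: (etrans (congr2 +%R e1 e2)); rewrite addr0.
Qed.

Let decay1 t x : 0 < t -> (forall y, sqdist x y <= t -> Omega y) ->
  `|dotO one (dkern t x)| <= 0 * t `^ (1 - 1).
Proof. by move=> t0 dO; rewrite dot_one_dkern// normr0 mul0r. Qed.

(** The kernel is not normalized: instead of computing its mass, which is the same
    for all x and all small t, everything is divided by it pointwise. *)
Definition mass x : R := point_limit Omega one x.

(** The general distance estimate with decay constant 0. *)
Lemma massE T t x : 0 < t -> t <= T -> (forall y, sqdist x y <= T -> Omega y) ->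
  dotO one (kern t x) = mass x.
Proof.
move=> t0 tT dO; apply/eqP; rewrite -subr_eq0 -normr_le0.
have := point_limit_dist M0 oO OM one2 ltr01 (lexx 0) decay1 t0 tT dO.
by rewrite mul0r mul0r.
Qed.

Lemma mass_continuous : {in Omega, continuous mass}.
Proof.
exact: (point_limit_continuous M0 oO OM one2 ltr01 (lexx 0) decay1).
Qed.

Lemma mass_le x : Omega x -> `|mass x| <= 8.
Proof.
move=> /(disc_nbhs oO)[T T0 /nbhs_singleton dO].
rewrite -(massE T0 (lexx T) dO) -[leRHS]mulr1.
by apply: dot_kern_le => // y; rewrite normr1.
Qed.

(** Otherwise the kernel would vanish a.e., hence everywhere by continuity, but it
    is positive at its centre. *)
Lemma mass_gt0 x : Omega x -> 0 < mass x.
Proof.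
move=> Ox; have [T T0 /nbhs_singleton dO] := disc_nbhs oO Ox.
rewrite -(massE T0 (lexx T) dO) lt_neqAle; apply/andP; split; last first.
  by apply: Rintegral_ge0 => y _; rewrite mul1r kern_ge0.
apply/eqP => m0.
have kk : dotO (kern T x) (kern T x) <= 0.
  rewrite -(mulr0 (2 / T)) m0 -dotZr//; last exact: k2.
  apply: le_Rintegral => //.
  - exact: (sqint_mul mO (k2 x T0) (k2 x T0)).
  - exact: (sqint_mul mO one2 (sqintZ mO (2 / T) (k2 x T0))).
  - by move=> y _; rewrite mul1r ler_wpM2r ?kern_ge0 ?kern_le.
have kz : dotO (kern T x) (kern T x) = 0.
  by apply/eqP; rewrite eq_le kk dot_ge0.
have kae := dot0_ae mO (k2 x T0) kz.
have c0 : {in Omega, continuous (fun=> 0 : R)} by move=> y _; exact: cvg_cst.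
have ck : {in Omega, continuous (kern T x)} by move=> y _; exact: kern_continuous.
have := ae_eq_continuous oO ck c0 kae Ox.
rewrite /kern /sqdist !subrr expr0n/= addr0 mul0r subr0 => /eqP.
by rewrite mulf_eq0 invr_eq0 !gt_eqF// flat_gt0.
Qed.

Lemma cvg_dot_dominated (g_ : nat -> R * R -> R) g u B : sqintO u ->
  (forall n, measurable_fun (Omega : set mplane) (g_ n)) ->
  measurable_fun (Omega : set mplane) g ->
  (forall n y, Omega y -> `|g_ n y| <= B) ->
  (forall y, Omega y -> g_ n y @[n --> \oo] --> g y) ->
  dotO (g_ n) u @[n --> \oo] --> dotO g u.
Proof.
move=> u2 mg_ mg gB gc; have [mu _] := u2.
have iu := sqint_integrable M0 oO OM u2.
have iG : leb2.-integrable (Omega : set mplane) (EFin \o (fun y => B * `|u y|)).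
  apply: (integrableZR mO); have := integrable_abse iu; exact.
have mgu n : measurable_fun (Omega : set mplane) (EFin \o (fun y => g_ n y * u y)).
  by apply/measurable_EFinP/measurable_funM.
have mgu' : measurable_fun (Omega : set mplane) (EFin \o (fun y => g y * u y)).
  by apply/measurable_EFinP/measurable_funM.
have cvg_ : {ae leb2, forall y, (Omega : set mplane) y ->
    (EFin \o (fun y => g_ n y * u y)) y @[n --> \oo] --> (EFin \o (fun y => g y * u y)) y}.
  apply: aeW => y Oy; apply: cvg_EFin; first exact: nearW.
  by apply: cvgM; [exact: gc|exact: cvg_cst].
have dom : {ae leb2, forall y, forall n : nat, (Omega : set mplane) y ->
    (`|(g_ n y * u y)%:E| <= (B * `|u y|)%:E)%E}.
  by apply: aeW => y n Oy; rewrite /= lee_fin normrM ler_wpM2r// gB.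
have [i1 _ h] := @dominated_convergence _ mplane R leb2 Omega mO _ _ _ mgu mgu' cvg_ iG dom.
have f1 := integrable_fin_num mO i1.
by apply: (@fine_cvg _ _ _ _ _); rewrite fineK.
Qed.

Section identify.
Variables (u : R * R -> R) (b C : R).
Hypothesis u2 : sqintO u.
Hypothesis b0 : 0 < b.
Hypothesis C0 : 0 <= C.
Hypothesis decay : forall t x, 0 < t -> (forall y, sqdist x y <= t -> Omega y) ->
  `|dotO u (dkern t x)| <= C * t `^ (b - 1).

Local Notation U := (point_limit Omega u).

Let cU : {in Omega, continuous U} := point_limit_continuous M0 oO OM u2 b0 C0 decay.

(** Subtracting the constant v y, the integrand is small on the disc that carries
    the kernel. *)
Lemma cvg_dot_kern v B y : Omega y -> sqintO v -> (forall z, `|v z| <= B) ->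
  {for y, continuous v} ->
  dotO v (kern n.+1%:R^-1 y) @[n --> \oo] --> mass y * v y.
Proof.
move=> Oy v2 vB cv; have [T T0 /nbhs_singleton dO] := disc_nbhs oO Oy.
apply/cvgrPdist_le => e e0.
have e8 : 0 < e / 8 by rewrite divr_gt0.
have cv' : v z @[z --> y] --> v y by exact: cv.
have /cvgrPdist_le/(_ _ e8)/nbhs_ballP[r /= r0 hr] := cv'.
have mt : 0 < Num.min T (r ^+ 2) by rewrite lt_min T0 exprn_gt0.
have [N _ HN] := near_infty_natSinv_lt (PosNum mt).
exists N => // n Nn /=.
have /= := HN n Nn; rewrite lt_min => /andP[/ltW nT nr].
set t := n.+1%:R^-1 in nT nr *.
have t0 : 0 < t by rewrite invr_gt0.
rewrite -(massE t0 nT dO).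
have vy2 : sqintO (fun z => v y * 1) := sqintZ mO (v y) one2.
have -> : dotO one (kern t y) * v y = dotO (fun z => v y * 1) (kern t y).
  by rewrite mulrC (dotZl mO (v y) one2 (k2 y t0)).
rewrite -(dotBl mO vy2 v2 (k2 y t0)).
have i := sqint_mul mO (sqintB mO vy2 v2) (k2 y t0).
apply: (le_trans (le_normr_Rintegral mO i)).
have -> : e = e / 8 * (2 / t) * (4 * t) by field; lra.
apply: (@Rintegral_disc_le _ Omega oO _ _ t y) => //.
- by rewrite mulr_ge0 ?(ltW e8)// divr_ge0// ltW.
- have := integrable_abse i; exact.
- move=> z; rewrite normrM /= mulr1.
  have [h|h] := leP t (sqdist y z).
    by rewrite kern_out// normr0 mulr0 mulr_ge0 ?(ltW e8)// divr_ge0// ltW.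
  apply: ler_pM => //; last by rewrite ger0_norm ?kern_ge0// kern_le.
  apply: hr; have h2 : sqdist y z < r ^+ 2 by apply: lt_trans h _.
  by split; rewrite /ball/= distrC -(@ltr_pXn2r _ 2)// ?nnegrE ?(ltW r0)//
    real_normK ?num_real//; apply: le_lt_trans h2; rewrite /sqdist ?lerDl ?lerDr sqr_ge0.
- by move=> z h; rewrite /= kern_out// mulr0 normr0.
Qed.

Lemma dot_kern_bounded t x : 0 < t ->
  `|dotO u (kern t x)| <= nrmO u * (2 / t * nrmO one).
Proof.
move=> t0; apply: le_trans (dot_norm_le mO u2 (k2 x t0)) _.
rewrite ler_wpM2l ?nrm_ge0//; apply: (nrm_le_cst M0 oO OM) => //; first exact: k2.
  by move=> y _; rewrite ger0_norm ?kern_ge0// kern_le.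
by rewrite divr_ge0// ltW.
Qed.

(** Localize with a bump chi supported in a disc where the averages converge
    uniformly. For a test function F the integral of <u, kern t x> chi F converges
    to that of U chi F; by symmetry of the kernel it is also the integral of u
    against the averages of chi F, which converge boundedly to mass chi F. Hence
    (U - mass u) chi is orthogonal to all test functions, so it vanishes a.e. *)
Lemma point_limit_eq_mass lam phi : dirichlet_eigensystem Omega lam phi ->
  ae_eq leb2 (Omega : set mplane) U (fun y => mass y * u y).
Proof.
move=> eig.
suff : leb2.-negligible ([set y | U y != mass y * u y] `&` Omega).
  apply: (@negligibleS _ mplane R leb2) => y /= h.
  have [Oy|nO] := pselect (Omega y); last by case: h => /nO.
  by split => //; apply/eqP => E; apply: h => _.
apply: negligible_locally => x0 Ox.
have [T T0 nT] := disc_nbhs oO Ox.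
have /nbhs_ballP[r /= r0 hr] := nT.
pose rho := (r / 2) ^+ 2.
have r2 : 0 < r / 2 by rewrite divr_gt0.
have rho0 : 0 < rho by rewrite exprn_gt0.
have discT z : sqdist x0 z <= rho -> forall y, sqdist z y <= T -> Omega y.
  move=> /(sqdist_le (ltW r2))[h1 h2]; apply: hr.
  by split; rewrite /ball/= distrC; lra.
have discO z : sqdist x0 z <= rho -> Omega z.
  by move=> /discT; apply; rewrite /sqdist !subrr expr0n/= addr0 ltW.
pose chi y := flat 0 (1 - sqdist x0 y / rho).
have tchi : test_function Omega chi := disc_test_function 0 rho0 discO.
have chi2 := test_function_sqint M0 oO OM tchi.
have chi_le y : `|chi y| <= 1.
  by rewrite ger0_norm ?flat_ge0//; exact: flat_le_fact.
have chi_out y : ~ sqdist x0 y <= rho -> chi y = 0.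
  by move=> /negP; rewrite -ltNge => /ltW h; exact: disc_out.
have [mu _] := u2.
have mU : measurable_fun (Omega : set mplane) U := open_continuous_measurable2 oO cU.
have mmass : measurable_fun (Omega : set mplane) mass.
  exact: (open_continuous_measurable2 oO mass_continuous).
have mchi : measurable_fun (Omega : set mplane) chi by have [] := chi2.
have K0 : 0 <= C / b by rewrite divr_ge0// ltW.
have dist t y : 0 < t -> t <= T -> `|dotO u (kern t y) * chi y - U y * chi y| <= C / b * t `^ b.
  move=> t0 tT; rewrite -mulrBl normrM.
  have [h|/chi_out ->] := pselect (sqdist x0 y <= rho); last first.
    by rewrite normr0 mulr0 mulr_ge0// powR_ge0.
  rewrite -[leRHS]mulr1; apply: ler_pM => //.
  exact: (point_limit_dist M0 oO OM u2 b0 C0 decay t0 tT (discT _ h)).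
have leb_fin : (leb2 (Omega : set mplane) < +oo)%E := leb2_bounded_lty M0 oO OM.
have m2 t : 0 < t -> sqintO (fun y => dotO u (kern t y)).
  move=> t0; apply: (sqint_continuous M0 oO OM); first exact: (dot_kern_continuous M0 oO OM t0 u2).
  by move=> y _; exact: dot_kern_bounded.
have mc2 t : 0 < t -> sqintO (fun y => dotO u (kern t y) * chi y).
  move=> t0; apply: (sqint_bounded (C := nrmO u * (2 / t * nrmO one)) mO leb_fin).
    by apply: measurable_funM => //; have [] := m2 t t0.
  move=> y _; rewrite normrM -[leRHS]mulr1; apply: ler_pM => //.
  exact: dot_kern_bounded.
have Uc2 : sqintO (fun y => U y * chi y).
  apply: (sqint_bounded (C := nrmO u * (2 / T * nrmO one) + C / b * T `^ b) mO leb_fin).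
    exact: (measurable_funM mU mchi).
  move=> y _; have d := dist T y T0 (lexx T).
  have e : `|dotO u (kern T y) * chi y| <= nrmO u * (2 / T * nrmO one).
    by rewrite normrM -[leRHS]mulr1; apply: ler_pM => //; exact: dot_kern_bounded.
  have tri (p q : R) : `|q| <= `|p| + `|p - q|.
    by rewrite -[X in `|X| <= _](_ : p - (p - q) = q); [exact: ler_normB|ring].
  apply: le_trans (tri (dotO u (kern T y) * chi y) _) _.
  exact: (lerD e d).
have cu2 : sqintO (fun y => mass y * chi y * u y).
  have [_ u2i] := u2; split; first by apply: measurable_funM => //; exact: measurable_funM.
  apply: (le_integrableR mO _ (integrableZR mO (8 ^+ 2) u2i)).
    by apply: measurable_funX; apply: measurable_funM => //; exact: measurable_funM.
  move=> y Oy /=; rewrite ger0_norm ?sqr_ge0// exprMn ler_wpM2r ?sqr_ge0//.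
  rewrite -(real_normK (num_real (mass y * chi y))) lerXn2r ?nnegrE// normrM.
  by rewrite -[leRHS]mulr1; apply: ler_pM => //; exact: mass_le.
have key F : test_function Omega F ->
    dotO ((fun y => U y * chi y) \- (fun y => mass y * chi y * u y)) F = 0.
  move=> tF; have F2 := test_function_sqint M0 oO OM tF.
  have [sF _ _] := tF.
  have tv := test_functionM tchi sF; have v2 := test_function_sqint M0 oO OM tv.
  have [B vB] := test_function_bounded tv.
  rewrite dotBl//; apply/eqP; rewrite subr_eq0; apply/eqP.
  have l1 : dotO (fun y => dotO u (kern n.+1%:R^-1 y)) (chi * F) @[n --> \oo] -->
      dotO (fun y => U y * chi y) F.
    apply/cvgrPdist_le => e e0.
    have ep : 0 < e / (nrmO F * nrmO one + 1).
      by rewrite divr_gt0// ltr_wpDl// mulr_ge0 ?nrm_ge0.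
    have [tau tau0 Htau] := small_powR K0 b0 ep.
    have mt : 0 < Num.min T tau by rewrite lt_min T0.
    have [N _ HN] := near_infty_natSinv_lt (PosNum mt).
    exists N => // n Nn /=.
    have /= := HN n Nn; rewrite lt_min => /andP[/ltW tT /ltW nr].
    set t := n.+1%:R^-1 in tT nr *.
    have t0 : 0 < t by rewrite invr_gt0.
    have -> : dotO (fun y => dotO u (kern t y)) (chi * F) =
        dotO (fun y => dotO u (kern t y) * chi y) F.
      by apply: eq_Rintegral => y _; exact: mulrA.
    rewrite distrC -(dotBl mO (mc2 t t0) Uc2 F2).
    apply: le_trans (dot_norm_le mO (sqintB mO (mc2 t t0) Uc2) F2) _.
    have h : nrmO ((fun y => dotO u (kern t y) * chi y) \- (fun y => U y * chi y)) <=
        e / (nrmO F * nrmO one + 1) * nrmO one.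
      apply: (nrm_le_cst M0 oO OM); first exact: (sqintB mO (mc2 t t0) Uc2).
        move=> y _; apply: le_trans (dist t y t0 tT) _; apply: Htau.
        by rewrite t0.
      exact: ltW.
    apply: le_trans (ler_wpM2r (nrm_ge0 leb2 (Omega : set mplane) F) h) _.
    have alg (p q : R) : 0 <= p -> 0 <= q -> e / (p * q + 1) * q * p <= e.
      move=> p0 q0; have pq := mulr_ge0 p0 q0.
      rewrite -mulrA (mulrC q) mulrAC ler_pdivrMr ?ltr_wpDl//.
      by rewrite ler_wpM2l ?(ltW e0)// lerDl.
    by apply: alg; exact: nrm_ge0.
  have l2 : dotO (fun y => dotO (chi * F) (kern n.+1%:R^-1 y)) u @[n --> \oo] -->
      dotO (fun y => mass y * (chi * F) y) u.
    apply: (@cvg_dot_dominated _ _ _ (8 * B)) => //.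
    - move=> n; apply: open_continuous_measurable2 => //.
      by apply: (dot_kern_continuous M0 oO OM) => //; rewrite invr_gt0.
    - by apply: measurable_funM => //; have [] := v2.
    - by move=> n y _; apply: dot_kern_le => //; rewrite invr_gt0.
    - move=> y Oy; apply: (cvg_dot_kern Oy v2 vB).
      by apply: smooth_continuous; exact: smoothM (let: And3 s _ _ := tchi in s) sF.
  have E : (fun n : nat => dotO (fun y => dotO u (kern n.+1%:R^-1 y)) (chi * F)) =
      (fun n : nat => dotO (fun y => dotO (chi * F) (kern n.+1%:R^-1 y)) u).
    apply/funext => n; have t0 : 0 < n.+1%:R^-1 :> R by rewrite invr_gt0.
    exact: (dot_kern_sym M0 oO OM t0 u2 v2).
  rewrite E in l1.
  apply: (etrans (cvg_unique (@Rhausdorff R) l1 l2)).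
  apply: eq_Rintegral => y _; rewrite mulrfctE.
  by ring.
(* chi does not vanish inside the disc, so it can be cancelled there. *)
have := test_functions_dense M0 oO OM eig (sqintB mO Uc2 cu2) key.
move=> ae0; exists [set y | sqdist x0 y < rho].
  apply: filterS (nbhsx_ballx x0 (r / 4) _); last by rewrite divr_gt0.
  move=> y []; rewrite /ball/= !(distrC x0.1) !(distrC x0.2) => h1 h2.
  rewrite /rho /sqdist.
  have q (p : R) : `|p| < r / 4 -> p ^+ 2 < (r / 4) ^+ 2.
    move=> h; rewrite -(real_normK (num_real p)) ltr_pXn2r ?nnegrE//.
    by rewrite divr_ge0// ltW.
  have := q _ h1; have := q _ h2; rewrite !exprMn.
  have : 0 <= r ^+ 2 by exact: sqr_ge0.
  by move=> *; lra.
apply: (@negligibleS _ mplane R leb2 _ _ _ ae0) => y [/= ny yr] h.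
have Oy := discO y (ltW yr).
have := h Oy; have cp : 0 < chi y.
  by apply: flat_gt0; rewrite subr_gt0 ltr_pdivrMr// mul1r.
move=> /eqP; rewrite mulrAC -mulrBl mulf_eq0 (gt_eqF cp) orbF subr_eq0.
exact/negP.
Qed.

End identify.
End representative.

(** * The state equation *)

(** A box is convex, so one that contains the vertices contains their hull. *)
Lemma convex_polygon_bounded (R : realType) (Omega : set (R * R)) :
  convex_polygon Omega -> exists2 M, 0 < M &
    open Omega /\ Omega `<=` `]- M, M[ `*` `]- M, M[.
Proof.
move=> [_ [V finV ->]].
have [M M0 VM] : exists2 M : R, 0 < M & V `<=` `]- M, M[ `*` `]- M, M[.
  have /finite_seqP[r Vr] := finV.
  exists (1 + \sum_(x <- r) (`|x.1| + `|x.2|)).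
    by rewrite ltr_pwDl// sumr_ge0// => x _; rewrite addr_ge0.
  move=> x; rewrite Vr /= => xr.
  have h : `|x.1| + `|x.2| <= \sum_(x <- r) (`|x.1| + `|x.2|).
    by rewrite (big_rem x)//= lerDl sumr_ge0.
  have h1 := normr_ge0 x.1; have h2 := normr_ge0 x.2.
  by split; rewrite /= in_itv/= -ltr_norml; lra.
exists M => //; split; first exact: open_interior.
apply: subset_trans (@interior_subset _ _) _.
apply: smallest_sub => // x y l; rewrite !inE => -[x1 x2] [y1 y2].
have l0 : 0 <= l%:num by exact: ge0.
have l1 : l%:num <= 1 by exact: le1.
move: x1 x2 y1 y2; rewrite /= !in_itv/= => /andP[a1 a2] /andP[b1 b2] /andP[c1 c2] /andP[d1 d2].
have key (p q : R) : - M < p -> p < M -> - M < q -> q < M ->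
    - M < l%:num * p + (1 - l%:num) * q < M.
  move=> p1 p2 q1 q2.
  have [e|e] := leP l%:num (1 / 2); apply/andP; split; nra.
by split; exact: key.
Qed.

Section state_equation.
Context {R : realType}.
Local Notation mplane := (measurableTypeR R * measurableTypeR R)%type.
Variables (Omega : set (R * R)) (M : R).
Hypothesis M0 : 0 < M.
Hypothesis oO : open Omega.
Hypothesis OM : Omega `<=` `]- M, M[ `*` `]- M, M[.
Local Notation sqintO := (sqint leb2 (Omega : set mplane)).
Local Notation dotO := (dot leb2 (Omega : set mplane)).
Local Notation nrmO := (nrm leb2 (Omega : set mplane)).
Implicit Types (f g h u v w : R * R -> R) (x y : R * R).
Variables (lam : nat -> R) (phi : nat -> R * R -> R) (s : R).
Hypothesis eig : dirichlet_eigensystem Omega lam phi.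
Hypothesis s12 : 1 / 2 < s.
Hypothesis s1 : s < 1.

Let mO : measurable (Omega : set mplane). Proof. exact: open_measurable2. Qed.
Let lam0 k : 0 < lam k. Proof. by have [] := eig.1 k. Qed.
Let p2 := eigen_sqint oO eig.
Let orth := eigen_orth eig.
Let basis := eigen_basis oO eig.

(** Testing the state equation with the eigenfunctions diagonalizes it. *)
Definition solves g u := sqintO u /\
  forall k, dotO u (phi k) = lam k `^ (- s) * dotO g (phi k).

Let Lam : R := (4 * M ^+ 2) `^ s.
Let Lam0 : 0 <= Lam. Proof. exact: powR_ge0. Qed.

(* The spectrum stays away from 0 by Poincare's inequality. *)
Let lamN_le k : lam k `^ (- s) <= Lam.
Proof.
have ok : dotO (phi k) (phi k) = 1 by rewrite orth eqxx.
have h := eigenvalue_ge M0 oO OM (eig.1 k) ok.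
have M2 : 0 < 4 * M ^+ 2 by rewrite mulr_gt0 ?exprn_gt0.
rewrite powRN -[leRHS]invrK lef_pV2 ?posrE ?invr_gt0 ?powR_gt0//.
rewrite -powRN /Lam.
have -> : (4 * M ^+ 2) `^ (- s) = (4 * M ^+ 2)^-1 `^ s.
  by rewrite -(powR_inv1 (ltW M2)) -powRrM mulN1r.
apply: ge0_ler_powR => //.
- by have := s12; lra.
- by rewrite nnegrE invr_ge0 ltW.
- by rewrite nnegrE ltW.
Qed.

Let coef_sqr_le g k : (lam k `^ (- s) * dotO g (phi k)) ^+ 2 <=
  Lam ^+ 2 * dotO g (phi k) ^+ 2.
Proof.
by rewrite exprMn ler_wpM2r ?sqr_ge0// lerXn2r ?nnegrE ?powR_ge0.
Qed.

Lemma solves_exists g : sqintO g -> exists u, solves g u.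
Proof.
move=> g2.
have cB n : \sum_(0 <= k < n) (lam k `^ (- s) * dotO g (phi k)) ^+ 2 <=
    Lam ^+ 2 * dotO g g.
  apply: (@le_trans _ _ (\sum_(0 <= k < n) Lam ^+ 2 * dotO g (phi k) ^+ 2)).
    by apply: ler_sum => k _; exact: coef_sqr_le.
  by rewrite -mulr_sumr ler_wpM2l ?sqr_ge0//; exact: (bessel mO p2 orth n g2).
have [u u2 uc] := riesz_fischer mO p2 orth cB.
by exists u.
Qed.

Lemma solves_nrm g u : sqintO g -> solves g u -> nrmO u <= Lam * nrmO g.
Proof.
move=> g2 [u2 ug]; apply: nrm_le; first by rewrite mulr_ge0 ?nrm_ge0.
have h := parseval mO p2 basis u2 u2.
rewrite -(cvg_lim (@Rhausdorff R) h); apply: limr_le; first exact: cvgP h.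
apply: nearW => n; rewrite exprMn nrm_sqr.
apply: (@le_trans _ _ (\sum_(0 <= k < n) Lam ^+ 2 * dotO g (phi k) ^+ 2)).
  by apply: ler_sum => k _; rewrite -expr2 ug; exact: coef_sqr_le.
by rewrite -mulr_sumr ler_wpM2l ?sqr_ge0//; exact: (bessel mO p2 orth n g2).
Qed.

Lemma solvesB g h u w : sqintO g -> sqintO h -> solves g u -> solves h w ->
  solves (g \- h) (u \- w).
Proof.
move=> g2 h2 [u2 ug] [w2 wh]; split; first exact: sqintB.
by move=> k; rewrite (dotBl mO u2 w2 (p2 k)) (dotBl mO g2 h2 (p2 k)) ug wh mulrBr.
Qed.

Lemma solves_mid g h u w : sqintO g -> sqintO h -> solves g u -> solves h w ->
  solves (fun x => 2^-1 * (g \+ h) x) (fun x => 2^-1 * (u \+ w) x).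
Proof.
move=> g2 h2 [u2 ug] [w2 wh]; split; first exact/sqintZ/sqintD.
move=> k; rewrite (dotZl mO _ (sqintD mO u2 w2) (p2 k)) (dotZl mO _ (sqintD mO g2 h2) (p2 k)).
by rewrite (dotDl mO u2 w2 (p2 k)) (dotDl mO g2 h2 (p2 k)) ug wh; ring.
Qed.

Lemma solves_unique g h u w : sqintO g -> sqintO h -> solves g u -> solves h w ->
  ae_eq leb2 (Omega : set mplane) g h -> ae_eq leb2 (Omega : set mplane) u w.
Proof.
move=> g2 h2 [u2 ug] [w2 wh] gh; apply: (coef_inj mO p2 basis u2 w2) => k.
by rewrite ug wh (ae_dot mO g2 h2 (p2 k) gh).
Qed.

(** The embedding of H^(2 s) into C(Omega): a solution with square-integrable
    right-hand side lies in H^(2 s), and 2 s > 1 is half the dimension. The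
    representative is the limit of the averages, divided by the mass of the kernel.
    It is bounded at x because it differs from the average at one fixed scale,
    which is bounded by Cauchy-Schwarz, by a multiple of the norm of g. *)
Lemma solves_representative : exists Cx : R * R -> R, forall g u, sqintO g ->
  solves g u -> exists v, [/\ {in Omega, continuous v},
    ae_eq leb2 (Omega : set mplane) v u &
    forall x, Omega x -> `|v x| <= Cx x * nrmO g].
Proof.
have b0 : 0 < s - 1 / 2 by have := s12; lra.
have /choice[Cx HC] (x : R * R) : exists C : R, Omega x -> forall g u, sqintO g -> solves g u ->
    `|point_limit Omega u x / mass Omega x| <= C * nrmO g.
  have [Ox|nO] := pselect (Omega x); last by exists 0.
  have [T T0 /nbhs_singleton dO] := disc_nbhs oO Ox.
  exists ((mass Omega x)^-1 * (Lam * (2 / T * nrmO (fun=> 1)) +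
    77 / (s - 1 / 2) * T `^ (s - 1 / 2))) => _ g u g2 sol.
  have [u2 ug] := sol.
  have C0 : 0 <= 77 * nrmO g by rewrite mulr_ge0 ?nrm_ge0.
  have dec t y : 0 < t -> (forall z, sqdist y z <= t -> Omega z) ->
      `|dotO u (dkern t y)| <= 77 * nrmO g * t `^ (s - 1 / 2 - 1).
    move=> t0 yO; rewrite (_ : s - 1 / 2 - 1 = s - 3 / 2); last by field.
    exact: (dkern_estimate M0 oO OM eig s12 s1 u2 g2 ug t0 yO).
  have d := point_limit_dist M0 oO OM u2 b0 C0 dec T0 (lexx T) dO.
  have e := dot_kern_bounded M0 oO OM u2 x T0.
  have n := solves_nrm g2 sol.
  have m0 := mass_gt0 M0 oO OM Ox.
  rewrite normrM normfV (gtr0_norm m0) [leLHS]mulrC -[leRHS]mulrA ler_wpM2l ?invr_ge0 ?(ltW m0)//.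
  have tri (p q : R) : `|q| <= `|p| + `|p - q|.
    by rewrite -[X in `|X| <= _](_ : p - (p - q) = q); [exact: ler_normB|ring].
  apply: le_trans (tri (dotO u (kern T x)) _) _.
  apply: le_trans (lerD e d) _; rewrite [leRHS]mulrDl; apply: lerD.
    rewrite [leRHS]mulrAC ler_wpM2r// mulr_ge0 ?nrm_ge0//.
    by rewrite divr_ge0// ltW.
  by rewrite le_eqVlt; apply/orP; left; apply/eqP; ring.
exists Cx => g u g2 sol; have [u2 ug] := sol.
exists (fun x => point_limit Omega u x / mass Omega x).
have C0 : 0 <= 77 * nrmO g by rewrite mulr_ge0 ?nrm_ge0.
have dec t y : 0 < t -> (forall z, sqdist y z <= t -> Omega z) ->
    `|dotO u (dkern t y)| <= 77 * nrmO g * t `^ (s - 1 / 2 - 1).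
  move=> t0 yO; rewrite (_ : s - 1 / 2 - 1 = s - 3 / 2); last by field.
  exact: (dkern_estimate M0 oO OM eig s12 s1 u2 g2 ug t0 yO).
split.
- move=> x Ox; have m0 : mass Omega x != 0.
    by rewrite gt_eqF// (mass_gt0 M0 oO OM)//; exact: set_mem.
  apply: cvgM; first exact: (point_limit_continuous M0 oO OM u2 b0 C0 dec).
  by apply: cvgV => //; exact: (mass_continuous M0 oO OM).
- have := point_limit_eq_mass M0 oO OM u2 b0 C0 dec eig.
  apply: filterS => x h Ox; rewrite (h Ox) mulrAC divff ?mul1r//.
  by rewrite gt_eqF// (mass_gt0 M0 oO OM).
- by move=> x Ox; exact: HC.
Qed.

(** Every eigenfunction is an admissible test function, and against phi_k the
    series defining the bilinear form has a single nonzero term. *)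
Lemma admissible_solves f g u : sqintO f -> sqintO g ->
  Hspace Omega lam phi s u -> state_equation Omega lam phi s f u g ->
  solves (f \+ g) u.
Proof.
move=> f2 g2 [/(L2_sqint mO) u2 _] st; split => // k.
have ser c : (fun n => \sum_(0 <= j < n) c j * (k == j)%:R : R) @ \oo --> c k.
  apply: (@cvg_near_cst nat R (c k)).
  exists k.+1 => // n kn /=.
  rewrite (bigD1_seq k) ?iota_uniq ?mem_index_iota//= eqxx mulr1 big1 ?addr0// => j jk.
  by rewrite eq_sym (negbTE jk) mulr0.
have Hk : Hspace Omega lam phi s (phi k).
  split; first exact/(L2_sqint mO)/p2.
  apply: (cvgP (lam k `^ s)); have := ser (fun j => lam j `^ s).
  rewrite (_ : (fun n => _) = series (fun j => lam j `^ s * `|coef Omega phi (phi k) j| ^+ 2))//.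
  apply/funext => n; apply: eq_bigr => j _.
  rewrite /coef -[L2dot _ _ _]/(dotO (phi k) (phi j)) orth.
  by case: (k == j); rewrite ?normr1 ?normr0 ?expr1n ?expr0n.
have := st _ Hk; rewrite /Bform -[L2dot _ _ _]/(dotO (f \+ g) (phi k)) => <-.
have -> : limn (series (fun j => lam j `^ s * coef Omega phi u j * coef Omega phi (phi k) j)) =
    lam k `^ s * dotO u (phi k).
  apply: cvg_lim => //; have := ser (fun j => lam j `^ s * dotO u (phi j)).
  rewrite (_ : (fun n => _) = series (fun j => lam j `^ s * coef Omega phi u j *
    coef Omega phi (phi k) j))//.
  apply/funext => n; apply: eq_bigr => j _.
  by rewrite /coef -[L2dot _ (phi k) _]/(dotO (phi k) (phi j)) orth.
rewrite mulrA -powRD ?addNr ?powRr0 ?mul1r//.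
by apply/implyP => _; rewrite gt_eqF.
Qed.

(** lam ^ s times the square of lam ^ (- s) is lam ^ (- s), which is bounded; so u
    has finite energy, and the state equation is Parseval's identity. *)
Lemma solves_admissible f g u : sqintO f -> sqintO g -> solves (f \+ g) u ->
  Hspace Omega lam phi s u /\ state_equation Omega lam phi s f u g.
Proof.
move=> f2 g2 [u2 ug]; have fg2 := sqintD mO f2 g2.
have lamK k : lam k `^ s * lam k `^ (- s) = 1.
  rewrite -powRD ?subrr ?powRr0//.
  by apply/implyP => _; rewrite gt_eqF.
split.
  split; first exact/(L2_sqint mO).
  apply: nondecreasing_is_cvgn.
    apply: nondecreasing_series => k _ _.
    by rewrite mulr_ge0 ?powR_ge0// sqr_ge0.
  exists (Lam * dotO (f \+ g) (f \+ g)) => _ [n _ <-] /=.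
  apply: (@le_trans _ _ (\sum_(0 <= k < n) Lam * dotO (f \+ g) (phi k) ^+ 2)).
    apply: ler_sum => k _.
    rewrite real_normK ?num_real// /coef -[L2dot _ _ _]/(dotO u (phi k)) ug.
    have alg (p q r : R) : p * (q * r) ^+ 2 = p * q * q * r ^+ 2 by ring.
    by rewrite alg lamK mul1r ler_wpM2r ?sqr_ge0.
  by rewrite -mulr_sumr ler_wpM2l//; exact: (bessel mO p2 orth n fg2).
move=> v [/(L2_sqint mO) v2 _]; apply: cvg_lim => //.
have := parseval mO p2 basis fg2 v2.
rewrite (_ : (fun n => _) = series (fun j => lam j `^ s * coef Omega phi u j *
    coef Omega phi v j))//.
apply/funext => n; apply: eq_bigr => k _; rewrite /coef.
by rewrite -[L2dot _ u _]/(dotO u (phi k)) ug mulrA lamK mul1r.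
Qed.

Lemma point_valueE v u x : {in Omega, continuous v} ->
  ae_eq leb2 (Omega : set mplane) v u -> Omega x -> point_value Omega u x = v x.
Proof.
move=> cv vu Ox; apply: xget_unique; first by exists v; split.
move=> _ [w [cw wu ->]]; apply: (ae_eq_continuous oO cw cv) => //.
exact: ae_eq_trans wu (ae_eq_sym vu).
Qed.

End state_equation.

(** * The optimal control *)

Section clamp.
Context {R : realType}.
Implicit Types a b p r : R.

Definition clamp a b r := Num.max a (Num.min b r).

Lemma clamp_itv a b r : a <= b -> a <= clamp a b r <= b.
Proof. by move=> ab; rewrite /clamp le_max lexx /= ge_max ab ge_min lexx. Qed.

Lemma clamp_id a b r : a <= r <= b -> clamp a b r = r.
Proof. by move=> /andP[ar rb]; rewrite /clamp (min_idPr rb) (max_idPr ar). Qed.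

(** The clamp of r is the point of the interval nearest to r. *)
Lemma clamp_dist a b p r : a <= p <= b -> `|clamp a b r - r| <= `|p - r|.
Proof.
move=> /andP[ap pb]; rewrite /clamp.
have [br|rb] := leP b r.
  rewrite (max_idPr (le_trans ap pb)) !ler0_norm; lra.
have [ra|ar] := leP a r; last by rewrite !ger0_norm; lra.
by rewrite subrr normr0.
Qed.

End clamp.

Lemma cvg_sum_seq (R : realType) (T : eqType) (r : seq T) (F : nat -> T -> R) (l : T -> R) :
  (forall i, i \in r -> F n i @[n --> \oo] --> l i) ->
  \sum_(i <- r) F n i @[n --> \oo] --> \sum_(i <- r) l i.
Proof.
elim: r => [|i r IH] Fl.
  by under eq_fun do rewrite big_nil; rewrite big_nil; exact: cvg_cst.
under eq_fun do rewrite big_cons; rewrite big_cons; apply: cvgD.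
  by apply: Fl; rewrite mem_head.
by apply: IH => j jr; apply: Fl; rewrite in_cons jr orbT.
Qed.

Section optimal_control.
Context {R : realType}.
Local Notation mplane := (measurableTypeR R * measurableTypeR R)%type.
Variables (Omega : set (R * R)) (M : R).
Hypothesis M0 : 0 < M.
Hypothesis oO : open Omega.
Hypothesis OM : Omega `<=` `]- M, M[ `*` `]- M, M[.
Local Notation sqintO := (sqint leb2 (Omega : set mplane)).
Local Notation dotO := (dot leb2 (Omega : set mplane)).
Local Notation nrmO := (nrm leb2 (Omega : set mplane)).
Variables (lam : nat -> R) (phi : nat -> R * R -> R) (s : R).
Variables (D : set (R * R)) (ud : R * R -> R) (alpha : R) (f : R * R -> R) (a b : R).
Hypothesis eig : dirichlet_eigensystem Omega lam phi.
Hypothesis s12 : 1 / 2 < s.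
Hypothesis s1 : s < 1.
Hypothesis finD : finite_set D.
Hypothesis DO : D `<=` Omega.
Hypothesis alpha0 : 0 < alpha.
Hypothesis f_L2 : L2 Omega f.
Hypothesis ab : a < b.
Implicit Types (g h u v w p q : R * R -> R) (x y z : R * R).

Let mO : measurable (Omega : set mplane). Proof. exact: open_measurable2. Qed.
Let f2 : sqintO f. Proof. exact/(L2_sqint mO). Qed.

Local Notation adm := (admissible Omega lam phi s f a b).
Local Notation cost := (J Omega D ud alpha).
Local Notation solves := (solves Omega lam phi s).
Local Notation val := (point_value Omega).

Let adm_sqint u q : adm u q -> sqintO q.
Proof. by move=> [_ [/(L2_sqint mO)]]. Qed.

Let adm_solves u q : adm u q -> solves (f \+ q) u.
Proof.
by move=> [Hu [/(L2_sqint mO) q2 _] st]; exact: (admissible_solves oO eig f2 q2 Hu st).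
Qed.

Let solves_adm u q : Qad Omega a b q -> solves (f \+ q) u -> adm u q.
Proof.
move=> Q sol; have q2 : sqintO q by apply/(L2_sqint mO); case: Q.
by have [h1 h2] := solves_admissible M0 oO OM eig s12 f2 q2 sol; split.
Qed.

(** Clamping gives the pointwise nearest function with values between the bounds,
    so the clamp r of the limit q is at least as close to q as every q_ n. Hence
    |r - q| = 0, and q inherits the bounds almost everywhere. *)
Lemma Qad_closed (q_ : nat -> R * R -> R) q : (forall n, Qad Omega a b (q_ n)) ->
  sqintO q -> (forall e, 0 < e -> exists n, nrmO (q_ n \- q) <= e) -> Qad Omega a b q.
Proof.
move=> Q q2 qq; split; first exact/(L2_sqint mO).
pose r x := clamp a b (q x).
have [mq _] := q2.
have rb x : a <= r x <= b by apply: clamp_itv; exact: ltW.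
have r2 : sqintO r.
  apply: (@sqint_bounded _ mplane R leb2 Omega r (`|a| + `|b|)) => //.
  - exact: leb2_bounded_lty M0 oO OM.
  - apply: measurable_maxr; first exact: measurable_cst.
    by apply: measurable_minr => //; exact: measurable_cst.
  - move=> x _; have /andP[r1 r3] := rb x.
    have := ler_norm b; have := ler_norm (- a); rewrite normrN.
    have := normr_ge0 a; have := normr_ge0 b.
    by rewrite ler_norml => *; apply/andP; split; lra.
have small e : 0 < e -> nrmO (r \- q) <= e.
  move=> /qq[n qn]; apply: le_trans qn.
  have [/(L2_sqint mO) n2 nab] := Q n; have [mn _] := n2.
  pose qn x := clamp a b (q_ n x).
  have nqn : ae_eq leb2 (Omega : set mplane) (q_ n) qn.
    by apply: (@filterS mplane _ (ae_filter_ringOfSetsType leb2) _ _ _ nab) => x h Ox; rewrite /qn clamp_id// h.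
  have qn2 : sqintO qn.
    apply: (ae_sqint mO _ nqn n2); apply: measurable_maxr; first exact: measurable_cst.
    by apply: measurable_minr => //; exact: measurable_cst.
  have E : dotO (qn \- q) (qn \- q) = dotO (q_ n \- q) (q_ n \- q).
    rewrite (dotBB mO qn2 q2) (dotBB mO n2 q2).
    rewrite (ae_dot mO n2 qn2 n2 nqn) (ae_dot mO n2 qn2 q2 nqn).
    by rewrite [dotO qn (q_ n)]dotC (ae_dot mO n2 qn2 qn2 nqn).
  rewrite /nrm -E; apply: ler_wsqrtr; apply: le_Rintegral => //.
  - exact: (sqint_mul mO (sqintB mO r2 q2) (sqintB mO r2 q2)).
  - exact: (sqint_mul mO (sqintB mO qn2 q2) (sqintB mO qn2 q2)).
  - move=> x _ /=; rewrite -!expr2.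
    rewrite -(real_normK (num_real (r x - q x))) -(real_normK (num_real (qn x - q x))).
    rewrite lerXn2r ?nnegrE//; apply: clamp_dist; apply: clamp_itv; exact: ltW.
have rq0 : dotO (r \- q) (r \- q) = 0.
  apply/eqP; rewrite -nrm_sqr sqrf_eq0 -[_ == 0]/(_ == _) eq_le nrm_ge0 andbT.
  by apply/ler_addgt0Pl => e /small; rewrite addr0.
have := dot_indep_ae mO r2 q2 rq0; apply: filterS => x h Ox.
by rewrite -(h Ox).
Qed.

Lemma sqint_bounds_Qad q : measurable_fun (Omega : set mplane) q ->
  (forall x, a <= q x <= b) -> Qad Omega a b q.
Proof.
move=> mq qab; split; last by apply: aeW => x _; exact: qab.
apply/(L2_sqint mO).
apply: (@sqint_bounded _ mplane R leb2 Omega q (`|a| + `|b|)) => //.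
  exact: leb2_bounded_lty M0 oO OM.
move=> x _; have /andP[r1 r3] := qab x.
have := ler_norm b; have := ler_norm (- a); rewrite normrN.
have := normr_ge0 a; have := normr_ge0 b.
by rewrite ler_norml => *; apply/andP; split; lra.
Qed.

Let midf p q : R * R -> R := fun x => 2^-1 * (p \+ q) x.

Lemma Qad_mid p q : Qad Omega a b p -> Qad Omega a b q -> Qad Omega a b (midf p q).
Proof.
move=> [/(L2_sqint mO) p2 pab] [/(L2_sqint mO) q2 qab]; split.
  by apply/(L2_sqint mO)/sqintZ => //; exact: sqintD.
apply: (@filterS2 mplane _ (ae_filter_ringOfSetsType leb2) _ _ _ _ pab qab) => x h1 h2 Ox.
have /andP[a1 a2] := h1 Ox; have /andP[a3 a4] := h2 Ox.
by rewrite /midf /=; apply/andP; split; lra.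
Qed.

Lemma adm_mid u v p q : adm u p -> adm v q -> adm (midf u v) (midf p q).
Proof.
move=> A1 A2; have p2 := adm_sqint A1; have q2 := adm_sqint A2.
apply: solves_adm; first by apply: Qad_mid; [case: A1|case: A2].
have := solves_mid oO eig (sqintD mO f2 p2) (sqintD mO f2 q2) (adm_solves A1) (adm_solves A2).
rewrite (_ : (fun x => 2^-1 * ((f \+ p) \+ (f \+ q)) x) = f \+ midf p q)//.
by apply/funext => x; rewrite /midf /=; field.
Qed.

(** The state equation is linear, and continuous representatives are unique; so the
    representative of a combination of states is the combination of the
    representatives, and the evaluation bound for the right-hand side p - q applies
    to a difference of states. *)
Lemma point_value_control : exists Cx : R * R -> R, forall u v p q,
  adm u p -> adm v q -> forall z, Omega z ->
  `|val u z - val v z| <= Cx z * nrmO (p \- q) /\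
  val (midf u v) z = 2^-1 * (val u z + val v z).
Proof.
have [Cx HC] := solves_representative M0 oO OM eig s12 s1.
exists Cx => u v p q A1 A2 z Oz.
have p2 := adm_sqint A1; have q2 := adm_sqint A2.
have fp2 := sqintD mO f2 p2; have fq2 := sqintD mO f2 q2.
have S1 := adm_solves A1; have S2 := adm_solves A2.
have [ru [cu uu _]] := HC _ _ fp2 S1.
have [rv [cv vv _]] := HC _ _ fq2 S2.
have SB := solvesB oO eig fp2 fq2 S1 S2.
have [rw [cw ww wb]] := HC _ _ (sqintB mO fp2 fq2) SB.
rewrite (point_valueE oO cu uu Oz) (point_valueE oO cv vv Oz); split.
  have -> : ru z - rv z = rw z.
    have cB : {in Omega, continuous (ru \- rv)}.
      by move=> y Oy; apply: cvgB; [exact: cu|exact: cv].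
    apply: (ae_eq_continuous oO cB cw _ Oz).
    apply: filterS3 uu vv ww => y h1 h2 h3 Oy.
    by rewrite /= h1// h2// h3.
  have := wb z Oz; rewrite (_ : (f \+ p) \- (f \+ q) = p \- q)//.
  by apply/funext => y /=; ring.
have cM : {in Omega, continuous (fun x => 2^-1 * (ru x + rv x))}.
  move=> y Oy; apply: cvgM; first exact: cvg_cst.
  by apply: cvgD; [exact: cu|exact: cv].
have eM : ae_eq leb2 (Omega : set mplane) (fun x => 2^-1 * (ru x + rv x)) (midf u v).
  by apply: filterS2 uu vv => y h1 h2 Oy; rewrite /midf /= h1// h2.
exact: (point_valueE oO cM eM Oz).
Qed.

(* The sum over the finite set D, as a sum over a list of points of Omega. *)
Let obs : exists r : seq (R * R), (forall z, z \in r -> Omega z) /\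
  forall F : R * R -> R, \sum_(z \in D) F z = \sum_(z <- r) F z.
Proof.
exists (finmap.enum_fset (fset_set D)); split; last by move=> F; exact: fsbig_finite.
by move=> z zD; apply: DO; have := in_fset_set finD z; rewrite [LHS]zD => /esym/set_mem.
Qed.

(** The control term obeys the parallelogram law exactly; the tracking term is a
    convex function of point values, and these are affine in the control. *)
Lemma cost_mid u v p q : adm u p -> adm v q ->
  cost (midf u v) (midf p q) <=
    (cost u p + cost v q) / 2 - alpha / 8 * nrmO (p \- q) ^+ 2.
Proof.
move=> A1 A2; have p2 := adm_sqint A1; have q2 := adm_sqint A2.
have [Cx HC] := point_value_control; have [r [rO sumE]] := obs.
have L q' : sqintO q' -> L2norm Omega q' = nrmO q'.
  by move=> ?; apply: L2norm_nrm => //; exact/(L2_sqint mO).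
have pq2 := sqintD mO p2 q2.
rewrite /J !sumE (L _ p2) (L _ q2) (L (midf p q)); last exact: sqintZ.
have E : nrmO (midf p q) ^+ 2 = (nrmO p ^+ 2 + nrmO q ^+ 2) / 2 - nrmO (p \- q) ^+ 2 / 4.
  rewrite /midf (nrmZ mO _ pq2) exprMn !nrm_sqr (dotBB mO p2 q2) (dotDD mO p2 q2).
  by rewrite ger0_norm ?invr_ge0//; field.
have S : \sum_(z <- r) `|val (midf u v) z - ud z| ^+ 2 <=
    (\sum_(z <- r) `|val u z - ud z| ^+ 2 + \sum_(z <- r) `|val v z - ud z| ^+ 2) / 2.
  rewrite -big_split/= mulr_suml big_seq [leRHS]big_seq; apply: ler_sum => z zr.
  have [_ ->] := HC _ _ _ _ A1 A2 z (rO z zr).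
  rewrite !real_normK ?num_real//.
  by have := sqr_ge0 (val u z - val v z); nra.
rewrite E; move: S; set S1 := \sum_(z <- r) _; set S2 := \sum_(z <- r) _; set S3 := \sum_(z <- r) _.
by move=> S; nra.
Qed.

Lemma cost_ge0 u q : adm u q -> 0 <= cost u q.
Proof.
move=> A; have [r [_ sumE]] := obs; rewrite /J sumE.
apply: addr_ge0; apply: mulr_ge0.
- by rewrite invr_ge0.
- by apply: sumr_ge0 => z _; exact: sqr_ge0.
- by rewrite divr_ge0// ltW.
- exact: sqr_ge0.
Qed.

Lemma cvg_cost (u_ q_ : nat -> R * R -> R) u q : (forall n, adm (u_ n) (q_ n)) ->
  adm u q -> nrmO (q_ n \- q) @[n --> \oo] --> 0 ->
  cost (u_ n) (q_ n) @[n --> \oo] --> cost u q.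
Proof.
move=> An A qn; have q2 := adm_sqint A; have qn2 n := adm_sqint (An n).
have [Cx HC] := point_value_control; have [r [rO sumE]] := obs.
have L q' : sqintO q' -> L2norm Omega q' = nrmO q'.
  by move=> ?; apply: L2norm_nrm => //; exact/(L2_sqint mO).
have dist0 (w : nat -> R) (l C : R) : (forall n, `|w n - l| <= C * nrmO (q_ n \- q)) ->
    w n @[n --> \oo] --> l.
  move=> h; apply/cvgrPdist_le => e e0.
  have C1 : 0 < `|C| + 1 by rewrite ltr_wpDl.
  have /cvgrPdist_le/(_ _ (divr_gt0 e0 C1)) := qn; apply: filterS => n.
  rewrite sub0r normrN ger0_norm ?nrm_ge0// ler_pdivlMr// mulrC => hn.
  rewrite distrC; apply: le_trans (h n) _; apply: le_trans hn.
  rewrite ler_wpM2r ?nrm_ge0//; apply: le_trans (ler_norm C) _.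
  by rewrite lerDl.
have nq : nrmO (q_ n) @[n --> \oo] --> nrmO q.
  apply: (dist0 _ _ 1) => n; rewrite mul1r ler_norml.
  have h1 := nrm_approx oO q2 (qn2 n); rewrite nrmB in h1.
  have h2 := nrm_approx oO (qn2 n) q2.
  by apply/andP; split; lra.
have vz z : z \in r -> val (u_ n) z @[n --> \oo] --> val u z.
  move=> zr; apply: (dist0 _ _ (Cx z)) => n.
  by have [] := HC _ _ _ _ (An n) A z (rO z zr).
have -> : cost u q = 2^-1 * \sum_(z <- r) (val u z - ud z) * (val u z - ud z)
    + alpha / 2 * (nrmO q * nrmO q).
  rewrite /J sumE (L _ q2) expr2; congr (_ * _ + _); apply: eq_bigr => z _.
  by rewrite real_normK ?num_real// expr2.
have -> : (fun n => cost (u_ n) (q_ n)) =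
  (fun n => 2^-1 * \sum_(z <- r) (val (u_ n) z - ud z) * (val (u_ n) z - ud z)
    + alpha / 2 * (nrmO (q_ n) * nrmO (q_ n))).
  apply/funext => n.
  rewrite /J sumE (L _ (qn2 n)) expr2; congr (_ * _ + _); apply: eq_bigr => z _.
  by rewrite real_normK ?num_real// expr2.
apply: cvgD; apply: cvgM; [exact: cvg_cst| |exact: cvg_cst|exact: cvgM].
apply: cvg_sum_seq => z zr.
by apply: cvgM; apply: cvgB; solve [exact: vz|exact: cvg_cst].
Qed.

Lemma adm_nonempty : exists u q, adm u q.
Proof.
have Q : Qad Omega a b (fun=> a).
  by apply: sqint_bounds_Qad => // x; rewrite lexx ltW.
have q2 : sqintO (fun=> a) by apply/(L2_sqint mO); case: Q.
have [u sol] := solves_exists M0 oO OM eig s12 (sqintD mO f2 q2).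
by exists u, (fun=> a); exact: solves_adm.
Qed.

(** By uniform convexity every minimizing sequence of controls is Cauchy in L^2, so
    it converges strongly and continuity of the cost suffices. *)
Lemma optimal_exists : exists u q, optimal Omega lam phi s D ud alpha f a b u q.
Proof.
have [u0 [q0 A0]] := adm_nonempty.
pose E : set R := [set c | exists u q, adm u q /\ c = cost u q].
have infE : has_inf E.
  split; first by exists (cost u0 q0), u0, q0.
  by exists 0 => _ [u [q [A ->]]]; exact: cost_ge0.
pose m := inf E.
have mle u q : adm u q -> m <= cost u q.
  by move=> A; apply: ge_inf; [case: infE|exists u, q].
have /choice[w Hw] (n : nat) : exists w : (R * R -> R) * (R * R -> R),
    adm w.1 w.2 /\ cost w.1 w.2 < m + n.+1%:R^-1.
  have n0 : 0 < n.+1%:R^-1 :> R by rewrite invr_gt0.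
  have [_ [u [q [A ->]]] h] := inf_adherent n0 infE.
  by exists (u, q).
pose q_ n := (w n).2; pose u_ n := (w n).1.
have An n : adm (u_ n) (q_ n) by have [] := Hw n.
have qn2 n : sqintO (q_ n) := adm_sqint (An n).
have gap n k : alpha / 8 * nrmO (q_ n \- q_ k) ^+ 2 <= (n.+1%:R^-1 + k.+1%:R^-1) / 2.
  have h := cost_mid (An n) (An k).
  have h1 := mle _ _ (adm_mid (An n) (An k)).
  have [_ h2] := Hw n; have [_ h3] := Hw k.
  have alg (c1 c2 c3 d r1 r2 mm : R) : c3 <= (c1 + c2) / 2 - d -> mm <= c3 ->
    c1 < mm + r1 -> c2 < mm + r2 -> d <= (r1 + r2) / 2 by move=> *; lra.
  exact: (alg _ _ _ _ _ _ _ h h1 h2 h3).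
have cauchy_q e : 0 < e -> exists N : nat, forall n k, (N <= n)%N -> (N <= k)%N ->
    nrmO (q_ n \- q_ k) <= e.
  move=> e0; have d0 : 0 < alpha / 8 * e ^+ 2.
    by rewrite mulr_gt0 ?exprn_gt0// divr_gt0.
  have [N _ HN] := near_infty_natSinv_lt (PosNum d0).
  exists N => n k Nn Nk; have /= h1 := HN n Nn; have /= h2 := HN k Nk.
  have h := gap n k.
  rewrite -(@ler_pXn2r _ 2)// ?nnegrE ?nrm_ge0 ?(ltW e0)//.
  have a8 : 0 < alpha / 8 by rewrite divr_gt0.
  rewrite -(ler_pM2l a8).
  have alg (d r1 r2 t : R) : d <= (r1 + r2) / 2 -> r1 < t -> r2 < t -> d <= t.
    by move=> *; lra.
  exact: (alg _ _ _ _ h h1 h2).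
have [q q2 qlim] := sqint_complete mO qn2 cauchy_q.
have Q : Qad Omega a b q.
  apply: (@Qad_closed q_) => // [n|e e0]; first by case: (An n).
  by have [N HN] := qlim e e0; exists N; exact: HN.
have [u sol] := solves_exists M0 oO OM eig s12 (sqintD mO f2 q2).
have A := solves_adm Q sol.
exists u, q; split => // v p Av.
apply: le_trans (mle _ _ Av).
have q0lim : nrmO (q_ n \- q) @[n --> \oo] --> 0.
  apply/cvgrPdist_le => e e0; have [N HN] := qlim e e0; exists N => // n Nn.
  by rewrite /= sub0r normrN ger0_norm ?nrm_ge0//; exact: HN.
have c := cvg_cost An A q0lim.
apply/ler_addgt0Pl => e e0.
have e2 : 0 < e / 2 by rewrite divr_gt0.
have /cvgrPdist_le/(_ _ e2)[N _ HN] := c.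
have [N' _ HN'] := near_infty_natSinv_lt (PosNum e2).
have /= h1 := HN _ (leq_maxl N N'); have /= h2 := HN' _ (leq_maxr N N').
have [_ h3] := Hw (maxn N N').
have alg (x1 x2 r mm : R) : `|x1 - x2| <= e / 2 -> r < e / 2 -> x2 < mm + r ->
    x1 <= e + mm.
  by rewrite ler_norml => /andP[? ?] ? ?; lra.
exact: (alg _ _ _ _ h1 h2 h3).
Qed.

(** Two minimizers at positive distance would both be beaten by their midpoint. *)
Lemma optimal_unique u v p q : optimal Omega lam phi s D ud alpha f a b u q ->
  optimal Omega lam phi s D ud alpha f a b v p ->
  eq_ae Omega v u /\ eq_ae Omega p q.
Proof.
move=> [Au Ju] [Av Jv].
have p2 := adm_sqint Av; have q2 := adm_sqint Au.
have h := cost_mid Av Au; have h1 := Ju _ _ (adm_mid Av Au); have h2 := Jv _ _ Au.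
have le0 : alpha / 8 * nrmO (p \- q) ^+ 2 <= 0.
  have alg (c1 c2 c3 d : R) : c3 <= (c1 + c2) / 2 - d -> c2 <= c3 -> c1 <= c2 -> d <= 0.
    by move=> *; lra.
  exact: (alg _ _ _ _ h h1 h2).
have a8 : 0 < alpha / 8 by rewrite divr_gt0.
have pq0 : dotO (p \- q) (p \- q) = 0.
  apply/eqP; rewrite eq_le dot_ge0 andbT -nrm_sqr.
  by rewrite -(pmulr_rle0 _ a8).
have pq := dot_indep_ae mO p2 q2 pq0.
split; last exact: pq.
apply: (solves_unique oO eig (sqintD mO f2 p2) (sqintD mO f2 q2)
  (adm_solves Av) (adm_solves Au)).
apply: (@filterS mplane _ (ae_filter_ringOfSetsType leb2) _ _ _ pq) => x hx Ox.
by rewrite /= hx.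
Qed.

End optimal_control.

Theorem theorem4p1 (R : realType) (Omega : set (R * R))
    (lam : nat -> R) (phi : nat -> R * R -> R) (s : R)
    (D : set (R * R)) (ud : R * R -> R) (alpha : R) (f : R * R -> R) (a b : R)
    (polyOmega : convex_polygon Omega)
    (eigOmega : dirichlet_eigensystem Omega lam phi)
    (s_gt : 1 / 2 < s) (s_lt : s < 1)
    (D_fin : finite_set D) (D_sub : D `<=` Omega)
    (alpha_gt0 : 0 < alpha) (f_L2 : L2 Omega f) (ab : a < b) :
  exists u q : R * R -> R,
    optimal Omega lam phi s D ud alpha f a b u q /\
    (forall v p : R * R -> R,
       optimal Omega lam phi s D ud alpha f a b v p ->
       eq_ae Omega v u /\ eq_ae Omega p q).
Proof.
have [M M0 [oO OM]] := convex_polygon_bounded polyOmega.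
have [u [q opt]] := optimal_exists M0 oO OM ud eigOmega s_gt s_lt D_fin D_sub alpha_gt0 f_L2 ab.
exists u, q; split => // v p optv.
exact: (optimal_unique M0 oO OM eigOmega s_gt s_lt D_fin D_sub alpha_gt0 f_L2 opt optv).
Qed.
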